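(* If $\mathcal{A}$ is an uncountable well presented infinite time decidable model in a language coded by a writable real, then there is an infinite time decidable, countable elementary substructure $\mathcal{B}\prec\mathcal{A}$.
   Context: Infinite time Turing machines: three-tape machines with finite programs; successor steps as classically; at limit stages the head returns to the leftmost cell, a special limit state is entered and each cell takes the $\limsup$ of its previous values. Reals are elements of $2^\omega$; (infinite time) computable functions and decidable sets of reals are those computed/decided by such machines; a real is writable if it is the output of some program on input $0$. Languages are computably presented (symbols have real Gödel codes, the set of codes decidable, kind/arity computable, logical symbols coded in $\mathbb{N}$); the language is coded by a writable real if some writable real lists the Gödel codes of all its symbols. A decidable model is a structure whose universe $A$ is a decidable set of reals and whose elementary diagram is decidable. A real codes a sequence $\langle x_\beta:\beta\le\alpha\rangle$ of reals if it codes a pair $(z,x)$ where $z$ codes a well order $\lhd$ on a subset of $\mathbb{N}$ of type $\alpha+1$ and $x_\beta=(m\mapsto x(\langle n,m\rangle))$ for $n$ the $\beta$-th element of $\lhd$. A model $\mathcal{A}=\langle A,\dots\rangle$ is well presented if there is an enumeration $\langle s_\alpha:\alpha<\delta\rangle$, $\delta\le\omega_1$, including every Gödel code of a symbol of the language and every element of $A$, such that from $s_\alpha$ one can compute (uniformly) a real coding $\langle s_\beta:\beta\le\alpha\rangle$. *)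

(* Defs.v *)
From Stdlib Require Cantor.
From mathcomp Require Import all_boot.
From mathcomp Require Import boolp classical_sets functions cardinality.
From mathcomp Require wochoice.

Set Implicit Arguments.
Unset Strict Implicit.
Unset Printing Implicit Defensive.

Local Open Scope classical_set_scope.

(* A well-ordered class of stages or indices is a type [W]
   with a non-strict relation [R : rel W] such that [wochoice.well_order R];
   an ordinal is represented by any such pair of that order type. *)

Definition real := nat -> bool.

(* n is identified with the real 1 ... 1 0 0 ..., with n ones. *)
Definition real_of_nat (n : nat) : real := fun k => k < n.

Definition npair (n m : nat) : nat := Cantor.to_nat (n, m).

Definition rpair (x y : real) : real := fun k => if odd k then y k./2 else x k./2.

Definition column (x : real) (n : nat) : real := fun m => x (npair n m).

(* Column 0 holds the length of [s], column i.+1 its i-th entry. *)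
Definition rseq (s : seq real) : real := fun k =>
  let: (i, j) := Cantor.of_nat k in
  if i is i'.+1 then nth (real_of_nat 0) s i' j else real_of_nat (size s) j.

Definition wlt (W : Type) (R : rel W) (v w : W) : bool := R v w && ~~ R w v.

Definition is_least (W : Type) (R : rel W) (w : W) : Prop := forall v, R w v.

Definition is_succ (W : Type) (R : rel W) (v w : W) : Prop :=
  wlt R v w /\ forall u, wlt R v u -> R w u.

Definition is_limit (W : Type) (R : rel W) (w : W) : Prop :=
  (exists v, wlt R v w) /\
  forall v, wlt R v w -> exists2 u, wlt R v u & wlt R u w.

(* The limsup of the bits [b u] for u below w: it is 1 iff [b] takes the
   value 1 cofinally often below w. *)
Definition limsup_below (W : Type) (R : rel W) (w : W) (b : W -> bool) : bool :=
  `[< forall v, wlt R v w -> exists2 u, R v u && wlt R u w & b u >].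

Inductive state (n : nat) : Type :=
  | Start | Limit | Halt | Ordinary of 'I_n.

Arguments Start {n}.
Arguments Limit {n}.
Arguments Halt {n}.

(* The three bits are those under the head on the input, scratch and output
   tapes; the last component of an instruction is the direction of the move,
   [true] for right.  The instructions for [Halt] are never used. *)
Record program : Type := Program {
  nstates : nat;
  trans : state nstates -> bool * bool * bool ->
          state nstates * (bool * bool * bool) * bool }.

Record config (n : nat) : Type := Config {
  cstate : state n;
  head : nat;
  input : real;
  scratch : real;
  output : real }.

Definition write (t : real) (h : nat) (b : bool) : real :=
  fun k => if k == h then b else t k.

Definition init_config (n : nat) (x : real) : config n :=
  Config Start 0 x (real_of_nat 0) (real_of_nat 0).

(* A head told to move left from the leftmost cell stays there. *)
Definition step (p : program) (c : config (nstates p)) : config (nstates p) :=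
  let h := head c in
  let: (q, (a, b, o), d) :=
    trans (cstate c) (input c h, scratch c h, output c h) in
  Config q (if d then h.+1 else h.-1)
    (write (input c) h a) (write (scratch c) h b) (write (output c) h o).

Definition limit_config (n : nat) (W : Type) (R : rel W) (w : W)
    (c : W -> config n) : config n :=
  Config Limit 0
    (fun k => limsup_below R w (fun v => input (c v) k))
    (fun k => limsup_below R w (fun v => scratch (c v) k))
    (fun k => limsup_below R w (fun v => output (c v) k)).

Record is_run (p : program) (x : real) (W : Type) (R : rel W)
    (c : W -> config (nstates p)) : Prop := IsRun {
  run_wo : wochoice.well_order R;
  run_init : forall w, is_least R w -> c w = init_config (nstates p) x;
  run_succ : forall v w, is_succ R v w -> c w = step (c v);
  run_limit : forall w, is_limit R w -> c w = limit_config R w c }.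

(* [p] on input [x] halts with output [y]: its computation, carried along some
   ordinal, is in the halt state for the first time at stage [w], with [y] on
   the output tape. *)
Definition computes (p : program) (x y : real) : Prop :=
  exists (W : Type) (R : rel W) (c : W -> config (nstates p)) (w : W),
    [/\ is_run x R c, cstate (c w) = Halt,
        forall v, wlt R v w -> cstate (c v) <> Halt & output (c w) = y].

Definition decidable_set (A : set real) : Prop :=
  exists p, forall x, computes p x (real_of_nat (x \in A)).

Definition writable (y : real) : Prop := exists p, computes p (real_of_nat 0) y.

(* Constant symbols are the function symbols of arity 0. *)
Record language : Type := Language {
  fsym : Type;
  rsym : Type;
  farity : fsym -> nat;
  rarity : rsym -> nat;
  gcode : fsym + rsym -> real }.

Definition symbol_codes (L : language) : set real := range (@gcode L).

(* All natural numbers are reserved for codes of logical symbols.  The kind of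
   a symbol is given by the number 0 (function) or 1 (relation). *)
Record computably_presented (L : language) : Prop := ComputablyPresented {
  gcode_inj : injective (@gcode L);
  gcode_nonlogical : forall (s : fsym L + rsym L) n, gcode s <> real_of_nat n;
  gcode_decidable : decidable_set (symbol_codes L);
  gcode_kind_arity : exists p, forall s : fsym L + rsym L,
    computes p (gcode s)
      (match s with
       | inl f => rpair (real_of_nat 0) (real_of_nat (farity f))
       | inr r => rpair (real_of_nat 1) (real_of_nat (rarity r))
       end) }.

(* [x] is a pair (d, z), and the list consists of the columns of z with index
   in d; the set d allows for an empty list. *)
Definition lists (x : real) (S : set real) : Prop :=
  exists d z : real, x = rpair d z /\ S = [set column z n | n in [set n | d n]].

Definition coded_by_writable (L : language) : Prop :=
  exists2 x, writable x & lists x (symbol_codes L).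

Inductive term (L : language) : Type :=
  | Var of nat
  | App (f : fsym L) of ('I_(farity f) -> term L).

Inductive formula (L : language) : Type :=
  | Eq of term L & term L
  | Rel (r : rsym L) of ('I_(rarity r) -> term L)
  | Not of formula L
  | And of formula L & formula L
  | Ex of nat & formula L.

Arguments Var {L} _.

Fixpoint term_free (L : language) (t : term L) (j : nat) : Prop :=
  match t with
  | Var i => j = i
  | App f a => exists i, term_free (a i) j
  end.

Fixpoint free (L : language) (phi : formula L) (j : nat) : Prop :=
  match phi with
  | Eq t u => term_free t j \/ term_free u j
  | Rel r a => exists i, term_free (a i) j
  | Not psi => free psi j
  | And psi chi => free psi j \/ free chi j
  | Ex i psi => j <> i /\ free psi j
  end.

(* Formulas are strings of symbols in prefix notation; =, not, and, exists have
   the codes 0, 1, 2, 3, and the i-th variable has the code 4 + i. *)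
Definition var_code (i : nat) : real := real_of_nat (4 + i).

Fixpoint term_string (L : language) (t : term L) : seq real :=
  match t with
  | Var i => [:: var_code i]
  | App f a => gcode (inl f) ::
      flatten [seq term_string (a i) | i <- enum 'I_(farity f)]
  end.

Fixpoint formula_string (L : language) (phi : formula L) : seq real :=
  match phi with
  | Eq t u => real_of_nat 0 :: term_string t ++ term_string u
  | Rel r a => gcode (inr r) ::
      flatten [seq term_string (a i) | i <- enum 'I_(rarity r)]
  | Not psi => real_of_nat 1 :: formula_string psi
  | And psi chi => real_of_nat 2 :: formula_string psi ++ formula_string chi
  | Ex i psi => [:: real_of_nat 3, var_code i & formula_string psi]
  end.

Definition formula_code (L : language) (phi : formula L) : real :=
  rseq (formula_string phi).

(* The values of [fint] and [rint] on arguments outside the universe are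
   irrelevant junk. *)
Record structure (L : language) : Type := Structure {
  univ : set real;
  fint : forall f : fsym L, ('I_(farity f) -> real) -> real;
  rint : forall r : rsym L, ('I_(rarity r) -> real) -> Prop;
  univ_nonempty : univ !=set0;
  fint_closed : forall (f : fsym L) (a : 'I_(farity f) -> real),
    (forall i, univ (a i)) -> univ (fint a) }.

Fixpoint eval (L : language) (A : structure L) (e : nat -> real) (t : term L) : real :=
  match t with
  | Var i => e i
  | App f a => fint A (fun i => eval A e (a i))
  end.

Fixpoint sat (L : language) (A : structure L) (e : nat -> real)
    (phi : formula L) : Prop :=
  match phi with
  | Eq t u => eval A e t = eval A e u
  | Rel r a => rint A (fun i => eval A e (a i))
  | Not psi => ~ sat A e psi
  | And psi chi => sat A e psi /\ sat A e chi
  | Ex i psi => exists2 x, univ A x & sat A (fun j => if j == i then x else e j) psi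
  end.

(* The pairs (phi, a), suitably coded, with a a finite sequence from A that
   interprets all the free variables of phi, and A |= phi[a]. *)
Definition elementary_diagram (L : language) (A : structure L) : set real :=
  [set x | exists (phi : formula L) (a : seq real),
    [/\ x = rpair (formula_code phi) (rseq a),
        forall i, i < size a -> univ A (nth (real_of_nat 0) a i),
        forall j, free phi j -> j < size a
      & sat A (nth (real_of_nat 0) a) phi]].

Definition decidable_model (L : language) (A : structure L) : Prop :=
  decidable_set (univ A) /\ decidable_set (elementary_diagram A).

Definition elementary_substructure (L : language) (B A : structure L) : Prop :=
  [/\ univ B `<=` univ A,
      forall (f : fsym L) (b : 'I_(farity f) -> real),
        (forall i, univ B (b i)) -> fint B b = fint A b,
      forall (r : rsym L) (b : 'I_(rarity r) -> real),
        (forall i, univ B (b i)) -> (rint B b <-> rint A b)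
    & forall (phi : formula L) (e : nat -> real),
        (forall i, univ B (e i)) -> (sat B e phi <-> sat A e phi)].

(* [y] codes the sequence of the [s b] for b <= a: [y] is a pair (z, x), where
   z codes a well order on a subset of nat through its non-strict relation
   {(n, m) | z <n, m> = 1} (so that orders of type 1 and 0 have distinct
   codes).  That this relation is a well order of type alpha + 1, for a the
   alpha-th index, is expressed by the order isomorphism [e], which sends the
   beta-th index to the beta-th element of the coded order. *)
Definition codes_segment (T : Type) (R : rel T) (s : T -> real) (a : T)
    (y : real) : Prop :=
  exists z x : real, y = rpair z x /\
  let field := [set n | z (npair n n)] in
  (forall n m, z (npair n m) -> field n /\ field m) /\
  exists e : T -> nat,
    [/\ set_bij [set b | R b a] field e,
        forall b c, R b a -> R c a -> z (npair (e b) (e c)) = R b c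
      & forall b, R b a -> column x (e b) = s b].

(* A well order has type at most omega_1 iff its proper initial segments are
   countable. *)
Definition well_presented (L : language) (A : structure L) : Prop :=
  exists (T : Type) (R : rel T) (s : T -> real),
    [/\ wochoice.well_order R,
        forall a, countable [set b | R b a],
        symbol_codes L `<=` range s /\ univ A `<=` range s
      & exists p, forall a, exists2 y, computes p (s a) y & codes_segment R s a y].

(* Main.v *)
Require Import Defs.
From Stdlib Require Cantor Eqdep_dec Relation_Operators Lexicographic_Product.
From HB Require Import structures.
From mathcomp Require Import all_boot boolp classical_sets cardinality functions.
From mathcomp Require wochoice.

(* Let X_a be the set of the s_b with b < a.  As A is uncountable and the
   initial segments of the index order are countable, some X_a is closed under
   Tarski-Vaught witnesses of A; take the least such a, and let B be the trace
   of X_a on A, which is a countable elementary substructure.  To decide whether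
   an element x = s_b of A is in B, compute a code of the s_c with c <= b and
   search it for a closed X_c with c <= b; being closed is an arithmetical
   property of this code and of the given list of symbols, relative to the
   elementary diagram of A.

   So it suffices that the infinite time computable functions are closed under
   composition, pairing, case distinction and limsups of omega-iterations, which
   give quantification over the natural numbers and recursion.  For this, several
   tapes are simulated in blocks of cells, and bits in the leftmost cells, which
   the head reads at limits, record which subroutine is active; a loop flashes
   such a bit at each round, so that it is 1 at a limit of rounds only. *)

Set Implicit Arguments.
Unset Strict Implicit.
Unset Printing Implicit Defensive.

(** * Runs along well orders *)

(** The limsup rule shapes the proof. At a limit the state is lost and the head is reset, so what
    must survive has to be on the tapes; but a 1 written only for a moment, again and again,
    survives as well. Hence a simulation passes limits correctly if, during each simulated step,
    every bit takes no values but its old and its new one; and a loop has the intended limit on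
    those tapes on which its body shows no temporary values. This is why cleanness of tapes is
    carried through the constructions. Ordinals do not occur: runs are indexed by arbitrary
    well-ordered types, and concatenating runs along a well order is a lexicographic sum.
    Uncountability of the universe enters through one fact: every sequence of indices has a strict
    upper bound, for otherwise countably many countable initial segments would cover the universe.
    So adding witnesses in omega rounds ends below some index. *)

Record strict_wo (W : Type) (lt : W -> W -> Prop) : Prop := StrictWo {
  wo_wf : well_founded lt;
  wo_tri : forall a b, [\/ lt a b, a = b | lt b a];
  wo_trans : forall a b c, lt a b -> lt b c -> lt a c }.

Lemma wo_irr W (lt : W -> W -> Prop) : strict_wo lt -> forall a, ~ lt a a.
Proof.
move=> h a; elim: (wo_wf h a) => {}a _ IH laa; exact: (IH a laa laa).
Qed.

Lemma wo_asym W (lt : W -> W -> Prop) : strict_wo lt ->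
  forall a b, lt a b -> lt b a -> False.
Proof. by move=> h a b ab ba; exact: wo_irr h a (wo_trans h ab ba). Qed.

Lemma wo_min W (lt : W -> W -> Prop) : strict_wo lt -> forall P : W -> Prop,
  (exists a, P a) -> exists a, P a /\ forall b, lt b a -> ~ P b.
Proof.
move=> h P [a Pa]; apply: contrapT => no.
elim: (wo_wf h a) Pa => {}a _ IH Pa; apply: no; exists a; split=> // b ba; exact: IH b ba.
Qed.

Definition leq_of W (lt : W -> W -> Prop) (a b : W) : Prop := a = b \/ lt a b.

Inductive gstate (Q : Type) : Type := GLim | GRun of Q | GExit.
Arguments GLim {Q}.
Arguments GExit {Q}.

Record gconf (Q I : Type) : Type :=
  GConf { gs : gstate Q; gh : nat; gt : I -> real }.

Section Seg.
Variables (Q T : Type).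
Local Notation conf := (gconf Q T).

Section Next.
Variable stp : conf -> conf.

(** A bit of the limit is 1 iff cofinally many of the blocks [V u] contain a configuration where it
    is 1. For blocks with a single configuration this is the limsup rule. *)
Definition glim W (lt : W -> W -> Prop) (S : W -> Prop) (V : W -> conf -> Prop)
  : conf :=
  GConf GLim 0 (fun i k => `[< forall v, S v ->
    exists u, [/\ S u, leq_of lt v u & exists x, V u x /\ gt x i k] >]).

(* The configuration following those of the stages in the initial segment [S],
   when the stage [w] stands for a whole segment with configurations [V w]
   which leads to [D w]. *)
Definition next_conf W (lt : W -> W -> Prop) (S : W -> Prop) (c : conf)
    (V : W -> conf -> Prop) (D : W -> conf) (d : conf) : Prop :=
  [\/ (forall v, ~ S v) /\ d = c,
      exists m, [/\ S m, forall v, S v -> leq_of lt v m & d = D m] |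
      [/\ exists v, S v, forall v, S v -> exists2 u, S u & lt v u &
          d = glim lt S V]].

Lemma glim_ext W (lt : W -> W -> Prop) S V W' (lt' : W' -> W' -> Prop) S' V' :
  (forall P : conf -> Prop,
    (forall v, S v -> exists u, [/\ S u, leq_of lt v u & exists x, V u x /\ P x]) <->
    (forall v, S' v -> exists u, [/\ S' u, leq_of lt' v u & exists x, V' u x /\ P x])) ->
  glim lt S V = glim lt' S' V'.
Proof.
move=> h; congr GConf; apply/funext => i; apply/funext => k.
exact: asbool_equiv_eq (h (fun x => gt x i k)).
Qed.

(* [c] leads to [d] along some well order, through the configurations [V]
   (which include [c], unless [V] is empty, but not the final [d]). *)
Definition seg (c : conf) (V : conf -> Prop) (d : conf) : Prop :=
  exists W (lt : W -> W -> Prop) (f : W -> conf),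
    [/\ strict_wo lt,
        forall w, next_conf lt (lt^~ w) c (fun u => eq (f u)) (fun u => stp (f u)) (f w),
        next_conf lt (fun=> True) c (fun u => eq (f u)) (fun u => stp (f u)) d &
        forall x, V x <-> exists w, f w = x].

Lemma seg_refl c : seg c (fun=> False) c.
Proof.
exists Empty_set, (fun _ _ => False), (fun x : Empty_set => match x with end).
split; [by split=> // -[]|by []|by constructor 1; split|by move=> x; split=> // -[]].
Qed.

Lemma seg_step c : seg c (eq c) (stp c).
Proof.
exists unit, (fun _ _ => False), (fun=> c); split.
- by split=> // [] [] []; constructor 2.
- by move=> w; constructor 1; split=> // v [].
- by constructor 2; exists tt; split=> // -[]; left.
- by move=> x; split=> [->|[]//]; exists tt.
Qed.

Lemma seg_limhead c V d : seg c V d -> (gs c = GLim -> gh c = 0) ->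
  (forall x, gs (stp x) = GLim -> gh (stp x) = 0) ->
  forall x, V x -> gs x = GLim -> gh x = 0.
Proof.
move=> [W [lt [f [h hf _ hV]]]] hc hstp x /hV [w <-].
by case: (hf w) => [[_ ->]|[m [_ _ ->]]|[_ _ ->]] //; apply: hstp.
Qed.

(** The stages of the sum are pairs in the lexicographic order. Inside a block the block itself
    determines the next configuration, at its beginning the order [J] does. Blocks are nonempty, so
    that an initial segment of [J] without a last element yields one of the sum without a last
    element. *)
Lemma seg_sigma J (ltJ : J -> J -> Prop) (C D : J -> conf) (V : J -> conf -> Prop) c d :
  strict_wo ltJ ->
  (forall j, seg (C j) (V j) (D j)) -> (forall j, exists x, V j x) ->
  (forall j, next_conf ltJ (ltJ^~ j) c V D (C j)) ->
  next_conf ltJ (fun=> True) c V D d ->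
  seg c (fun x => exists j, V j x) d.
Proof.
move=> hJ hs hne hC hd.
have [W hs1] := choice hs.
have [lt hs2] : exists lt : forall j, W j -> W j -> Prop, forall j, exists f : W j ->
    conf,
    [/\ strict_wo (lt j),
        forall w, next_conf (lt j) ((lt j)^~ w) (C j) (fun u => eq (f u)) (fun u => stp
            (f u)) (f w),
        next_conf (lt j) (fun=> True) (C j) (fun u => eq (f u)) (fun u => stp (f u)) (D
            j) &
        forall x, V j x <-> exists w, f w = x].
  exists (fun j => projT1 (cid (hs1 j))) => j; exact: projT2 (cid (hs1 j)).
have {hs1} [f hf] : exists f : forall j, W j -> conf, forall j,
    [/\ strict_wo (lt j),
        forall w, next_conf (lt j) ((lt j)^~ w) (C j) (fun u => eq (f j u)) (fun u =>
            stp (f j u)) (f j w),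
        next_conf (lt j) (fun=> True) (C j) (fun u => eq (f j u)) (fun u => stp (f j
            u)) (D j) &
        forall x, V j x <-> exists w, f j w = x].
  exists (fun j => projT1 (cid (hs2 j))) => j; exact: projT2 (cid (hs2 j)).
have {hs2} wof j : strict_wo (lt j) by case: (hf j).
have inj2 j (a b : W j) : existT W j a = existT W j b -> a = b.
  by apply: Eqdep_dec.inj_pair2_eq_dec => x y; case: (pselect (x = y)); [left|right].
pose Z := {j : J & W j}.
pose ltZ : Z -> Z -> Prop := Relation_Operators.lexprod J W ltJ lt.
pose fZ (z : Z) := f (projT1 z) (projT2 z).
have lexP (z z' : Z) : ltZ z z' -> ltJ (projT1 z) (projT1 z') \/
    exists2 v, z = existT W (projT1 z') v & lt _ v (projT2 z').
  by case=> [i j a b ij|i a b ab]; [left|right; exists a].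
have lexJ (z z' : Z) : ltJ (projT1 z) (projT1 z') -> ltZ z z'.
  by case: z z' => [i a] [j b] /= ij; constructor.
have lexW j a b : lt j a b -> ltZ (existT W j a) (existT W j b) by constructor.
have woZ : strict_wo ltZ.
  split.
  - by apply: Lexicographic_Product.wf_lexprod => [|j];
      [exact: wo_wf hJ|exact: wo_wf (wof j)].
  - case=> i a [j b]; case: (wo_tri hJ i j) => [ij|ij|ij].
    + by constructor 1; apply: lexJ.
    + subst j; case: (wo_tri (wof i) a b) => [ab|->|ab].
      * by constructor 1; exact: lexW.
      * by constructor 2.
      * by constructor 3; exact: lexW.
    + by constructor 3; apply: lexJ.
  - move=> x y [k w] xy yz; case: (lexP _ _ yz) => /= [yz'|[v ey yz']].
      case: (lexP _ _ xy) => [xy'|[u ex xy']]; apply: lexJ.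
        exact: (wo_trans hJ xy' yz').
      by rewrite ex.
    subst y; case: (lexP _ _ xy) => /= [xy'|[u ex xy']]; first exact: lexJ.
    rewrite ex; apply: lexW; exact: (wo_trans (wof k) xy' yz').
pose nextZ S d' := next_conf ltZ S c (fun u => eq (fZ u)) (fun u => stp (fZ u)) d'.
have inh j : exists w : W j, True.
  by have [x] := hne j; have [_ _ _ hV] := hf j => /hV [w]; exists w.
(* The union of the blocks in [S] leads where [S] leads: if [S] has a last element, the end of its
   block decides, be it a last stage or a limit; otherwise both limits run over the same blocks
   cofinally. *)
have cut (S : J -> Prop) d' : (forall a b, ltJ a b -> S b -> S a) ->
    next_conf ltJ S c V D d' -> nextZ (fun z => S (projT1 z)) d'.
  move=> Sdn; case=> [[nS ->]|[m [Sm mmax ->]]|[[v Sv] nomax ->]].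
  - by constructor 1; split=> // -[j a] /=; exact: nS.
  - have [_ _ nx hV] := hf m; have [w0 _] := inh m.
    have mtop (z : Z) : S (projT1 z) -> ltJ (projT1 z) m \/ exists v, z = existT W m v.
      case: z => j a /= /mmax [jm|jm]; [right|by left].
      by subst j; exists a.
    case: nx => [[/(_ w0)]//|[w [_ wmax ->]]|[_ nomax ->]].
    + constructor 2; exists (existT W m w); split=> // z /mtop [zm|[v ->]].
        by right; apply: lexJ.
      by case: (wmax v I) => [->|vw]; [left|right; apply: lexW].
    + constructor 3; split; first by exists (existT W m w0).
        move=> z /mtop [zm|[v ->]].
          by exists (existT W m w0) => //; apply: lexJ.
        by have [u _ vu] := nomax v I; exists (existT W m u) => //; exact: lexW.
      apply: glim_ext => P; split=> hP.
        move=> z /mtop [zm|[v ->]].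
          have [u [_ _ [x [ex Px]]]] := hP w0 I.
          by exists (existT W m u); split; [exact: Sm|right; apply: lexJ|exists x].
        have [u [_ vu [x [ex Px]]]] := hP v I.
        exists (existT W m u); split; [exact: Sm| |by exists x].
        by case: vu => [->|vu]; [left|right; apply: lexW].
      move=> v _; have [u [Su vu [x [ex Px]]]] := hP (existT W m v) Sm.
      have [um|[w eu]] := mtop _ Su.
        case: vu => [vu|]; first by rewrite -vu in um; case: (wo_irr hJ um).
        case/lexP=> [/=|[w eu _]]; first by move=> /(wo_asym hJ) /(_ um).
        by have /= em := f_equal (@projT1 _ _) eu; rewrite -em in um;
            case: (wo_irr hJ um).
      subst u; exists w; split=> //; last by exists x.
      case: vu => [/inj2 ->|/lexP /= [/(wo_irr hJ)//|[w' /inj2 -> ?]]];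
          [by left|by right].
  - constructor 3; split.
    + by have [w0 _] := inh v; exists (existT W v w0).
    + case=> j a /= Sj; have [u Su ju] := nomax j Sj; have [w0 _] := inh u.
      by exists (existT W u w0) => //; apply: lexJ.
    apply: glim_ext => P; split=> hP.
      case=> j a /= Sj; have [j' Sj' jj'] := nomax j Sj.
      have [u [Su ju [x [Vx Px]]]] := hP j' Sj'.
      have [_ _ _ hV] := hf u; have [w ew] := (hV x).1 Vx.
      exists (existT W u w); split=> //; last by exists x.
      by right; apply: lexJ => /=; case: ju => [eu|ju];
          [rewrite -eu|exact: (wo_trans hJ jj' ju)].
    move=> j Sj; have [w0 _] := inh j.
    have [[u w] [/= Su ju [x [ex Px]]]] := hP (existT W j w0) Sj.
    exists u; split=> //.
      case: ju => [ju|/lexP /= [?|[w' ju _]]]; [left|by right|left];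
      exact: (f_equal (@projT1 _ _) ju).
    by exists x; split=> //; have [_ _ _ hV] := hf u; apply/hV; exists w.
exists Z, ltZ, fZ; split=> //.
- case=> j w; rewrite -[fZ (existT _ j w)]/(f j w).
  have [_ nx _ hV] := hf j.
  case: (nx w) => [[nw ->]|[m [mw mmax ->]]|[[v vw] nomax ->]].
  + rewrite (_ : ltZ^~ _ = fun z => ltJ (projT1 z) j).
      by apply: (cut (ltJ^~ j)) => // a b; exact: wo_trans.
    apply/funext => z; apply/propext; split=> [|zj]; last exact: lexJ.
    by case/lexP => //= -[v _ /nw].
  + constructor 2; exists (existT W j m); split=> //; first exact: lexW.
    move=> z /lexP /= [zj|[v -> vw]]; first by right; apply: lexJ.
    by case: (mmax v vw) => [->|vm]; [left|right; apply: lexW].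
  + constructor 3; split; first by exists (existT W j v); exact: lexW.
      move=> z /lexP /= [zj|[v' -> v'w]].
        by exists (existT W j v); [exact: lexW|exact: lexJ].
      by have [u uw vu] := nomax v' v'w; exists (existT W j u); exact: lexW.
    apply: glim_ext => P; split=> hP.
      move=> z /lexP /= [zj|[v' -> v'w]].
        have [u [uw _ [x [ex Px]]]] := hP v vw.
        by exists (existT W j u); split; [exact: lexW|right; exact: lexJ|exists x].
      have [u [uw vu [x [ex Px]]]] := hP v' v'w.
      exists (existT W j u); split; [exact: lexW| |by exists x].
      by case: vu => [->|vu]; [left|right; apply: lexW].
    move=> v' v'w; have [z [zw vz [x [ex Px]]]] := hP (existT W j v') (lexW _ _ _ v'w).
    case: (lexP _ _ zw) => /= [zj|[u eu uw]].
      case: vz => [vz|]; first by rewrite -vz in zj; case: (wo_irr hJ zj).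
      case/lexP=> [/= /(wo_asym hJ) /(_ zj)//|[u eu _]].
      by have /= em := f_equal (@projT1 _ _) eu; rewrite -em in zj; case: (wo_irr hJ zj).
    subst z; exists u; split=> //; last by exists x.
    case: vz => [/inj2 ->|/lexP /= [/(wo_irr hJ)//|[w' /inj2 -> ?]]]; [by left|by right].
- exact: (cut (fun=> True) d (fun _ _ _ => id) hd).
- move=> x; split=> [[j]|[[j w] <-]].
    by have [_ _ _ hV] := hf j => /hV [w <-]; exists (existT W j w).
  by exists j; have [_ _ _ hV] := hf j; apply/hV; exists w.
Qed.

Lemma seg_nil c V d : seg c V d -> (forall x, ~ V x) -> d = c.
Proof.
move=> [W [lt [f [h _ hd hV]]]] nV; have nW (w : W) : False.
  by apply: (nV (f w)); apply/hV; exists w.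
by case: hd => [[_ ->]//|[/nW]//|[[/nW]]].
Qed.

Lemma seg_ext c V V' d : seg c V d -> (forall x, V x <-> V' x) -> seg c V' d.
Proof. by move=> + e; rewrite (_ : V = V') //; apply/funext => x; apply/propext. Qed.

Lemma seg_trans c V d V' e : seg c V d -> seg d V' e ->
  seg c (fun x => V x \/ V' x) e.
Proof.
move=> h1 h2.
(* Empty segments are set aside, as [seg_sigma] wants nonempty blocks. *)
case: (pselect (exists x, V x)) => [ne1|e1]; last first.
  have nV x : ~ V x by move=> Vx; apply: e1; exists x.
  rewrite -(seg_nil h1 nV); apply: seg_ext h2 _ => x.
  by split=> [|[/nV//|//]]; right.
case: (pselect (exists x, V' x)) => [ne2|e2]; last first.
  have nV x : ~ V' x by move=> Vx; apply: e2; exists x.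
  rewrite (seg_nil h2 nV); apply: seg_ext h1 _ => x.
  by split=> [|[//|/nV//]]; left.
pose ltb (a b : bool) := ~~ a && b.
have wob : strict_wo ltb.
  split; last by do 3 case.
    have af : Acc ltb false by apply: Acc_intro => -[].
    have at_ : Acc ltb true by apply: Acc_intro => -[h0|_]; [discriminate h0|exact: af].
    by move=> b; case: b; [exact: at_|exact: af].
  by case=> -[]; (constructor 1 + constructor 2 + constructor 3).
apply: (@seg_ext _ (fun x => exists b : bool, (if b then V' else V) x)); last first.
  by move=> x; split=> [[[]]|[]]; [right|left|exists false|exists true].
apply: (seg_sigma (ltJ := ltb) (C := fun b => if b then d else c)
                  (D := fun b => if b then e else d)) => //; try by case.
- case; last by constructor 1; split=> // -[].
  by constructor 2; exists false; split=> // -[] // _; left.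
- by constructor 2; exists true; split=> // -[]; [left|right].
Qed.

Lemma seg_omega (c : nat -> conf) (V : nat -> conf -> Prop) :
  (forall n, seg (c n) (V n) (c n.+1)) -> (forall n, exists x, V n x) ->
  seg (c 0) (fun x => exists n, V n x)
    (GConf GLim 0 (fun i k => `[< forall n, exists m, n <= m /\
       exists x, V m x /\ gt x i k >])).
Proof.
move=> hs hne; pose ltn' (a b : nat) : Prop := a < b.
have won : strict_wo ltn'.
  split; last by move=> a b d; exact: ltn_trans.
    have h n : forall m, m <= n -> Acc ltn' m.
      elim: n => [|n IH] m mn; split=> k km.
        by move: mn; rewrite leqn0 => /eqP m0; rewrite m0 in km.
      by apply: IH; rewrite -ltnS; exact: leq_trans km mn.
    by move=> n; exact: h (leqnn n).
  by move=> a b; case: (ltngtP a b) => ab; [constructor 1|constructor 3|constructor 2].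
apply: (seg_sigma (ltJ := ltn') (C := c) (D := fun n => c n.+1)) => //.
- case=> [|n]; first by constructor 1.
  constructor 2; exists n; split=> [|v|//]; first exact: ltnSn.
  by rewrite /ltn' ltnS leq_eqVlt => /predU1P [->|]; [left|right].
- constructor 3; split; first by exists 0.
    by move=> v _; exists v.+1 => //; exact: ltnSn.
  congr GConf; apply/funext => i; apply/funext => k.
  apply: asbool_equiv_eq; split=> hP v.
    move=> _; have [u [vu hx]] := hP v; exists u; split=> //; move: vu.
    by rewrite leq_eqVlt => /predU1P [->|]; [left|right].
  have [u [_ vu hx]] := hP v I; exists u; split=> //.
  by case: vu => [->//|/ltnW].
Qed.

Definition reach (P : conf -> Prop) (c d : conf) : Prop :=
  exists V, seg c V d /\ forall x, V x -> P x.

(** With at least one stage, as required of the rounds in [seg_omega]; moreover the bits of [c]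
    itself then count at the limit. *)
Definition reach1 (P : conf -> Prop) (c d : conf) : Prop :=
  exists V, [/\ seg c V d, V c & forall x, V x -> P x].

Lemma reach1W P c d : reach1 P c d -> reach P c d.
Proof. by move=> [V [h _ hP]]; exists V. Qed.

Lemma reach_sub (P P' : conf -> Prop) c d :
  reach P c d -> (forall x, P x -> P' x) -> reach P' c d.
Proof. by move=> [V [h hP]] PP'; exists V; split=> // x /hP /PP'. Qed.

Lemma reach_refl P c : reach P c c.
Proof. by exists (fun=> False); split=> //; exact: seg_refl. Qed.

Lemma reach_trans P c d e : reach P c d -> reach P d e -> reach P c e.
Proof.
move=> [V [h hP]] [V' [h' hP']]; exists (fun x => V x \/ V' x).
by split=> [|x [/hP|/hP']//]; exact: seg_trans h h'.
Qed.

Lemma reach1_step (P : conf -> Prop) c e : P c -> reach P (stp c) e -> reach1 P c e.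
Proof.
move=> Pc [V [h hP]]; exists (fun x => c = x \/ V x).
by split=> [||x [<-|/hP]//]; [exact: seg_trans (seg_step c) h|left].
Qed.

Lemma reach_step (P : conf -> Prop) c e : P c -> reach P (stp c) e -> reach P c e.
Proof. by move=> Pc h; apply/reach1W/reach1_step. Qed.

Lemma reach_iter (P : conf -> Prop) (c : nat -> conf) n :
  (forall m, m < n -> P (c m) /\ stp (c m) = c m.+1) -> reach P (c 0) (c n).
Proof.
elim: n => [|n IH] h; first exact: reach_refl.
apply: (@reach_trans _ _ (c n)).
  by apply: IH => m mn; apply: h; exact: leq_trans mn (leqnSn n).
have [Pn <-] := h n (ltnSn n); apply: reach_step => //; exact: reach_refl.
Qed.

(** The invariants [P] do not determine the limit: a bit which recurs at the beginnings of rounds is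
    1, and one which is 0 throughout all late rounds is 0, while otherwise temporary values
    decide. *)
Lemma reach_omega (P : nat -> conf -> Prop) (c : nat -> conf) :
  (forall n, reach1 (P n) (c n) (c n.+1)) ->
  exists t, [/\ reach (fun x => exists n, P n x) (c 0) (GConf GLim 0 t),
    forall i k, (forall n, exists2 m, n <= m & gt (c m) i k) -> t i k &
    forall i k n, (forall m x, n <= m -> P m x -> gt x i k = false) -> t i k = false].
Proof.
move=> /choice [V hV].
have hs n : seg (c n) (V n) (c n.+1) by case: (hV n).
have hne n : exists x, V n x by exists (c n); case: (hV n).
eexists; split.
- exists (fun x => exists n, V n x); split; first exact: seg_omega hs hne.
  by move=> x [n Vx]; exists n; case: (hV n) => _ _; exact.
- move=> i k h; apply/asboolP => n; have [m nm hm] := h n.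
  by exists m; split=> //; exists (c m); case: (hV m).
- move=> i k n h; apply: asboolF => /(_ n) [m [nm [x [Vx]]]].
  by rewrite (h m) //; case: (hV m) => _ _; exact.
Qed.

Lemma reach_omega_cvg (P : nat -> conf -> Prop) (c : nat -> conf) (fin : T -> real) :
  (forall n, reach1 (P n) (c n) (c n.+1)) ->
  (forall n x i k, P n x -> k < n -> gt x i k = fin i k) ->
  reach (fun x => exists n, P n x) (c 0) (GConf GLim 0 fin).
Proof.
move=> h hfin; have [t [ht h1 h0]] := reach_omega h.
rewrite (_ : fin = t) //; apply/funext => i; apply/funext => k.
case e: (fin i k); symmetry.
  apply: h1 => n; exists (maxn n k.+1); first exact: leq_maxl.
  have [V [_ Vc VP]] := h (maxn n k.+1).
  by rewrite (hfin _ _ i k (VP _ Vc)) // leq_maxr.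
apply: (h0 i k k.+1) => m x km Px; exact: etrans (hfin m x i k Px km) e.
Qed.

End Next.
End Seg.

Arguments seg_limhead {Q T stp c V d}.

(** * Step-by-step simulation of machines *)

Section Sim.
Variables (Q1 T1 Q2 T2 : Type) (stp1 : gconf Q1 T1 -> gconf Q1 T1)
  (stp2 : gconf Q2 T2 -> gconf Q2 T2) (h : gconf Q1 T1 -> gconf Q2 T2).
Hypothesis h_lim : forall t, gs (h (GConf GLim 0 t)) = GLim /\
  gh (h (GConf GLim 0 t)) = 0.
Hypothesis h_bit : forall i k, (exists b, forall x, gt (h x) i k = b) \/
  (exists i' k', forall x, gt (h x) i k = gt x i' k').

(** Within the segment that replaces one step, a bit has its value before or after this step only.
    So the limsup over the long run is the limsup over the images of the short run, and by [h_bit]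
    it is the image of the limit. *)
Lemma seg_sim P c V d : seg stp1 c V d ->
  (forall x, V x -> exists V',
    [/\ seg stp2 (h x) V' (h (stp1 x)), V' (h x) & forall y, V' y ->
      P y /\ forall i k, gt y i k = gt (h x) i k \/ gt y i k = gt (h (stp1 x)) i k]) ->
  reach stp2 P (h c) (h d).
Proof.
move=> [W [lt [f [wo hf hd hV]]]] hs.
have {}hs w := hs (f w) ((hV (f w)).2 (ex_intro _ w erefl)).
have [V' hV'] := choice hs.
exists (fun x => exists w, V' w x); split; last first.
  by move=> x [w Vx]; have [_ _ /(_ x Vx) []] := hV' w.
pose C w := h (f w); pose D w := h (stp1 (f w)).
have hnext (S : W -> Prop) x : (forall a b, lt a b -> S b -> S a) ->
    next_conf lt S c (fun u => eq (f u)) (fun u => stp1 (f u)) x ->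
    next_conf lt S (h c) V' D (h x).
  move=> Sdn; case=> [[nS ->]|[m [Sm mmax ->]]|[[v Sv] nomax ->]].
  - by constructor 1.
  - by constructor 2; exists m.
  constructor 3; split=> //; first by exists v.
  set g := glim _ _ _; set g' := glim _ _ _.
  have : gt (h g) = gt g'.
    apply/funext => i; apply/funext => k.
    case: (h_bit i k) => [[b hb]|[i' [k' hb]]]; rewrite hb.
      have hy u y : V' u y -> gt y i k = b.
        by have [_ _ H] := hV' u; move=> /H [_ /(_ i k)]; rewrite !hb => -[].
      symmetry; case: b {hb} hy => hy.
        apply/asboolP => u Su; exists u; split=> //; first by left.
        by exists (h (f u)); have [_ Vu _] := hV' u; split=> //; exact: hy Vu.
      by apply: asboolF => /(_ v Sv) [u [_ _ [y [/hy ->]]]].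
    apply: asbool_equiv_eq; split=> hP u Su; have [u' [Su' uu' [y [ey Py]]]] := hP u Su.
      exists u'; split=> //; exists (h (f u')); have [_ Vu _] := hV' u'.
      by split=> //; rewrite hb ey.
    have [_ _ /(_ y ey) [_ /(_ i k)]] := hV' u'; rewrite Py !hb => -[hy|hy].
      by exists u'; split=> //; exists (f u').
    (* Here the bit is 1 after the step of [u'], that is, in the configuration of the successor
       stage [w] of [u'], which is in [S] because [S] has no last stage. *)
    have [u'' Su'' lu] := nomax u' Su'.
    have [w [lw wmin]] := wo_min wo (P := lt u') (ex_intro _ u'' lu).
    exists w; split.
    - case: (wo_tri wo w u'') => [wu|->//|/wmin//]; exact: Sdn wu Su''.
    - by right; case: uu' => [->//|]; exact: (fun q => wo_trans wo q lw).
    exists (f w); split=> //.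
    case: (hf w) => [[/(_ u')]//|[m [mw mmax ->]]|[_ nom _]].
      case: (mmax u' lw) => [<-//|um]; case: (wmin m mw um).
    by have [m mw um] := nom u' lw; case: (wmin m mw um).
  have [e1 e2] := h_lim (gt g); case: (h g) e1 e2 => s0 h0 t0 /= -> -> ->.
  by [].
apply: (seg_sigma (ltJ := lt) (C := C) (D := D)) => //.
- by move=> w; have [] := hV' w.
- by move=> w; exists (h (f w)); have [] := hV' w.
- by move=> w; apply: hnext => // a b ab bw; exact: (wo_trans wo ab bw).
- exact: hnext.
Qed.

End Sim.

(** * Machines with several tapes *)

(* A machine with tapes [T] and one common head.  In [gdelta], the state [None]
   is the limit state, and the new state [None] means to halt. *)
Record gprog (T : Type) : Type := GProg {
  gQ : finType;
  gentry : gQ;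
  gdelta : option gQ -> (T -> bool) -> option gQ * (T -> bool) * bool }.

Definition gapply T (F : gprog T) (o : option (gQ F)) (c : gconf (gQ F) T) :
    gconf (gQ F) T :=
  let: (q, col, d) := gdelta o (fun i => gt c i (gh c)) in
  GConf (if q is Some q' then GRun q' else GExit)
    (if d then (gh c).+1 else (gh c).-1)
    (fun i k => if k == gh c then col i else gt c i k).

Definition gstep T (F : gprog T) (c : gconf (gQ F) T) : gconf (gQ F) T :=
  match gs c with
  | GLim => gapply None c
  | GRun q => gapply (Some q) c
  | GExit => c
  end.

Lemma gapply_lim T (F : gprog T) (qo : option (gQ F)) x : gs (gapply qo x) <> GLim.
Proof. by rewrite /gapply; case: (gdelta qo _) => -[[]]. Qed.

Lemma gstep_lim T (F : gprog T) x : gs (@gstep T F x) <> GLim.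
Proof.
rewrite /gstep; case e: (gs x); [exact: gapply_lim|exact: gapply_lim|by rewrite e].
Qed.

Definition clean (T : Type) (Cl : T -> Prop) (s s' x : T -> real) : Prop :=
  forall i, Cl i -> forall k, x i k = s i k \/ x i k = s' i k.

(* [F] transforms the tapes [s] into [s'], and meanwhile each bit on the tapes
   [Cl] only takes its initial and final values. *)
Definition exec T (F : gprog T) (Cl : T -> Prop) (s s' : T -> real) : Prop :=
  reach (@gstep T F) (fun x => gs x <> GExit /\ clean Cl s s' (gt x))
    (GConf (GRun (gentry F)) 0 s) (GConf GExit 0 s').

Lemma exec_sub T (F : gprog T) (Cl Cl' : T -> Prop) s s' :
  exec F Cl s s' -> (forall i, Cl' i -> Cl i) -> exec F Cl' s s'.
Proof.
move=> h hC; apply: reach_sub h _ => x [? hx]; split=> // i /hC; exact: hx.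
Qed.

Definition combine T1 T (pi : T -> option T1) (u : T1 -> real) (o : T -> real)
  : T -> real := fun j => if pi j is Some i then u i else o j.

Definition lift_out T1 T (Q1 Q : Type) (pi : T -> option T1) (kappa : Q1 -> Q)
    (kx : option Q) (r : option Q1 * (T1 -> bool) * bool) (col : T -> bool) :=
  let: (q, c, d) := r in
  (if q is Some q' then Some (kappa q') else kx,
   fun j => if pi j is Some i then c i else col j, d).

Section Embed.
Variables (T1 T : Type) (F : gprog T1) (G : gprog T).
Variables (iota : T1 -> T) (pi : T -> option T1).
Hypothesis piK : forall i, pi (iota i) = Some i.
Variables (kappa : gQ F -> gQ G) (kx : option (gQ G)) (o : T -> real).
Hypothesis delta_run : forall q col,
  gdelta (Some (kappa q)) col =
  lift_out pi kappa kx (gdelta (Some q) (col \o iota)) col.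
Hypothesis delta_lim : forall col, (forall j, pi j = None -> col j = o j 0) ->
  gdelta None col = lift_out pi kappa kx (gdelta None (col \o iota)) col.

Let emb (x : gconf (gQ F) T1) : gconf (gQ G) T :=
  GConf (match gs x with
         | GLim => GLim
         | GRun q => GRun (kappa q)
         | GExit => if kx is Some q then GRun q else GExit
         end) (gh x) (combine pi (gt x) o).

Let emb_step x : gs x <> GExit -> (gs x = GLim -> gh x = 0) ->
  gstep (emb x) = emb (gstep x).
Proof.
have key qo qo' : (forall col, (forall j, pi j = None -> col j = o j (gh x)) ->
      gdelta qo' col = lift_out pi kappa kx (gdelta qo (col \o iota)) col) ->
    gapply qo' (emb x) = emb (gapply qo x).
  move=> hd; rewrite /gapply hd /=; last by move=> j; rewrite /combine => ->.
  rewrite (_ : _ \o _ = fun i => gt x i (gh x)); last first.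
    by apply/funext => i; rewrite /= /combine piK.
  case: (gdelta qo _) => -[q c] d /=; rewrite /emb /=; congr GConf; first by case: q.
  apply/funext => j; apply/funext => k; rewrite /combine.
  by case: (pi j) => [i|] //; case: eqP => // ->.
rewrite /gstep; case: x key => -[|q|] h u //= key _ => [h0|_]; apply: key.
  by rewrite h0.
by move=> col _; exact: delta_run.
Qed.

(** At a limit [G] loses the state that tells that [F] is running. But the tapes which are not tapes
    of [F] keep their content [o], and by [delta_lim] their leftmost cells suffice to continue
    [F]. *)
Lemma exec_embed Cl s s' : exec F Cl s s' ->
  reach (@gstep T G)
    (fun x => gs x <> GExit /\ exists2 u, clean Cl s s' u & gt x = combine pi u o)
    (GConf (GRun (kappa (gentry F))) 0 (combine pi s o))
    (GConf (if kx is Some q then GRun q else GExit) 0 (combine pi s' o)).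
Proof.
move=> [V [h hV]].
have hlim : forall x, V x -> gs x = GLim -> gh x = 0.
  by apply: (seg_limhead h) => // x /gstep_lim.
have := @seg_sim _ _ _ _ (@gstep T1 F) (@gstep T G) emb.
rewrite -[GConf (GRun (kappa _)) _ _]/(emb (GConf (GRun (gentry F)) 0 s)).
rewrite -[GConf (if _ is Some _ then _ else _) _ _]/(emb (GConf GExit 0 s')).
apply.
- by [].
- move=> j k; case e: (pi j) => [i|]; [right; exists i, k|left; exists (o j k)] => x;
  by rewrite /emb /= /combine e.
- exact: h.
move=> x Vx; have [nx cx] := hV x Vx; exists (eq (emb x)); split=> //.
  by rewrite -emb_step //; [exact: seg_step|exact: hlim].
move=> y <-; split; last by left.
split; last by exists (gt x).
by rewrite /emb /=; case: (gs x) nx.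
Qed.

End Embed.

(** * Subroutines under the control of a flag *)

Definition set0cell (T : eqType) (s : T -> real) (f : T) (b : bool) : T -> real :=
  fun j k => if (j == f) && (k == 0) then b else s j k.

Definition setcol (T : eqType) (c : T -> bool) (f : T) (b : bool) : T -> bool :=
  fun j => if j == f then b else c j.

Lemma gapply_flag (T : eqType) (F : gprog T) (x : gconf (gQ F) T) qo q f b :
  gh x = 0 ->
  gdelta qo (fun i => gt x i 0) = (q, setcol (fun i => gt x i 0) f b, false) ->
  gapply qo x = GConf (if q is Some q' then GRun q' else GExit) 0
    (set0cell (gt x) f b).
Proof.
move=> h0 hd; rewrite /gapply h0 hd; congr GConf.
apply/funext => i; apply/funext => k; rewrite /set0cell /setcol.
by case: eqP => [->|]; case: eqP.
Qed.

Lemma combine_id T1 T (iota : T1 -> T) (pi : T -> option T1) (s : T -> real) :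
  (forall j i, pi j = Some i -> iota i = j) -> combine pi (s \o iota) s = s.
Proof.
by move=> h; apply/funext => j; rewrite /combine; case e: (pi j) => [i|//] /=;
    rewrite (h _ _ e).
Qed.

(* Subroutines [F1] and [F2] on some of the tapes, under a finite control which
   acts on the leftmost cells only; at limits, [act] reads from the leftmost
   cells which subroutine is active ([None] if it is the turn of the control). *)
Section Control.
Variables (T T1 T2 : Type) (F1 : gprog T1) (F2 : gprog T2).
Variables (iota1 : T1 -> T) (pi1 : T -> option T1).
Variables (iota2 : T2 -> T) (pi2 : T -> option T2).
Variables (C : finType) (c0 r1 r2 : C).
Variable ctl : option C -> (T -> bool) -> option (C + bool) * (T -> bool).
Variable act : (T -> bool) -> option bool.

Let Q : finType := (gQ F1 + gQ F2 + C)%type.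
Let k1 (q : gQ F1) : Q := inl (inl q).
Let k2 (q : gQ F2) : Q := inl (inr q).

Let ctl_out (r : option (C + bool) * (T -> bool)) : option Q * (T -> bool) * bool :=
  (match r.1 with
   | None => None
   | Some (inl c) => Some (inr c)
   | Some (inr b) => Some (if b then k2 (gentry F2) else k1 (gentry F1))
   end, r.2, false).

Definition control : gprog T := GProg (inr c0 : Q) (fun (o : option Q) col =>
  let run1 q := lift_out pi1 k1 (Some (inr r1 : Q)) (gdelta q (col \o iota1)) col in
  let run2 q := lift_out pi2 k2 (Some (inr r2 : Q)) (gdelta q (col \o iota2)) col in
  match o with
  | None => match act col with
            | Some false => run1 None
            | Some true => run2 None
            | None => ctl_out (ctl None col)
            end
  | Some (inl (inl q)) => run1 (Some q)
  | Some (inl (inr q)) => run2 (Some q)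
  | Some (inr c) => ctl_out (ctl (Some c) col)
  end).

Lemma control_run1 Cl s s' o : (forall i, pi1 (iota1 i) = Some i) ->
  (forall col, (forall j, pi1 j = None -> col j = o j 0) -> act col = Some false) ->
  exec F1 Cl s s' ->
  reach (@gstep T control)
    (fun x => gs x <> GExit /\ exists2 u, clean Cl s s' u & gt x = combine pi1 u o)
    (GConf (GRun (k1 (gentry F1))) 0 (combine pi1 s o))
    (GConf (GRun (inr r1 : Q)) 0 (combine pi1 s' o)).
Proof.
move=> hpi hact; apply: (exec_embed (G := control) hpi (kx := Some (inr r1 : Q))) => //.
by move=> col /hact /= ->.
Qed.

Lemma control_run2 Cl s s' o : (forall i, pi2 (iota2 i) = Some i) ->
  (forall col, (forall j, pi2 j = None -> col j = o j 0) -> act col = Some true) ->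
  exec F2 Cl s s' ->
  reach (@gstep T control)
    (fun x => gs x <> GExit /\ exists2 u, clean Cl s s' u & gt x = combine pi2 u o)
    (GConf (GRun (k2 (gentry F2))) 0 (combine pi2 s o))
    (GConf (GRun (inr r2 : Q)) 0 (combine pi2 s' o)).
Proof.
move=> hpi hact; apply: (exec_embed (G := control) hpi (kx := Some (inr r2 : Q))) => //.
by move=> col /hact /= ->.
Qed.

End Control.

Section Combinators.
Variables (T : eqType) (T1 T2 : Type) (F1 : gprog T1) (F2 : gprog T2).
Variables (iota1 : T1 -> T) (pi1 : T -> option T1).
Variables (iota2 : T2 -> T) (pi2 : T -> option T2) (fl : T).
Hypotheses (piK1 : forall i, pi1 (iota1 i) = Some i)
  (iotaK1 : forall j i, pi1 j = Some i -> iota1 i = j) (fl1 : pi1 fl = None).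
Hypotheses (piK2 : forall i, pi2 (iota2 i) = Some i)
  (iotaK2 : forall j i, pi2 j = Some i -> iota2 i = j) (fl2 : pi2 fl = None).

(** The flag [fl] is 0 while [F1] runs and 1 while [F2] runs. *)
Definition seq_prog : gprog T :=
  control F1 F2 iota1 pi1 iota2 pi2 (None : option bool) (Some false) (Some true)
    (fun c col => match c with
       | Some (Some false) => (Some (inr true), setcol col fl true)
       | Some None => (Some (inr false), setcol col fl false)
       | _ => (None, setcol col fl false)
       end) (fun col => Some (col fl)).

(** The tested bit is copied to the flag, since the subroutine may change the tape [t] before a
    limit. *)
Definition if_prog (t : T) : gprog T :=
  control F1 F2 iota1 pi1 iota2 pi2 true false false
    (fun c col => match c with
       | Some true => (Some (inr (col t)), setcol col fl (col t))
       | _ => (None, setcol col fl false)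
       end) (fun col => Some (col fl)).

Definition loop_prog : gprog T :=
  control F1 F1 iota1 pi1 iota1 pi1 false true true
    (fun c col => match c with
       | Some false => (Some (inr false), setcol col fl false)
       | Some true => (Some (inl false), setcol col fl true)
       | None => (None, setcol col fl false)
       end) (fun col => if col fl then None else Some false).

Lemma combine_restrict T' (iota : T' -> T) (pi : T -> option T') (s o : T -> real) :
  (forall j i, pi j = Some i -> iota i = j) -> (forall i, o (iota i) = s (iota i)) ->
  combine pi (s \o iota) o = o.
Proof.
move=> h e; rewrite -[RHS](combine_id o h); congr (combine pi _ o).
by apply/funext => i /=; rewrite e.
Qed.

Lemma set0cell_off s b j : j <> fl -> set0cell s fl b j = s j.
Proof. by move=> /eqP/negbTE h; apply/funext => k; rewrite /set0cell h. Qed.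

Lemma iota_fl T' (iota : T' -> T) (pi : T -> option T') i :
  (forall i, pi (iota i) = Some i) -> pi fl = None -> iota i <> fl.
Proof. by move=> h e ei; move: (h i); rewrite ei e. Qed.

(** A tape is clean for the composition only if at most one of the subroutines changes it: otherwise
    it also takes the intermediate content [s1]. *)
Lemma exec_seq Cl1 Cl2 Cl s u1 u2 :
  let s1 := combine pi1 u1 s in let s2 := combine pi2 u2 s1 in
  exec F1 Cl1 (s \o iota1) u1 -> exec F2 Cl2 (s1 \o iota2) u2 ->
  (forall j, Cl j -> [/\ j <> fl, forall i, pi1 j = Some i -> Cl1 i,
     forall i, pi2 j = Some i -> Cl2 i & s1 j = s j \/ s2 j = s1 j]) ->
  exists2 s', exec seq_prog Cl s s' & forall j, j <> fl -> s' j = s2 j.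
Proof.
move=> s1 s2 h1 h2 hCl.
pose o1 := set0cell s fl false; pose o1' := combine pi1 u1 o1.
pose o2 := set0cell o1' fl true; pose o2' := combine pi2 u2 o2.
have e1' j : j <> fl -> o1' j = s1 j.
  by move=> jf; rewrite /o1' /s1 /combine; case: (pi1 j) => // ; rewrite /o1 set0cell_off.
have e2 j : j <> fl -> o2 j = s1 j by move=> jf; rewrite /o2 set0cell_off ?e1'.
have e2' j : j <> fl -> o2' j = s2 j.
  by move=> jf; rewrite /o2' /s2 /combine; case: (pi2 j) => //; exact: e2.
have cl x : (forall j, Cl j -> forall k, [\/ x j k = s j k, x j k = s1 j k | x j k = s2
    j k]) ->
    clean Cl s s2 x.
  move=> hx j Cj k; have [_ _ _ ee] := hCl j Cj; case: (hx j Cj k) => ->; auto.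
  by case: ee => ->; auto.
have cl' x : clean Cl s s2 x -> clean Cl s (set0cell o2' fl false) x.
  move=> hx j Cj k; have [jf _ _ _] := hCl j Cj.
  by rewrite set0cell_off // e2' //; exact: hx.
exists (set0cell o2' fl false); last by move=> j jf; rewrite set0cell_off ?e2'.
apply: reach_step.
  by split=> //; apply/cl'/cl => j _ k; constructor 1.
rewrite /gstep /= (gapply_flag (q := Some (inl (inl (gentry F1)) : gQ seq_prog)) (f :=
    fl) (b := false)) //=.
rewrite -/o1.
have -> : GConf (GRun (inl (inl (gentry F1)))) 0 o1 =
    GConf (GRun (inl (inl (gentry F1)))) 0 (combine pi1 (s \o iota1) o1) :> gconf (gQ
        seq_prog) T.
  by rewrite combine_restrict // => i; rewrite /o1 set0cell_off //; apply: iota_fl fl1.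
apply: reach_trans.
  apply: reach_sub; first (apply: control_run1; [exact: piK1| |exact: h1]).
    by move=> col ->; rewrite // /o1 /set0cell eqxx.
  move=> x [nx [u hu ->]]; split=> //; apply/cl'/cl => j Cj k.
  have [jf /(_ _ _) c1 _ _] := hCl j Cj; rewrite /combine.
  case e: (pi1 j) => [i|]; last by rewrite /o1 set0cell_off //; constructor 1.
  case: (hu i (c1 _ e) k) => -> /=; first by rewrite (iotaK1 e); constructor 1.
  by constructor 2; rewrite /s1 /combine e.
apply: reach_step.
  by split=> //; apply/cl'/cl => j Cj k; have [jf _ _ _] := hCl j Cj;
      rewrite /= -/o1' e1' //; constructor 2.
rewrite /gstep /= (gapply_flag (q := Some (inl (inr (gentry F2)) : gQ seq_prog)) (f :=
    fl) (b := true)) //=.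
rewrite -/o1' -/o2.
have -> : GConf (GRun (inl (inr (gentry F2)))) 0 o2 =
    GConf (GRun (inl (inr (gentry F2)))) 0 (combine pi2 (s1 \o iota2) o2) :> gconf (gQ
        seq_prog) T.
  by rewrite combine_restrict // => i; rewrite e2 //; apply: iota_fl fl2.
apply: reach_trans.
  apply: reach_sub; first (apply: control_run2; [exact: piK2| |exact: h2]).
    by move=> col ->; rewrite // /o2 /set0cell eqxx.
  move=> x [nx [u hu ->]]; split=> //; apply/cl'/cl => j Cj k.
  have [jf _ /(_ _ _) c2 _] := hCl j Cj; rewrite /combine.
  case e: (pi2 j) => [i|]; last by rewrite e2 //; constructor 2.
  case: (hu i (c2 _ e) k) => -> /=; first by rewrite (iotaK2 e); constructor 2.
  by constructor 3; rewrite /s2 /combine e.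
apply: reach_step.
  by split=> //; apply/cl'/cl => j Cj k; have [jf _ _ _] := hCl j Cj;
      rewrite /= -/o2' e2' //; constructor 3.
rewrite /gstep /= (gapply_flag (q := None) (f := fl) (b := false)) //=.
exact: reach_refl.
Qed.

Lemma exec_if t (s : T -> real) u1 u2 Cl1 Cl2 :
  (s t 0 = false -> exec F1 Cl1 (s \o iota1) u1) ->
  (s t 0 = true -> exec F2 Cl2 (s \o iota2) u2) ->
  exists2 s', exec (if_prog t) (fun=> False) s s' &
    forall j, j <> fl -> s' j = (if s t 0 then combine pi2 u2 s else combine pi1 u1 s) j.
Proof.
move=> hf ht.
have step0 b : s t 0 = b -> forall y s', reach (@gstep T (if_prog t))
    (fun x => gs x <> GExit)
    (GConf (GRun (inl (if b then inr (gentry F2) else inl (gentry F1)) : gQ (if_prog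
        t))) 0
      (set0cell s fl b)) y ->
  reach (@gstep T (if_prog t)) (fun x => gs x <> GExit /\ clean (fun=> False) s s' (gt x))
    (GConf (GRun (gentry (if_prog t))) 0 s) y.
  move=> e y s' r; apply: reach_step; first by split.
  rewrite /gstep /= (gapply_flag (q := Some (inl (if b then inr (gentry F2) else inl
      (gentry F1)) : gQ (if_prog t))) (f := fl) (b := b)) //=; last by rewrite e;
          case: b {e r}.
  by apply: (reach_sub r) => x nx; split.
have step1 o : reach (@gstep T (if_prog t))
    (fun x => gs x <> GExit) (GConf (GRun (inr false : gQ (if_prog t))) 0 o)
    (GConf GExit 0 (set0cell o fl false)).
  apply: reach_step => //.
  rewrite /gstep /= (gapply_flag (q := None) (f := fl) (b := false)) //=;
      exact: reach_refl.
pose o1 := set0cell s fl (s t 0).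
have rs T' (iota : T' -> T) (pi : T -> option T') : (forall i, pi (iota i) = Some i) ->
    (forall j i, pi j = Some i -> iota i = j) -> pi fl = None ->
    combine pi (s \o iota) o1 = o1.
  by move=> hp hi hn; rewrite combine_restrict // => i; rewrite /o1 set0cell_off //;
      exact: iota_fl hn.
have off T' (pi : T -> option T') (v : T' -> real) j : j <> fl ->
    set0cell (combine pi v o1) fl false j = combine pi v s j.
  by move=> jf; rewrite set0cell_off // /combine; case: (pi j) => //;
      rewrite /o1 set0cell_off.
have eo : set0cell s fl (s t 0) = o1 by [].
move: hf ht eo; case e: (s t 0) => hf ht eo.
  exists (set0cell (combine pi2 u2 o1) fl false); last by move=> j jf; rewrite off.
  apply: (step0 _ e); apply: reach_trans (step1 (combine pi2 u2 o1)).
  rewrite eo -{1}(rs _ _ _ piK2 iotaK2 fl2).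
  apply: reach_sub; first (apply: control_run2; [exact: piK2| |exact: (ht erefl)]).
    by move=> col ->; rewrite // /o1 /set0cell eqxx e.
  by move=> x [].
exists (set0cell (combine pi1 u1 o1) fl false); last by move=> j jf; rewrite off.
apply: (step0 _ e); apply: reach_trans (step1 (combine pi1 u1 o1)).
rewrite eo -{1}(rs _ _ _ piK1 iotaK1 fl1).
apply: reach_sub; first (apply: control_run1; [exact: piK1| |exact: (hf erefl)]).
  by move=> col ->; rewrite // /o1 /set0cell eqxx e.
by move=> x [].
Qed.

(** The limsup of the contents between rounds is obtained on the tapes [Cl] only: elsewhere a 1 that
    appears temporarily in each round remains at the limit. *)
Lemma exec_loop Cl (o : T -> real) (u : nat -> T1 -> real) :
  u 0 = o \o iota1 -> (forall n, exec F1 Cl (u n) (u n.+1)) ->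
  exists2 s', exec loop_prog (fun=> False) o s' &
    (forall j, pi1 j = None -> j <> fl -> s' j = o j) /\
    (forall i, Cl i -> forall k, s' (iota1 i) k =
      `[< forall n, exists2 m, n <= m & u m i k >]).
Proof.
move=> u0 hu.
(* The flag is arbitrary before the first round and 1 before every later one. *)
pose o_ n := if n is 0 then o else set0cell o fl true.
have oE n j : j <> fl -> o_ n j = o j by case: n => //= n jf; rewrite set0cell_off.
pose L : gQ loop_prog := inr false.
pose c n := GConf (GRun L) 0 (combine pi1 (u n) (o_ n)).
pose o1 n := set0cell (o_ n) fl false.
have cf b T' (pi : T -> option T') v x : pi fl = None ->
    set0cell (combine pi v x) fl b = combine pi v (set0cell x fl b).
  move=> pf; apply/funext => j; rewrite /combine; apply/funext => k.
  rewrite /set0cell; case: (eqVneq j fl) => [->|_] /=; first by rewrite pf.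
  by case: (pi j).
pose P n (x : gconf (gQ loop_prog) T) := [/\ gs x <> GExit,
  forall j, pi1 j = None -> j <> fl -> gt x j = o j &
  forall i, Cl i -> forall k, gt x (iota1 i) k = u n i k \/ gt x (iota1 i) k = u n.+1 i
      k].
have PI n q v x : (forall j, j <> fl -> x j = o j) -> clean Cl (u n) (u n.+1) v ->
    P n (GConf (GRun q) 0 (combine pi1 v x)).
  move=> hx hv; split=> //= [j pj jf|i Ci k]; first by rewrite /combine pj hx.
  by rewrite /combine piK1; exact: hv.
have o1E n j : j <> fl -> o1 n j = o j by move=> jf; rewrite /o1 set0cell_off // oE.
have round n : reach1 (@gstep T loop_prog) (P n) (c n) (c n.+1).
  apply: reach1_step; first by apply: PI (oE n) _ => i _ k; left.
  rewrite /gstep /= (gapply_flag (q := Some (inl (inl (gentry F1)) : gQ loop_prog)) (f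
      := fl) (b := false)) //=.
  rewrite cf // -/(o1 n); apply: reach_trans.
    apply: reach_sub; first (apply: control_run1; [exact: piK1| |exact: (hu n)]).
      by move=> col hc; rewrite hc // /o1 /set0cell eqxx.
    move=> x [nx [v hv ev]].
    have := PI n (gentry loop_prog) _ _ (o1E n) hv; rewrite -ev.
    by case=> _ /= h1 h2; split.
  apply: reach_step; first by apply: PI (o1E n) _ => i _ k; right.
  rewrite /gstep /= (gapply_flag (q := Some (inr false : gQ loop_prog)) (f := fl) (b :=
      true)) //=.
  rewrite cf // (_ : set0cell (o1 n) _ _ = o_ n.+1); first exact: reach_refl.
  apply/funext => j; apply/funext => k; rewrite /o1 /set0cell /=.
  case: ifP => // e; by case: n => [|n] /=; rewrite ?/set0cell ?e.
have [t [ht t1 t0]] := reach_omega round.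
have tf : t fl 0.
  by apply: t1 => n; exists n.+1 => //=; rewrite /combine fl1 /set0cell !eqxx.
exists (set0cell t fl false); last first.
  split=> [j pj jf|i Ci k]; rewrite set0cell_off //; last exact: iota_fl fl1.
    apply/funext => k; case e: (o j k).
      by apply: t1 => n; exists n => //=; rewrite /combine pj oE.
    by apply: (t0 _ _ 0) => m x _ [_ /(_ j pj jf) -> _].
  case: asboolP => h.
    by apply: t1 => n; have [m nm um] := h n; exists m => //=; rewrite /combine piK1.
  have [n hn] : exists n, forall m, n <= m -> u m i k = false.
    apply: contrapT => no; apply: h => n; apply: contrapT => no'; apply: no.
    exists n => m nm; apply/negbTE/negP => um; apply: no'; by exists m.
  apply: (t0 _ _ n) => m x nm [_ _ /(_ i Ci k)].
  by rewrite !hn ?(leq_trans nm) //; case.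
apply: (@reach_trans _ _ _ _ _ (GConf GLim 0 t)).
  rewrite (_ : GConf _ _ _ = c 0).
    by apply: reach_sub ht _ => x [n [nx _ _]]; split.
  by rewrite /c u0 combine_id.
apply: reach_step; first by split.
rewrite /gstep /= (gapply_flag (q := None) (f := fl) (b := false)) //=.
  exact: reach_refl.
by rewrite tf.
Qed.

End Combinators.

(** * Sweeps over the tapes, and interleaving *)

Section Sweep.
Variables (T : Type) (M : finType) (m0 : M) (mu : M -> (T -> bool) -> M * (T -> bool)).

Definition sweep : gprog T := GProg m0 (fun o col =>
  if o is Some m then (Some (mu m col).1, (mu m col).2, true) else (None, col, false)).

Fixpoint sweep_state (s : T -> real) (n : nat) : M :=
  if n is n'.+1 then (mu (sweep_state s n') (fun i => s i n')).1 else m0.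

Definition sweep_out (s : T -> real) : T -> real :=
  fun i k => (mu (sweep_state s k) (fun j => s j k)).2 i.

(** Every cell is rewritten once and left alone afterwards, so the tapes converge, and no cell shows
    a third value. *)
Lemma exec_sweep s : exec sweep (fun=> True) s (sweep_out s).
Proof.
pose st n : T -> real := fun i k => if k < n then sweep_out s i k else s i k.
pose c n := GConf (GRun (sweep_state s n : gQ sweep)) n (st n).
have cs n : gstep (c n) = c n.+1.
  rewrite /gstep /= /gapply /=.
  rewrite (_ : (fun i => st n i n) = fun i => s i n); last first.
    by apply/funext => i; rewrite /st ltnn.
  congr GConf; apply/funext => i; apply/funext => k.
  rewrite /st ltnS; case: ltngtP => // ->; by [].
have r n : reach1 (@gstep T sweep) (eq (c n)) (c n) (c n.+1).
  by apply: reach1_step => //; rewrite cs; exact: reach_refl.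
apply: (@reach_trans _ _ _ _ _ (GConf GLim 0 (sweep_out s))).
  have := reach_omega_cvg r (fin := sweep_out s).
  rewrite (_ : GConf (GRun (gentry sweep)) 0 s = c 0) // => h.
  apply: reach_sub; first apply: h.
    by move=> n x i k <- kn; rewrite /c /= /st kn.
  move=> x [n <-]; split=> // i _ k.
  by rewrite /= /st; case: ifP => _; auto.
apply: reach_step; first by split=> // i _ k; right.
have -> : gstep (GConf GLim 0 (sweep_out s)) = GConf GExit 0 (sweep_out s) :> gconf (gQ
    sweep) T.
  rewrite /gstep /= /gapply /=; congr GConf.
  by apply/funext => i; apply/funext => k; case: eqP => // ->.
exact: reach_refl.
Qed.

End Sweep.

Inductive xtape (L : nat) : Type := XI of 'I_L | XT | XP | XM.
Arguments XT {L}.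
Arguments XP {L}.
Arguments XM {L}.

(* Exchanges the tape [XT] with the interleaving of the tapes [XI i]: the column
   of the [XI i] marked on [XP] is exchanged with the block of [XT] whose
   beginning is marked on [XM], and then both marks move on. *)
Section Exchange.
Variable L' : nat.
Local Notation L := L'.+2.
Local Notation vec := {ffun 'I_L -> bool}.
Local Notation tape := (xtape L).

Definition xstate : finType := (bool + vec * ('I_L.+1 + bool))%type.

(** Column 0 needs a state of its own: its block begins in the same cell, so there is no mark to
    search for. *)
Definition x_init : xstate := inl false.
Definition x_adv : xstate := inl true.
Definition x_go (v : vec) : xstate := inr (v, inr false).
Definition x_back (v : vec) : xstate := inr (v, inr true).
Definition x_ex (i : nat) (v : vec) : xstate := inr (v, inl (inord i)).

Definition vset (v : vec) (i : nat) (b : bool) : vec :=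
  [ffun a : 'I_L => if a == i :> nat then b else v a].

Definition exchange : gprog tape := GProg x_init (fun o col =>
  let rd := [ffun a => col (XI a)] in
  let put (v : vec) i := fun t => match t with
    | XT => v (inord i) | XI a => col (XI a) | XP => col XP | XM => col XM end in
  match o with
  | None => (None, col, false)
  | Some (inl false) => (Some (x_ex 1 (vset rd 0 (col XT))),
      fun t => if t is XP then true else put rd 0 t, true)
  | Some (inl true) => (Some (x_go rd), fun t => if t is XP then true else col t, true)
  | Some (inr (v, inr false)) =>
      if col XM then (Some (x_ex 1 (vset v 0 (col XT))),
                      fun t => if t is XM then false else put v 0 t, true)
      else (Some (x_go v), col, true)
  | Some (inr (v, inr true)) =>
      if col XP then (Some x_adv, fun t => match t with
        | XI a => v a | XP => false | XT => col XT | XM => col XM end, true)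
      else (Some (x_back v), col, false)
  | Some (inr (v, inl i)) =>
      if i < L then (Some (x_ex i.+1 (vset v i (col XT))), put v i, true)
      else (Some (x_back v), fun t => if t is XM then true else col t, false)
  end).

Variable s : tape -> real.

Definition exchanged : tape -> real := fun t => match t with
  | XI i => fun k => s XT (k * L + i)
  | XT => fun k => s (XI (inord (k %% L))) (k %/ L)
  | XP | XM => fun=> false
  end.

Let st (a b : nat) (p m : real) : tape -> real := fun t => match t with
  | XI i => fun k => if k < a then exchanged (XI i) k else s (XI i) k
  | XT => fun k => if k < b then exchanged XT k else s XT k
  | XP => p
  | XM => m
  end.

(** The buffer in the course of exchanging column [j]: its first [i] entries have already been
    swapped with the block. *)
Let vj (j i : nat) : vec :=
  [ffun a : 'I_L => if a < i then s XT (j * L + a) else s (XI a) j].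

Let at_ (n : nat) : real := fun k => k == n.
Let no : real := fun=> false.

Let run q h u : gconf (gQ exchange) tape := GConf (GRun (q : gQ exchange)) h u.

Let vjS j i : i < L -> vset (vj j i) i (s XT (j * L + i)) = vj j i.+1.
Proof.
move=> iL; apply/ffunP => a; rewrite !ffunE ltnS.
case: (ltngtP a i) => [ai|ai|->] //.
Qed.

Let put_eq (u u' : tape -> real) h (c : tape -> bool) :
  (forall t k, k <> h -> u t k = u' t k) -> (forall t, c t = u' t h) ->
  (fun t k => if k == h then c t else u t k) = u'.
Proof.
move=> h1 h2; apply/funext => t; apply/funext => k.
by case: eqP => [->|kh]; [exact: h2|exact: h1].
Qed.

Let st_next a b b' p p' m m' h : b <= b' -> 
  (forall k, k <> h -> (k < b') = (k < b) /\ p k = p' k /\ m k = m' k) ->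
  forall t k, k <> h -> st a b p m t k = st a b' p' m' t k.
Proof. by move=> bb hk [i| | |] k /hk [h1 [h2 h3]] //=; rewrite h1. Qed.

Let ltnS_neq k h : k <> h -> (k < h.+1) = (k < h).
Proof. by move=> /eqP; rewrite ltnS leq_eqVlt => /negbTE ->. Qed.

Let exT j i : i < L -> exchanged XT (j * L + i) = s (XI (inord i)) j.
Proof.
move=> iL; rewrite /= modnMDl modn_small // divnMDl // divn_small //.
by rewrite addn0.
Qed.

Let at_off n k : k <> n -> at_ n k = no k.
Proof. by move=> /eqP/negbTE; rewrite /at_ => ->. Qed.

Let step_init : gstep (run x_init 0 (st 0 0 no no)) =
  run (x_ex 1 (vj 0 1)) 1 (st 0 1 (at_ 0) no).
Proof.
rewrite /gstep /= /gapply /=; congr (GConf (GRun (x_ex 1 _)) _ _).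
  rewrite -vjS //; congr (vset _ 0 _); apply/ffunP => a; by rewrite !ffunE.
apply: put_eq; first by apply: st_next => // k k0; rewrite ltnS_neq // at_off.
by case=> [a| | |] //=; rewrite ffunE mod0n div0n.
Qed.

Let step_adv j : gstep (run x_adv j (st j (j * L) no (at_ (j * L)))) =
  run (x_go (vj j 0)) j.+1 (st j (j * L) (at_ j) (at_ (j * L))).
Proof.
rewrite /gstep /= /gapply /=; congr (GConf (GRun (x_go _)) _ _).
  by apply/ffunP => a; rewrite !ffunE ltnn.
apply: put_eq; first by apply: st_next => // k k0; rewrite (at_off k0).
by case=> [a| | |] //=; rewrite /at_ eqxx.
Qed.

Let step_go j h v : h <> j * L ->
  gstep (run (x_go v) h (st j (j * L) (at_ j) (at_ (j * L)))) =
  run (x_go v) h.+1 (st j (j * L) (at_ j) (at_ (j * L))).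
Proof.
move=> hj; rewrite /gstep /= /gapply /= (at_off hj) /=; congr (GConf _ _ _).
by apply: put_eq.
Qed.

Let step_gohit j :
  gstep (run (x_go (vj j 0)) (j * L) (st j (j * L) (at_ j) (at_ (j * L)))) =
  run (x_ex 1 (vj j 1)) (j * L).+1 (st j (j * L).+1 (at_ j) no).
Proof.
rewrite /gstep /= /gapply /= {1}/at_ eqxx /=; congr (GConf (GRun (x_ex 1 _)) _ _).
  by rewrite -vjS // addn0 ltnn.
apply: put_eq; first by apply: st_next => // k k0; rewrite ltnS_neq // (at_off k0).
case=> [a| | |] //=; rewrite ltnSn ffunE /=.
by have := exT j (ltn0Sn L'.+1); rewrite addn0 /= => ->.
Qed.

Let step_ex j i : i < L ->
  gstep (run (x_ex i (vj j i)) (j * L + i) (st j (j * L + i) (at_ j) no)) =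
  run (x_ex i.+1 (vj j i.+1)) (j * L + i.+1) (st j (j * L + i.+1) (at_ j) no).
Proof.
move=> iL; rewrite /gstep /= /gapply /= inordK ?iL; last exact: ltnW.
rewrite addnS; congr (GConf (GRun (x_ex _ _)) _ _).
  by rewrite /= ltnn vjS.
apply: put_eq; first by apply: st_next => // k k0; rewrite ltnS_neq.
case=> [a| | |] //=; rewrite ltnSn ffunE inordK // ltnn.
exact: esym (exT j iL).
Qed.

Let step_mark j v :
  gstep (run (x_ex L v) (j.+1 * L) (st j (j.+1 * L) (at_ j) no)) =
  run (x_back v) (j.+1 * L).-1 (st j (j.+1 * L) (at_ j) (at_ (j.+1 * L))).
Proof.
rewrite /gstep /= /gapply /= inordK // ltnn; congr (GConf _ _ _).
apply: put_eq; first by apply: st_next => // k k0; rewrite (at_off k0).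
by case=> [a| | |] //=; rewrite /at_ eqxx.
Qed.

Let step_back j h v b m : h <> j ->
  gstep (run (x_back v) h (st j b (at_ j) m)) =
  run (x_back v) h.-1 (st j b (at_ j) m).
Proof.
move=> hj; rewrite /gstep /= /gapply /= (at_off hj) /=; congr (GConf _ _ _).
by apply: put_eq.
Qed.

Let step_backhit j b m :
  gstep (run (x_back (vj j L)) j (st j b (at_ j) m)) =
  run x_adv j.+1 (st j.+1 b no m).
Proof.
rewrite /gstep /= /gapply /= {1}/at_ eqxx /=; congr (GConf _ _ _).
apply: put_eq; last by case=> [a| | |] //=; rewrite ltnSn ffunE ltn_ord.
by case=> [a| | |] k kj //=; [rewrite ltnS_neq|exact: at_off].
Qed.

(** Round [n] finds the cells below [n] final and without marks, which gives convergence by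
    [reach_omega_cvg]. *)
Let P n (x : gconf (gQ exchange) tape) := gs x <> GExit /\
  exists a b p m, [/\ gt x = st a b p m, n <= a, n <= b &
    forall k, k < n -> p k = false /\ m k = false].

Let Prun n q h a b p m : n <= a -> n <= b ->
  (forall k, k < n -> p k = false /\ m k = false) -> P n (run q h (st a b p m)).
Proof. by move=> na nb hk; split=> //; exists a, b, p, m. Qed.

Let at_lt n m k : n <= m -> k < n -> at_ m k = false.
Proof. by move=> nm kn; rewrite /at_ ltn_eqF // (leq_trans kn). Qed.

(** The rest of a round after the first cell of the block, which is the same for column 0 and the
    later columns. *)
Let tail j : reach (@gstep _ exchange) (P j)
  (run (x_ex 1 (vj j 1)) (j * L).+1 (st j (j * L).+1 (at_ j) no))
  (run x_adv j.+1 (st j.+1 (j.+1 * L) no (at_ (j.+1 * L)))).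
Proof.
have jL i : j <= j * L + i by rewrite (leq_trans (leq_pmulr j (ltn0Sn L'.+1))) ?leq_addr.
apply: (@reach_trans _ _ _ _ _ (run (x_ex L (vj j L)) (j.+1 * L) (st j (j.+1 * L) (at_
    j) no))).
  have := @reach_iter _ _ (@gstep _ exchange) (P j) (fun i => run (x_ex i.+1 (vj j i.+1))
    (j * L + i.+1) (st j (j * L + i.+1) (at_ j) no)) L'.+1.
  rewrite addn1 mulSn addnC; apply=> i iL; split; last by rewrite step_ex.
  by apply: Prun => // k kj; rewrite (at_lt _ kj).
apply: reach_step; first by apply: Prun => // [|k kj];
    rewrite ?mulSn ?(addnC L) ?(at_lt _ kj).
rewrite step_mark.
have e : (j.+1 * L).-1 = j + ((j.+1 * L).-1 - j).
  by rewrite subnKC // mulSn /= (leq_trans (leq_pmulr j (ltn0Sn L'.+1))) // leq_addl.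
have PB h : P j (run (x_back (vj j L)) h (st j (j.+1 * L) (at_ j) (at_ (j.+1 * L)))).
  apply: Prun => // [|k kj]; first by rewrite mulSn addnC.
  by rewrite !(at_lt _ kj) //  mulSn addnC.
rewrite e; elim: (_ - j) => [|d IH]; last first.
  apply: reach_step => //; rewrite step_back ?addnS //.
  by apply/eqP; rewrite neq_ltn ltnS leq_addr orbT.
by rewrite addn0; apply: reach_step => //; rewrite step_backhit; exact: reach_refl.
Qed.

Lemma exec_exchange : s XP = no -> s XM = no ->
  exec exchange (fun=> False) s exchanged.
Proof.
move=> sP sM.
pose c n := if n is 0 then run x_init 0 (st 0 0 no no)
            else run x_adv n (st n (n * L) no (at_ (n * L))).
have round n : reach1 (@gstep _ exchange) (P n) (c n) (c n.+1).
  case: n => [|n].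
    apply: reach1_step; first exact: Prun.
    by rewrite step_init; exact: (tail 0).
  have nL : n.+1 <= n.+1 * L by rewrite leq_pmulr.
  apply: reach1_step; first by apply: Prun => // k kn; rewrite (at_lt _ kn).
  rewrite step_adv; apply: (reach_trans _ (tail n.+1)).
  (* As [L] is at least 2, the block of column [n.+1] begins at or to the right of cell [n.+2],
     where [x_adv] leaves the head; so moving right finds the mark [XM]. *)
  have e : n.+1 * L = n.+2 + (n.+1 * L - n.+2).
    by rewrite subnKC // mulSn -addn2 addnC leq_add // leq_pmulr.
  have PG h : P n.+1 (run (x_go (vj n.+1 0)) h (st n.+1 (n.+1 * L) (at_ n.+1) (at_
      (n.+1 * L)))).
    by apply: Prun => // k kn; rewrite !(at_lt _ kn).
  apply: (@reach_trans _ _ _ _ _ (run (x_go (vj n.+1 0)) (n.+1 * L) (st n.+1 (n.+1 * L)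
      (at_ n.+1) (at_ (n.+1 * L))))).
    have := @reach_iter _ _ (@gstep _ exchange) (P n.+1) (fun i => run (x_go (vj n.+1
        0)) (n.+2 + i) (st n.+1 (n.+1 * L) (at_ n.+1) (at_ (n.+1 * L)))) (n.+1 * L -
            n.+2).
    rewrite addn0 -e; apply=> m mn; split => //; rewrite step_go ?addnS //.
    by move=> em; move: mn; rewrite e in em; move/addnI: em => ->; rewrite ltnn.
  by apply: reach_step => //; rewrite step_gohit; exact: reach_refl.
have e0 : s = st 0 0 no no.
  by apply/funext => -[a| | |] //=; apply/funext.
have := reach_omega_cvg round (fin := exchanged).
rewrite {1}/c -e0 => h.
apply: (@reach_trans _ _ _ _ _ (GConf GLim 0 exchanged)).
  apply: reach_sub; first apply: h.
    move=> n x i k [_ [a [b [p [m [-> na nb hk]]]]]] kn.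
    case: i => [i| | |] /=; rewrite ?(leq_trans kn) //.
      by have [] := hk k kn.
    by have [] := hk k kn.
  by move=> x [n [nx _]]; split.
apply: reach_step; first by split.
have -> : gstep (GConf GLim 0 exchanged) = GConf GExit 0 exchanged :> gconf (gQ
    exchange) tape.
  rewrite /gstep /= /gapply /=; congr GConf; exact: put_eq.
exact: reach_refl.
Qed.

End Exchange.

(** * Well orders in the sense of the definition of runs *)

Section WellOrder.
Variables (W : Type) (R : rel W).
Hypothesis woR : wochoice.well_order R.

Lemma wo_least (P : W -> Prop) : (exists a, P a) ->
  exists a, P a /\ forall b, P b -> R a b.
Proof.
move=> [a Pa]; have [|z [[Pz hz] _]] := woR (A := fun x => `[< P x >]).
  by exists a; exact/asboolP.
exists z; split; first exact/asboolP.
by move=> b Pb; apply: hz; exact/asboolP.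
Qed.

Lemma wo_total a b : R a b || R b a.
Proof.
have [|z [[->|->] hz]] := @wo_least (fun x => x = a \/ x = b).
- by exists a; left.
- by rewrite hz //; right.
- by rewrite [R b a]hz ?orbT //; left.
Qed.

Lemma wo_refl a : R a a.
Proof. by move: (wo_total a a); rewrite orbb. Qed.

Lemma wo_anti a b : R a b -> R b a -> a = b.
Proof.
move=> ab ba; have [|z [_ u]] := woR (A := fun x => `[< x = a \/ x = b >]).
  by exists a; apply/asboolP; left.
have h x : x = a \/ x = b -> z = x.
  move=> hx; apply: u; split; first exact/asboolP.
  by move=> y /asboolP; case: hx => -> [] ->; rewrite ?wo_refl.
have ea := h a (or_introl erefl); have eb := h b (or_intror erefl).
by rewrite -ea.
Qed.

Lemma wo_Rtrans a b c : R a b -> R b c -> R a c.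
Proof.
move=> ab bc; have [|z [hz lz]] := @wo_least (fun x => [\/ x = a, x = b | x = c]).
  by exists a; constructor 1.
have za : R z a by apply: lz; constructor 1.
have zb : R z b by apply: lz; constructor 2.
have zc : R z c by apply: lz; constructor 3.
case: hz za zb zc => -> // za zb zc; first by rewrite (wo_anti ab za).
by rewrite -(wo_anti bc zb).
Qed.

Lemma wltE a b : wlt R a b = ~~ R b a.
Proof.
by rewrite /wlt; have := wo_total a b; case: (R a b); case: (R b a).
Qed.

Lemma wlt_leq_trans a b c : wlt R a b -> R b c -> wlt R a c.
Proof. by rewrite !wltE => ab bc; apply: contra ab => ca; exact: wo_Rtrans bc ca. Qed.

Lemma leqE_wlt a b : R a b <-> a = b \/ wlt R a b.
Proof.
rewrite /wlt; split=> [ab|[->|/andP[]//]]; last exact: wo_refl.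
case e: (R b a); last by right; rewrite ab.
by left; exact: wo_anti.
Qed.

Lemma wo_strict : strict_wo (fun a b => wlt R a b).
Proof.
split.
- move=> a; apply: contrapT => na.
  have [|z [nz hz]] := @wo_least (fun x => ~ Acc (fun a b => wlt R a b) x);
      first by exists a.
  apply: nz; apply: Acc_intro => y; rewrite wltE => nzy; apply: contrapT => /hz zy.
  by rewrite zy in nzy.
- move=> a b; case ab: (R a b); last by constructor 3; rewrite wltE ab.
  case ba: (R b a); last by constructor 1; rewrite wltE ba.
  by constructor 2; exact: wo_anti.
- by move=> a b c ab /andP [bc _]; exact: wlt_leq_trans bc.
Qed.

Lemma wo_stage v : [\/ is_least R v, exists u, is_succ R u v | is_limit R v].
Proof.
case: (pselect (exists u, wlt R u v)) => [ne|no]; last first.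
  constructor 1 => u; case e: (R v u) => //; case: no; exists u; by rewrite wltE e.
case: (pselect (forall u, wlt R u v -> exists2 u', wlt R u u' & wlt R u' v)) => [nomax|].
  by constructor 3.
move=> /existsNP [m /not_implyP [mv nm]]; constructor 2; exists m; split=> // u mu.
by case e: (R v u) => //; case: nm; exists u; rewrite // wltE e.
Qed.

End WellOrder.

Lemma strict_well_order W (lt : W -> W -> Prop) : strict_wo lt ->
  wochoice.well_order (fun a b => `[< leq_of lt a b >]).
Proof.
move=> h; apply: wochoice.antisymmetric_well_order.
  move=> a b /andP [/asboolP ab /asboolP ba].
  by case: ab => // ab; case: ba => // ba; case: (wo_asym h ab ba).
move=> A [a Aa]; have [z [Az hz]] := wo_min h (P := fun x => x \in A) (ex_intro _ a Aa).
exists z; split=> // x Ax; apply/asboolP.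
by case: (wo_tri h z x) => [zx|->|/hz//]; [right|left].
Qed.

Section StateFin.
Variable n : nat.
Definition state_enc (q : state n) : option (option (option 'I_n)) :=
  match q with
  | Start => None
  | Limit => Some None
  | Halt => Some (Some None)
  | Ordinary i => Some (Some (Some i))
  end.
Definition state_dec (q : option (option (option 'I_n))) : state n :=
  match q with
  | None => Start
  | Some None => Limit
  | Some (Some None) => Halt
  | Some (Some (Some i)) => Ordinary i
  end.
Lemma state_encK : cancel state_enc state_dec. Proof. by case. Qed.
HB.instance Definition _ := Equality.copy (state n) (can_type state_encK).
HB.instance Definition _ := Choice.copy (state n) (can_type state_encK).
HB.instance Definition _ := Countable.copy (state n) (can_type state_encK).
HB.instance Definition _ := Finite.copy (state n) (can_type state_encK).
End StateFin.

(** * Given programs as subroutines *)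

Inductive ctape := CI | CS | CO | CE.

Section Call.
Variable p : program.

(* Runs [p], and then moves the head back to the leftmost cell, which is the one
   marked on the tape [CE]. *)
Definition call_prog : gprog ctape := GProg (Some Start : option (state (nstates p)))
  (fun o col =>
  let run q :=
    let: (q', (a, b, c), d) := trans q (col CI, col CS, col CO) in
    (Some (if q' is Halt then None else Some q'),
     fun t => match t with CI => a | CS => b | CO => c | CE => col CE end, d) in
  match o with
  | None => run Limit
  | Some (Some q) => run q
  | Some None => (if col CE then None else Some None, col, false)
  end).

Let mark0 : real := fun k => k == 0.

Let tapes (c : config (nstates p)) : ctape -> real := fun t =>
  match t with CI => input c | CS => scratch c | CO => output c | CE => mark0 end.

Let conv q c : gconf (gQ call_prog) ctape := GConf q (Defs.head c) (tapes c).

Let runs (q : state (nstates p)) : gstate (gQ call_prog) := GRun (Some q).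

Let conv_step q c : q = runs (cstate c) \/ q = GLim /\ cstate c = Limit ->
  gstep (conv q c) = conv (if cstate (step c) is Halt then GRun None
                           else runs (cstate (step c))) (step c).
Proof.
move=> hq; have -> : gstep (conv q c) =
    gapply (Some (Some (cstate c)) : option (gQ call_prog)) (conv q c).
  by case: hq => [->|[-> e]] //; rewrite /gstep /gapply /= e.
rewrite /gapply /= /step.
case: (trans _ _) => -[q' [[a b] o] d] /=; congr GConf; first by case: q'.
by apply/funext => -[] //=; apply/funext => k; case: eqP => // ->.
Qed.

Lemma exec_call x y (s : ctape -> real) : computes p x y ->
  s CI = x -> s CS = real_of_nat 0 -> s CO = real_of_nat 0 -> s CE = mark0 ->
  exists2 s', exec call_prog (fun=> False) s s' & s' CO = y.
Proof.
move=> [W [R [c [w [[wo hinit hsucc hlim] hw hbefore <-]]]]] sI sS sO sE.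
exists (tapes (c w)) => //.
have so := wo_strict wo.
(* The run is cut off at its first halting stage [w]; the walk of the head back to the leftmost cell
   is appended to it. *)
pose W' := {v : W | wlt R v w}.
pose lt' (a b : W') : Prop := wlt R (sval a) (sval b).
(* A program may also enter [Limit] by an instruction, so limit stages are recognised by the order
   and not by the state. *)
pose f (v : W') : gconf (gQ call_prog) ctape :=
  conv (if `[< is_limit R (sval v) >] then GLim else runs (cstate (c (sval v)))) (c
      (sval v)).
have so' : strict_wo lt'.
  split.
  - move=> [a aw]; elim: (wo_wf so a) aw => {}a _ IH aw.
    by apply: Acc_intro => -[b bw] ba; exact: IH.
  - move=> [a aw] [b bw]; case: (wo_tri so a b) => ab;
      [constructor 1| |constructor 3] => //.
    by constructor 2; subst b; congr exist; exact: Prop_irrelevance.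
  - by move=> a b d; exact: (wo_trans so).
have stepf (v : W') : gstep (f v) = conv (if cstate (step (c (sval v))) is Halt
    then GRun None else runs (cstate (step (c (sval v))))) (step (c (sval v))).
  apply: conv_step; case: asboolP => h; [right|by left].
  by split=> //; rewrite hlim.
have succ_notlim u v : is_succ R u v -> ~ is_limit R v.
  move=> [uv hu] [_ /(_ u uv) [u' uu' u'v]]; have := hu u' uu'.
  by apply/negP; rewrite -wltE.
pose c0 := GConf (GRun (gentry call_prog)) 0 s.
have nextf (v : W) (S : W' -> Prop) : R v w -> (forall u, S u <-> wlt R (sval u) v) ->
    next_conf lt' S c0 (fun u => eq (f u)) (fun u => gstep (f u))
      (if cstate (c v) is Halt then conv (GRun None) (c v) else
       conv (if `[< is_limit R v >] then GLim else runs (cstate (c v))) (c v)).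
  move=> vw hS; case: (wo_stage wo v) => [hl|[u hu]|hl].
  - constructor 1; split; first by move=> u /hS; rewrite wltE // hl.
    rewrite hinit //= asboolF; last by move=> [[u]]; rewrite wltE // hl.
    rewrite /conv /c0; congr GConf.
    by apply/funext => -[] /=; rewrite ?sI ?sS ?sO ?sE.
  - have uw : wlt R u w by apply: (wlt_leq_trans wo (b := v)) => //; case: hu.
    constructor 2; exists (exist _ u uw); split.
    + by apply/hS; case: hu.
    + move=> [t tw] /hS /= tv; case: (wo_tri so t u) => [tu|tu|ut].
      * by right.
      * by left; subst t; congr exist; exact: Prop_irrelevance.
      * by case: hu => _ /(_ t ut); move: tv; rewrite wltE // => /negbTE ->.
    rewrite stepf -(hsucc _ _ hu) asboolF; last exact: succ_notlim hu.
    by case: (cstate (c v)).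
  - have hl' := hlim v hl; rewrite asboolT // {1}hl' /=.
    case: hl => [[u uv] nomax].
    have inW t : wlt R t v -> wlt R t w by move=> tv; exact: (wlt_leq_trans wo tv).
    constructor 3; split.
    + by exists (exist _ u (inW _ uv)); exact/hS.
    + move=> [t tw] /hS /= tv; have [t' tt' t'v] := nomax t tv.
      by exists (exist _ t' (inW _ t'v)); [exact/hS|].
    rewrite hl'; congr GConf.
    have lsE (b : W -> bool) i k : (forall t, gt (f t) i k = b (sval t)) ->
        limsup_below R v b = `[< forall t, S t -> exists u0, [/\ S u0, leq_of lt' t u0 &
          exists x0, f u0 = x0 /\ gt x0 i k] >].
      move=> hb; apply: asbool_equiv_eq; split=> h.
        move=> [t tw] /hS /= tv; have [t' /andP [tt' t'v] bt'] := h t tv.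
        exists (exist _ t' (inW _ t'v)); split; first exact/hS.
          case/(leqE_wlt wo): tt' => [e|?]; [left|by right].
          by subst t'; congr exist; exact: Prop_irrelevance.
        by exists (f (exist _ t' (inW _ t'v))); rewrite hb.
      move=> t tv;
          have [|[t' t'w] [/hS /= t'v tt' [x0 [<-]]]] := h (exist _ t (inW _ tv)).
        exact/hS.
      rewrite hb => bt'; exists t' => //; rewrite t'v andbT.
      apply/(leqE_wlt wo); case: tt' => [[]|]; auto.
    apply/funext => -[] /=; apply/funext => k; try by apply: lsE.
    rewrite -(lsE (fun=> mark0 k) CE k) //.
    rewrite /limsup_below; case e: (mark0 k); symmetry.
      by apply/asboolP => t tv; exists t; rewrite // tv wo_refl.
    by apply: asboolF => /(_ u uv) [].
have conv_nohalt v : wlt R v w -> forall A (a b : A), (if cstate (c v) is Halt then a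
    else b) = b.
  by move=> /hbefore; case: (cstate (c v)).
have : seg (@gstep _ call_prog) c0 (fun x => exists v, f v = x) (conv (GRun None) (c w)).
  exists W', lt', f; split=> //.
  - move=> [v vw]; have := nextf v (lt'^~ (exist _ v vw)).
    by rewrite conv_nohalt //; apply; [case/andP: vw|].
  - have := nextf w (fun=> True); rewrite hw; apply; first exact: wo_refl.
    by move=> [u uw].
move=> sg; apply: (@reach_trans _ _ _ _ _ (conv (GRun None) (c w))).
  by exists (fun x => exists v, f v = x); split=> // z [v <-]; split=> //=; case: asboolP.
rewrite /conv; elim: (Defs.head (c w)) => [|h IH]; (apply: reach_step; first by split).
  have -> : gstep (GConf (GRun (None : gQ call_prog)) 0 (tapes (c w))) = GConf GExit 0
      (tapes (c w))
      :> gconf (gQ call_prog) ctape.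
    rewrite /gstep /= /gapply /=; congr GConf.
    by apply/funext => i; apply/funext => k; case: eqP => // ->.
  exact: reach_refl.
have -> : gstep (GConf (GRun (None : gQ call_prog)) h.+1 (tapes (c w))) = GConf (GRun
    (None : gQ call_prog)) h (tapes (c w))
    :> gconf (gQ call_prog) ctape.
  rewrite /gstep /= /gapply /=; congr GConf.
  by apply/funext => i; apply/funext => k; case: eqP => // ->.
exact: IH.
Qed.

End Call.

(** * Simulation by three tapes *)

(* Simulates three groups of [K] tapes with three tapes: the cell [h] of the tape
   [(t, i)] is the cell [h * K + i] of the tape [t]. *)
Section Blocks.
Variable K' : nat.
Local Notation K := K'.+2.
Local Notation vtape := ('I_3 * 'I_K)%type.
Variable F : gprog vtape.
Local Notation buf := {ffun vtape -> bool}.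

(** Three phases of a simulated step: reading a block into a buffer from left to right, writing the
    result from right to left, moving to a neighbouring block. The simulated state [None] is the
    limit state in the first phase, and means to halt in the other two. *)
Definition bstate : finType :=
  (option (gQ F) * 'I_K * buf + option (gQ F) * buf * bool * 'I_K +
   option (gQ F) * bool * 'I_K)%type.

Definition b_read (o : option (gQ F)) (r : nat) (b : buf) : bstate :=
  inl (inl (o, inord r, b)).
Definition b_write (o : option (gQ F)) (b : buf) (d : bool) (r : nat) : bstate :=
  inl (inr (o, b, d, inord r)).
Definition b_move (o : option (gQ F)) (d : bool) (r : nat) : bstate :=
  inr (o, d, inord r).

Let buf0 : buf := [ffun=> false].

Definition block_delta (q : bstate) (col : 'I_3 -> bool) :
    option bstate * ('I_3 -> bool) * bool :=
  match q with
  | inl (inl (o, r, b)) =>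
      let b' := [ffun i : vtape => if i.2 == r then col i.1 else b i] : buf in
      if r.+1 < K then (Some (b_read o r.+1 b'), col, true)
      else let: (q', c, d) := gdelta o b' in
           (Some (b_write q' (finfun c) d K'), fun t => c (t, r), false)
  | inl (inr (o, b, d, r)) =>
      (Some (if 0 < r then b_write o b d r.-1 else b_move o d K'.+1),
       fun t => b (t, r), if 0 < r then false else d)
  | inr (o, d, r) =>
      (if 1 < r then Some (b_move o d r.-1)
       else if o is Some q then Some (b_read (Some q) 0 buf0) else None, col, d)
  end.

Definition block_prog : gprog 'I_3 := GProg (b_read (Some (gentry F)) 0 buf0)
  (fun o => block_delta (if o is Some q then q else b_read None 0 buf0)).

Let flat (u : vtape -> real) : 'I_3 -> real :=
  fun t k => u (t, inord (k %% K)) (k %/ K).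

Let emb (x : gconf (gQ F) vtape) : gconf (gQ block_prog) 'I_3 :=
  GConf (match gs x with
         | GLim => GLim
         | GRun q => GRun (b_read (Some q) 0 buf0 : gQ block_prog)
         | GExit => GExit
         end) (gh x * K) (flat (gt x)).

Let mv (d : bool) (h : nat) := if d then h.+1 else h.-1.

Let brun q h u : gconf (gQ block_prog) 'I_3 := GConf (GRun (q : gQ block_prog)) h u.

Let modK h r : r < K -> (h * K + r) %% K = r.
Proof. by move=> rK; rewrite modnMDl modn_small. Qed.

Let divK h r : r < K -> (h * K + r) %/ K = h.
Proof. by move=> rK; rewrite divnMDl // divn_small // addn0. Qed.

Section OneStep.
Variables (x : gconf (gQ F) vtape) (o : option (gQ F)).
Hypothesis ho : gs x = (if o is Some q then GRun q else GLim).
Let h := gh x.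
Let U := flat (gt x).
Let q' := (gdelta o (fun i => gt x i h)).1.1.
Let c' := (gdelta o (fun i => gt x i h)).1.2.
Let d' := (gdelta o (fun i => gt x i h)).2.
Let Uw r : 'I_3 -> real := fun t k =>
  if (k %/ K == h) && (r <= k %% K) then c' (t, inord (k %% K)) else U t k.
Let br r : buf := [ffun i : vtape => if i.2 < r then gt x i h else false].

Let flat_at t (r : 'I_K) : U t (h * K + r) = gt x (t, r) h.
Proof. by rewrite /U /flat modK // divK // inord_val. Qed.

Let Uw0 : gstep x = GConf (if q' is Some q then GRun q else GExit) (mv d' h) (gt (gstep
    x))
  /\ flat (gt (gstep x)) = Uw 0.
Proof.
have -> : gstep x = gapply o x by rewrite /gstep ho; case: (o).
rewrite /gapply /flat /Uw /q' /c' /d' -/h; case: (gdelta o _) => -[q c] d /=; split=> //.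
apply/funext => t; apply/funext => k; rewrite /U /flat.
by rewrite andbT.
Qed.

Let Inv (y : gconf (gQ block_prog) 'I_3) := gs y <> GExit /\
  forall t k, gt y t k = U t k \/ gt y t k = Uw 0 t k.

Let InvU q k : Inv (brun q k U).
Proof. by split=> // t j; left. Qed.

Let InvUw q k r : Inv (brun q k (Uw r)).
Proof.
split=> // t j /=; rewrite /Uw; case: eqP => _ /=; last by left.
by case: ifP => _; [right|left].
Qed.

Let step_read b r : r < K'.+1 -> b = br r ->
  gstep (brun (b_read o r b) (h * K + r) U) =
  brun (b_read o r.+1 (br r.+1)) (h * K + r.+1) U.
Proof.
move=> rK ->; rewrite /gstep /= /gapply /= inordK ?ltnS ?(ltnW rK) //.
rewrite -ltnS rK addnS; congr (GConf (GRun (b_read _ _ _)) _ _).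
  apply/ffunP => -[t i]; rewrite !ffunE /=.
  rewrite -val_eqE /= inordK ?ltnS ?(ltnW rK) //.
  rewrite ?ltnS (leq_eqVlt i r); case: eqP => [e|_] //=.
  by rewrite -e flat_at.
by apply/funext => t; apply/funext => k; case: eqP => // ->.
Qed.

(** The last cell of the block is read and rewritten in one step, so the writing phase starts at the
    cell [K'] of the block. *)
Let read_last : gstep (brun (b_read o K'.+1 (br K'.+1)) (h * K + K'.+1) U) =
  brun (b_write q' (finfun c') d' K') (h * K + K') (Uw K'.+1).
Proof.
rewrite /gstep /= /gapply /= inordK // ltnn.
set bb := finfun _.
have -> : (bb : vtape -> bool) = fun i => gt x i h.
  apply/funext => -[t i]; rewrite !ffunE /= -val_eqE /= inordK //.
  have := ltn_ord i; rewrite ltnS leq_eqVlt; case: eqP => [e _|_ /= iK].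
    by rewrite -flat_at e.
  by rewrite iK.
rewrite /q' /d' /Uw /c'; case: (gdelta o _) => -[q c] d /=.
congr GConf; first by rewrite addnS.
apply/funext => t; apply/funext => k; case: eqP => [->|nk].
  by rewrite modK // divK // eqxx leqnn.
case: eqP => //= kh; case: leqP => // kK; case: nk.
have : k %% K < K by rewrite ltn_mod.
rewrite ltnS => kK'; rewrite (divn_eq k K) kh; congr (_ + _).
by apply/eqP; rewrite eqn_leq kK kK'.
Qed.

Let step_write r : r < K'.+1 ->
  gstep (brun (b_write q' (finfun c') d' r) (h * K + r) (Uw r.+1)) =
  if 0 < r then brun (b_write q' (finfun c') d' r.-1) (h * K + r.-1) (Uw r)
  else brun (b_move q' d' K'.+1) (mv d' (h * K)) (Uw 0).
Proof.
move=> rK; rewrite /gstep /= /gapply /= inordK ?ltnS ?(ltnW rK) //.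
have e : (fun (t : 'I_3) k => if k == h * K + r then (finfun c') (t, inord r) else Uw
    r.+1 t k) = Uw r.
  apply/funext => t; apply/funext => k; rewrite ffunE /Uw; case: eqP => [->|nk].
    by rewrite modK ?divK ?eqxx ?leqnn // ltnS ltnW.
  case: (eqVneq (k %/ K) h) => //= kh; rewrite [r <= _]leq_eqVlt; case: eqP => //= kr.
  by case: nk; rewrite (divn_eq k K) kh kr.
rewrite e; case: r {e} rK => [|r] rK //=; last by rewrite addnS.
by rewrite addn0.
Qed.

Let step_move r p : 0 < r -> r < K ->
  gstep (brun (b_move q' d' r) p (Uw 0)) =
  if 1 < r then brun (b_move q' d' r.-1) (mv d' p) (Uw 0)
  else GConf (if q' is Some q then GRun (b_read (Some q) 0 buf0 : gQ block_prog) else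
      GExit)
    (mv d' p) (Uw 0).
Proof.
move=> r0 rK; rewrite /gstep /= /gapply /= inordK //.
have e : (fun (t : 'I_3) k => if k == p then Uw 0 t p else Uw 0 t k) = Uw 0.
  by apply/funext => t; apply/funext => k; case: eqP => // ->.
rewrite e; case: ifP => // _; congr GConf.
by case: (q').
Qed.

(** This includes block 0, where no move to the left has any effect. *)
Let mvK d k m : iter m (mv d) (k * m) = mv d k * m.
Proof.
case: d => /=.
  have aux a n : iter n (mv true) a = n + a by elim: n => //= n ->.
  by rewrite aux mulSn.
have aux a n : iter n (mv false) a = a - n.
  by elim: n => [|n IH] /=; [rewrite subn0|rewrite IH subnS].
rewrite aux; case: k => [|k] /=; first by rewrite mul0n.
by rewrite mulSn addKn.
Qed.

(** A simulated step takes finitely many steps, in which each cell changes at most once; this is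
    what [seg_sim] asks for. *)
Lemma block_step : (gs x = GLim -> h = 0) ->
  exists V, [/\ seg (@gstep _ block_prog) (emb x) V (emb (gstep x)), V (emb x) &
    forall y, V y -> gs y <> GExit /\
      forall t k, gt y t k = gt (emb x) t k \/ gt y t k = gt (emb (gstep x)) t k].
Proof.
move=> h0; have [ex eU] := Uw0.
have -> : gt (emb x) = U by [].
have -> : gt (emb (gstep x)) = Uw 0 by rewrite /emb /= eU.
suff [V [hs hc hV]] : reach1 (@gstep _ block_prog) Inv (emb x) (emb (gstep x)).
  by exists V; split=> // y /hV [].
have b0 : buf0 = br 0 by apply/ffunP => i; rewrite !ffunE.
apply: reach1_step.
  by split=> [|t k]; [rewrite /emb /= ho; case: (o)|left].
have -> : gstep (emb x) = brun (b_read o 1 (br 1)) (h * K + 1) U.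
  rewrite -(step_read (b := buf0)) // addn0 /emb ho -/h -/U.
  by case: (o).
apply: (@reach_trans _ _ _ _ _ (brun (b_read o K'.+1 (br K'.+1)) (h * K + K'.+1) U)).
  apply: (@reach_iter _ _ (@gstep _ block_prog) Inv
    (fun r => brun (b_read o r.+1 (br r.+1)) (h * K + r.+1) U) K') => m mK.
  by split=> //; rewrite (step_read (r := m.+1)).
apply: reach_step => //; rewrite read_last.
have wr m : m < K'.+1 -> reach (@gstep _ block_prog) Inv
    (brun (b_write q' (finfun c') d' m) (h * K + m) (Uw m.+1))
    (brun (b_write q' (finfun c') d' 0) (h * K) (Uw 1)).
  elim: m => [|m IH] mK; first by rewrite addn0; exact: reach_refl.
  apply: reach_step => //; rewrite step_write //=; apply: IH; exact: ltnW.
apply: (reach_trans (wr _ (ltnSn K'))).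
apply: reach_step => //.
have := step_write (ltn0Sn K'); rewrite addn0 => -> /=.
(* The first of the [K] moves is made when the leftmost cell of the block is written, the others in
   the moving phase. *)
have -> : emb (gstep x) = GConf (if q' is Some q then GRun (b_read (Some q) 0 buf0 : gQ
    block_prog)
    else GExit) (iter K (mv d') (h * K)) (Uw 0).
  by rewrite /emb mvK eU {1}ex; congr GConf; [rewrite ex /=; case: (q')|rewrite ex].
have {ex eU h0 b0} aux m : m <= K'.+1 -> 0 < m -> forall p, reach (@gstep _ block_prog)
    Inv
    (brun (b_move q' d' m) p (Uw 0))
    (GConf (if q' is Some q then GRun (b_read (Some q) 0 buf0 : gQ block_prog)
       else GExit) (iter m (mv d') p) (Uw 0)).
  elim: m => // m IH mK _ p; apply: reach_step => //.
  rewrite step_move //; case: m IH mK => [|m] IH mK.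
    exact: reach_refl.
  by rewrite iterSr; apply: IH => //; exact: ltnW.
by rewrite iterSr; apply: aux.
Qed.

End OneStep.

Lemma exec_blocks (Cl : vtape -> Prop) s s' : exec F Cl s s' ->
  reach (@gstep _ block_prog) (fun x => gs x <> GExit)
    (GConf (GRun (gentry block_prog)) 0 (flat s)) (GConf GExit 0 (flat s')).
Proof.
move=> [V [h hV]].
have hlim : forall x, V x -> gs x = GLim -> gh x = 0.
  by apply: (seg_limhead h) => // x /gstep_lim.
apply: (@seg_sim _ _ _ _ (@gstep _ F) (@gstep _ block_prog) emb _ _ _ _ _ _ h) => //.
  by move=> i k; right; exists (i, inord (k %% K)), (k %/ K).
move=> x Vx; have [nx _] := hV x Vx.
case e: (gs x) nx => [|q|] // _.
  by apply: (block_step (o := None)) => // _; exact: hlim.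
by apply: (block_step (o := Some q)) => //; rewrite e.
Qed.

End Blocks.

Section ToProgram.
Variable G : gprog 'I_3.

Let t0 : 'I_3 := inord 0.
Let t1 : 'I_3 := inord 1.
Let t2 : 'I_3 := inord 2.

Definition to_program : program := @Program #|gQ G| (fun q abc =>
  let: (a, b, c) := abc in
  let: (q', col, d) := gdelta (match q with
      | Start => Some (gentry G) | Ordinary i => Some (enum_val i) | _ => None end)
    (fun t => if t == t0 then a else if t == t1 then b else c) in
  (if q' is Some q'' then Ordinary (enum_rank q'') else Halt,
   (col t0, col t1, col t2), d)).

Let st (q : gstate (gQ G)) : state #|gQ G| :=
  match q with GLim => Limit | GRun q => Ordinary (enum_rank q) | GExit => Halt end.

Let cv q (x : gconf (gQ G) 'I_3) : config (nstates to_program) :=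
  Config (q : state (nstates to_program)) (gh x) (gt x t0) (gt x t1) (gt x t2).

Let cv_step q x : gs x <> GExit -> (q = st (gs x) \/ q = Start /\ gs x = GRun (gentry
    G)) ->
  step (cv q x) = cv (st (gs (gstep x))) (gstep x).
Proof.
move=> nx hq.
pose o := match q with
      | Start => Some (gentry G) | Ordinary i => Some (enum_val i) | _ => None end.
have -> : gstep x = gapply o x.
  rewrite /gstep /o; case: hq => [->|[-> ->]] //; move: nx.
  by case: (gs x) => [|q'|] //= _; rewrite enum_rankK.
rewrite /step /= -/o /gapply.
have -> : (fun t => if t == t0 then gt x t0 (gh x) else
    if t == t1 then gt x t1 (gh x) else gt x t2 (gh x)) = fun t => gt x t (gh x).
  apply/funext => t; case: eqP => [->//|n0]; case: eqP => [->//|n1].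
  congr (gt x _ _); apply: val_inj; rewrite /= inordK //.
  have v0 : t <> 0 :> nat by move=> e; apply: n0; apply: val_inj; rewrite /= inordK.
  have v1 : t <> 1 :> nat by move=> e; apply: n1; apply: val_inj; rewrite /= inordK.
  by case: t v0 v1 {n0 n1} => -[|[|[|]]].
case: (gdelta o _) => -[[q'|] col] d /=; rewrite /cv /=; by congr Config.
Qed.

Lemma to_program_computes x s s' h :
  reach (@gstep _ G) (fun y => gs y <> GExit)
    (GConf (GRun (gentry G)) 0 s) (GConf GExit h s') ->
  s t0 = x -> s t1 = real_of_nat 0 -> s t2 = real_of_nat 0 ->
  computes to_program x (s' t2).
Proof.
set c0 := GConf (GRun _) 0 s; set d := GConf GExit h s'.
move=> [V [[W [lt [f [wo hf hd hV]]]] VP]] s0 s1 s2.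
have fP v : gs (f v) <> GExit by apply: VP; apply/hV; exists v.
have [w0 _] : exists w : W, True.
  by case: hd => [[_]//|[m [_ _ _]]|[[v _] _ _]]; [exists m|exists v].
(* The halting configuration [d] is not a stage of the segment; [None] is added on top for it. *)
pose lt' (a b : option W) : Prop := match a, b with
  | Some a, Some b => lt a b | Some _, None => True | None, _ => False end.
have wo' : strict_wo lt'.
  split.
  - have aS a : Acc lt' (Some a).
      by elim: (wo_wf wo a) => {}a _ IH; apply: Acc_intro => -[b /IH|[]].
    by case=> [a|]; [exact: aS|apply: Acc_intro => -[b _|[]]; exact: aS].
  - case=> [a|] [b|] /=; [|by constructor 1|by constructor 3|by constructor 2].
    by case: (wo_tri wo a b) => [?|->|?]; [constructor 1|constructor 2|constructor 3].
  - by case=> [a|] [b|] [e|] //=; exact: (wo_trans wo).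
pose R : rel (option W) := fun a b => `[< leq_of lt' a b >].
have woR : wochoice.well_order R := strict_well_order wo'.
have wltR a b : wlt R a b <-> lt' a b.
  rewrite wltE //; split=> [/asboolPn nb|ab].
    by case: (wo_tri wo' a b) => // [e|ba]; case: nb; [left|right].
  by apply/asboolPn => -[e|/(wo_asym wo')/(_ ab)//]; subst b; exact: (wo_irr wo' ab).
have nR a b : lt' a b -> R b a -> False by move=> /wltR; rewrite wltE // => /negP.
pose g w := if w is Some v then f v else d.
have hg w : next_conf lt (fun u => lt' (Some u) w) c0 (fun u => eq (f u)) (fun u =>
    gstep (f u)) (g w).
  by case: w => [w|]; [exact: hf|exact: hd].
(* At the first stage the state is [Start], which [to_program] treats like the entry state of
   [G]. *)
pose c w := cv (if `[< is_least R w >] then Start else st (gs (g w))) (g w).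
have leastE w : is_least R w -> forall u, ~ lt' (Some u) w.
  by move=> hl u /wltR; rewrite wltE // hl.
have noneL : ~ is_least R None by move=> /leastE /(_ w0); exact.
have succE v w : is_succ R v w -> exists u, v = Some u /\ g w = gstep (f u).
  move=> [/wltR vw hu]; case: v vw hu => [v|//] vw hu; exists v; split=> //.
  case: (hg w) => [[/(_ v)//]|[m [mw mmax ->]]|[_ nomax _]].
    case: (mmax v vw) => [->//|vm].
    by case: (nR _ _ mw (hu (Some m) ((wltR (Some v) (Some m)).2 vm))).
  have [u uw vu] := nomax v vw.
  by case: (nR _ _ uw (hu (Some u) ((wltR (Some v) (Some u)).2 vu))).
have startE w : is_least R w -> g w = c0.
  move=> /leastE hl; case: (hg w) => [[]//|[m [mw]]|[[m mw]]]; by case: (hl m).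
exists (option W), R, c, None; split.
- split=> //.
  + move=> w hl; rewrite /c asboolT // startE //= /cv /=.
    by rewrite s0 s1 s2.
  + move=> v w vw; have [u [ev eg]] := succE _ _ vw; subst v.
    rewrite /c asboolF; last first.
      by move=> /leastE /(_ u); apply; apply/wltR; case: vw.
    rewrite eg; symmetry; apply: (cv_step (fP u)).
    case: asboolP => hl; [right; split=> //|by left].
    by have /= -> := startE _ hl.
  + move=> w [[v /wltR vw] nomax]; case: v vw => [v|//] vw.
    rewrite /c asboolF; last by move=> /leastE /(_ v); exact.
    have gE : g w = glim lt (fun u => lt' (Some u) w) (fun u => eq (f u)).
      case: (hg w) => [[/(_ v)//]|[m [mw mmax _]]|[_ _ ->]//].
      have [|u /wltR mu /wltR uw] := nomax (Some m); first exact/wltR.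
      case: u mu uw => [u|//] mu uw; case: (mmax u uw) => [e|um].
        by subst u; case: (wo_irr wo mu).
      by case: (wo_asym wo um mu).
    have lsE t (b : option W -> bool) : forall k, (forall u, b (Some u) = gt (f u) t k) ->
        gt (g w) t k = limsup_below R w b.
      move=> k hb; rewrite gE; apply: asbool_equiv_eq; split=> hP.
        move=> [u|] /wltR // uw; have [u' [u'w uu' [y [<- hy]]]] := hP u uw.
        exists (Some u'); last by rewrite hb.
        apply/andP; split; last exact/wltR.
        by apply/asboolP; case: uu' => [->|]; [left|right].
      move=> u uw; have [|[u'|] /andP [/asboolP uu' /wltR u'w]] := hP (Some u) _.
      - exact/wltR.
      - rewrite hb => hy; exists u'; split=> //; last by exists (f u').
        by case: uu' => [[->]|]; [left|right].
      - by case: uu'.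
    rewrite /cv /limit_config {1 2}gE; congr Config;
      by apply/funext => k; apply: lsE => u.
- by rewrite /c asboolF.
- move=> [v|] /wltR // _; rewrite /c /=; case: asboolP => // _.
  by have := fP v; case: (gs (f v)).
- by [].
Qed.

End ToProgram.

(** * Programs with variables *)

Section XtapeFin.
Variable L : nat.
Definition xtape_enc (t : xtape L) : 'I_L + 'I_3 :=
  match t with XI i => inl i | XT => inr (inord 0) | XP => inr (inord 1) | XM => inr
      (inord 2) end.
Definition xtape_dec (t : 'I_L + 'I_3) : xtape L :=
  match t with inl i => XI i
  | inr j => if j == 0 :> nat then XT else if j == 1 :> nat then XP else XM end.
Lemma xtape_encK : cancel xtape_enc xtape_dec.
Proof. by case=> [i| | |] //=; rewrite !inordK. Qed.
HB.instance Definition _ := Equality.copy (xtape L) (can_type xtape_encK).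
HB.instance Definition _ := Choice.copy (xtape L) (can_type xtape_encK).
HB.instance Definition _ := Countable.copy (xtape L) (can_type xtape_encK).
HB.instance Definition _ := Finite.copy (xtape L) (can_type xtape_encK).
End XtapeFin.

Definition ctape_enc (t : ctape) : bool * bool :=
  match t with CI => (true, true) | CS => (true, false) | CO => (false, true)
  | CE => (false, false) end.
Definition ctape_dec (t : bool * bool) : ctape :=
  match t with (true, true) => CI | (true, false) => CS | (false, true) => CO
  | (false, false) => CE end.
Lemma ctape_encK : cancel ctape_enc ctape_dec. Proof. by case. Qed.
HB.instance Definition _ := Equality.copy ctape (can_type ctape_encK).
HB.instance Definition _ := Choice.copy ctape (can_type ctape_encK).
HB.instance Definition _ := Countable.copy ctape (can_type ctape_encK).
HB.instance Definition _ := Finite.copy ctape (can_type ctape_encK).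

Section Wrap.
Variables (N : nat) (X : eqType) (G : gprog X).
Variables (inm : bool -> ('I_N -> bool) -> X -> bool)
  (outm : (X -> bool) -> ('I_N -> bool) -> 'I_N -> bool).
Local Notation T0 := ('I_N + X)%type.

(** The state is [true] in the leftmost cell only, so that [inm] can write a mark there. *)
Definition wrap_in : gprog T0 := sweep true (fun m col => (false, fun t =>
  match t with inl i => col (inl i) | inr x => inm m (fun i => col (inl i)) x end)).

Definition wrap_out : gprog T0 := sweep tt (fun m col => (tt, fun t =>
  match t with
  | inl i => outm (fun x => col (inr x)) (fun i => col (inl i)) i
  | inr x => col (inr x)
  end)).

Definition wrap_iota (x : X) : option T0 := Some (inr x).
Definition wrap_pi (t : option T0) : option X :=
  if t is Some (inr x) then Some x else None.

(** [G] works on private tapes, which are initialised from the variables by one sweep and read by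
    another. The variables change during the last sweep only, so they are clean however [G]
    behaves. *)
Definition wrap_prog : gprog (option (option T0)) :=
  seq_prog (seq_prog wrap_in G Some id wrap_iota wrap_pi None) wrap_out
    Some id (fun t => Some (Some t)) (fun t => if t is Some o then o else None) None.

Lemma exec_wrap Cl (s : 'I_N -> real) (u : option (option T0) -> real) x1 :
  (forall i, u (Some (Some (inl i))) = s i) ->
  exec G Cl (fun x k => inm (k == 0) (fun i => s i k) x) x1 ->
  exists2 u', exec wrap_prog (fun t => exists i, t = Some (Some (inl i))) u u' &
    forall i, u' (Some (Some (inl i))) =
      fun k => outm (fun x => x1 x k) (fun i => s i k) i.
Proof.
move=> us hG.
pose v : option T0 -> real := u \o Some.
have [v1 hv1 ev1] : exists2 v', exec (seq_prog wrap_in G Some id wrap_iota wrap_pi None)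
    (fun t => exists i, t = Some (inl i)) v v' &
    (forall i, v' (Some (inl i)) = s i) /\ forall x, v' (Some (inr x)) = x1 x.
  have h1 := exec_sweep true (fun m col => (false, fun t : T0 =>
    match t with inl i => col (inl i) | inr x => inm m (fun i => col (inl i)) x end))
        (v \o Some).
  set w := sweep_out _ _ _ in h1.
  have wl i : w (inl i) = s i by apply/funext => k; rewrite /w /sweep_out /= /v /= us.
  have wr x k : w (inr x) k = inm (k == 0) (fun i => s i k) x.
    rewrite /w /sweep_out /= /v /=; congr (inm _ _ x); first by case: k.
    by apply/funext => i; rewrite us.
  have [|||||||||s' h es'] := @exec_seq (option T0) _ _ wrap_in G Some id wrap_iota
      wrap_pi None
     _ _ _ _ _ _ (fun=> True) Cl (fun t => exists i, t = Some (inl i)) v w x1;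
         rewrite -?/w //.
  - by case=> [[i|x]|] // y [->].
  - rewrite (_ : _ \o _ = fun x k => inm (k == 0) (fun i => s i k) x) //.
    by apply/funext => x; apply/funext => k; rewrite /= /combine /= wr.
  - move=> j [i ->]; split=> //; left; rewrite /combine /= wl /v /=; exact: esym (us i).
  by exists s' => //; split=> [i|x]; rewrite es' // /combine /= ?wl.
have h3 := exec_sweep tt (fun m col => (tt, fun t : T0 =>
  match t with
  | inl i => outm (fun x => col (inr x)) (fun i => col (inl i)) i
  | inr x => col (inr x)
  end)) (v1 \o Some).
set w := sweep_out _ _ _ in h3.
have wl i : w (inl i) = fun k => outm (fun x => x1 x k) (fun i => s i k) i.
  apply/funext => k; rewrite /w /sweep_out /=; congr (outm _ _ i).
    by apply/funext => x; rewrite ev1.2.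
  by apply/funext => j; rewrite ev1.1.
have [|||||||||s' h es'] := @exec_seq (option (option T0)) _ _
  (seq_prog wrap_in G Some id wrap_iota wrap_pi None) wrap_out Some id
  (fun t => Some (Some t)) (fun t => if t is Some o then o else None) None _ _ _ _ _ _
  (fun t => exists i, t = Some (inl i)) (fun=> True)
  (fun t => exists i, t = Some (Some (inl i))) u v1 w => //.
- by case=> [[t|]|] // t' [->].
- by move=> j [i ->]; split=> // [t [<-]|]; [exists i|left; rewrite /combine /= ev1.1 us].
exists s' => // i; by rewrite es' // /combine /= wl.
Qed.

End Wrap.

Section Rename.
Variables (T T' : Type) (F : gprog T) (iota : T -> T') (pi : T' -> option T).
Hypothesis piK : forall i, pi (iota i) = Some i.

Definition rename_prog : gprog T' := GProg (gentry F) (fun o col =>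
  lift_out pi id None (gdelta o (col \o iota)) col).

Lemma exec_rename Cl s s' o : exec F Cl s s' ->
  exec rename_prog (fun=> False) (combine pi s o) (combine pi s' o).
Proof.
move=> h; apply: reach_sub.
  apply: (exec_embed (G := rename_prog) piK (kappa := id) (kx := None) _ _ h) => //.
by move=> x [nx _]; split.
Qed.

End Rename.

Definition store : Type := nat -> real.

Definition upd (s : store) (t : nat) (x : real) : store :=
  fun i => if i == t then x else s i.

Definition tapes_of N (J : Type) (s : store) (u : J -> real) : 'I_N + J -> real :=
  fun t => match t with inl i => s i | inr j => u j end.

(* Machines compute [f] on all large enough numbers [N] of variables, in the
   presence of additional tapes [J] with arbitrary content. *)
Definition scomp (D : store -> Prop) (f : store -> store) : Prop :=
  exists N0, forall N, N0 <= N -> exists (J : finType) (F : gprog ('I_N + J)),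
    forall s, D s -> forall u, exists u',
      exec F (fun=> False) (@tapes_of N J s u) (@tapes_of N J (f s) u').

Lemma comp_intro (D : store -> Prop) (f : store -> store) N0 :
  (forall N, N0 <= N -> exists (T : finType) (v : 'I_N -> T) (F : gprog T),
    injective v /\ forall s, D s -> forall u, (forall i, u (v i) = s i) ->
      exists2 u', exec F (fun=> False) u u' & forall i, u' (v i) = f s i) ->
  scomp D f.
Proof.
move=> h; exists N0 => N /h [T [v [F [vinj hF]]]].
pose vinv (t : T) : option 'I_N := [pick i | v i == t].
have vK i : vinv (v i) = Some i.
  by rewrite /vinv; case: pickP => [j /eqP/vinj ->//|/(_ i)]; rewrite eqxx.
have vinvK t i : vinv t = Some i -> v i = t.
  by rewrite /vinv; case: pickP => // j /eqP <- [<-].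
pose iota (t : T) : 'I_N + T := if vinv t is Some i then inl i else inr t.
pose pi (t : 'I_N + T) : option T := match t with
  | inl i => Some (v i) | inr t => if vinv t is Some _ then None else Some t end.
have piK t : pi (iota t) = Some t.
  by rewrite /iota; case e: (vinv t) => [i|] /=; [rewrite (vinvK _ _ e)|rewrite e].
exists T, (rename_prog F iota pi) => s Ds u.
pose w (t : T) : real := if vinv t is Some i then s i else u t.
have [|w' hw' ew'] := hF s Ds w; first by move=> i; rewrite /w vK.
exists (fun t => if vinv t is Some _ then u t else w' t).
have := exec_rename piK (tapes_of s u) hw'.
rewrite (_ : combine _ _ _ = tapes_of s u); last first.
  apply/funext => -[i|t]; rewrite /combine /= ?/w ?vK //.
  by case e: (vinv t) => [i|] //; rewrite /w e.
rewrite (_ : combine _ _ _ = tapes_of (f s) (fun t => if vinv t is Some _ then u t else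
    w' t)) //.
apply/funext => -[i|t]; rewrite /combine /= ?ew' //.
by case e: (vinv t) => [i|].
Qed.

Section SeqTapes.
Variables (N : nat) (J1 J2 : Type).
Let T := ('I_N + option (J1 + J2))%type.
Definition iota_l (t : 'I_N + J1) : T :=
  match t with inl i => inl i | inr j => inr (Some (inl j)) end.
Definition pi_l (t : T) : option ('I_N + J1) :=
  match t with inl i => Some (inl i) | inr (Some (inl j)) => Some (inr j) | _ => None end.
Definition iota_r (t : 'I_N + J2) : T :=
  match t with inl i => inl i | inr j => inr (Some (inr j)) end.
Definition pi_r (t : T) : option ('I_N + J2) :=
  match t with inl i => Some (inl i) | inr (Some (inr j)) => Some (inr j) | _ => None end.
Lemma pi_lK i : pi_l (iota_l i) = Some i. Proof. by case: i. Qed.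
Lemma pi_rK i : pi_r (iota_r i) = Some i. Proof. by case: i. Qed.
Lemma iota_lK j i : pi_l j = Some i -> iota_l i = j.
Proof. by case: j => [k|[[k|k]|]] //= [<-]. Qed.
Lemma iota_rK j i : pi_r j = Some i -> iota_r i = j.
Proof. by case: j => [k|[[k|k]|]] //= [<-]. Qed.
End SeqTapes.

(** The machines share the variables, but have separate additional tapes. As the content of these is
    arbitrary, nothing has to be cleared. *)
Lemma comp_seq (D D' : store -> Prop) f g :
  scomp D f -> scomp D' g -> (forall s, D s -> D' (f s)) -> scomp D (g \o f).
Proof.
move=> [N1 h1] [N2 h2] DD'; apply: (@comp_intro _ _ (maxn N1 N2)) => N.
rewrite geq_max => /andP [/h1 [J1 [F1 hF1]] /h2 [J2 [F2 hF2]]].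
exists ('I_N + option (J1 + J2))%type, inl,
  (seq_prog F1 F2 (@iota_l N J1 J2) (@pi_l N J1 J2) (@iota_r N J1 J2) (@pi_r N J1 J2)
      (inr None)).
split=> [i j []//|s Ds u us].
have [u1 e1] := hF1 s Ds (fun j => u (inr (Some (inl j)))).
have [u2 e2] := hF2 _ (DD' _ Ds) (fun j => u (inr (Some (inr j)))).
have [|||s' h es'] := exec_seq (@pi_lK N J1 J2) (@iota_lK N J1 J2) (fl := inr None) erefl
  (@pi_rK N J1 J2) (@iota_rK N J1 J2) erefl (F1 := F1) (F2 := F2) (Cl1 := fun=> False)
  (Cl2 := fun=> False) (Cl := fun=> False) (s := u) (u1 := tapes_of (f s) u1)
  (u2 := tapes_of (g (f s)) u2) => //.
- by rewrite (_ : _ \o _ = tapes_of s (fun j => u (inr (Some (inl j))))) //;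
    apply/funext => -[i|j] //=; exact: us.
- rewrite (_ : _ \o _ = tapes_of (f s) (fun j => u (inr (Some (inr j))))) //.
  by apply/funext => -[i|j] //=; exact: us.
by exists s' => // i; rewrite es'.
Qed.

Lemma comp_if (D : store -> Prop) f g t :
  scomp (fun s => D s /\ s t 0 = false) f -> scomp (fun s => D s /\ s t 0 = true) g ->
  scomp D (fun s => if s t 0 then g s else f s).
Proof.
move=> [N1 h1] [N2 h2]; apply: (@comp_intro _ _ (maxn t.+1 (maxn N1 N2))) => N.
rewrite !geq_max => /and3P [tN /h1 [J1 [F1 hF1]] /h2 [J2 [F2 hF2]]].
exists ('I_N + option (J1 + J2))%type, inl,
  (if_prog F1 F2 (@iota_l N J1 J2) (@pi_l N J1 J2) (@iota_r N J1 J2) (@pi_r N J1 J2)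
      (inr None)
    (inl (Ordinal tN))).
split=> [i j []//|s Ds u us].
have ht : u (inl (Ordinal tN)) = s t by rewrite us.
have [u1 e1] : exists u1, s t 0 = false ->
    exec F1 (fun=> False) (u \o (@iota_l N J1 J2)) (tapes_of (f s) u1).
  case e: (s t 0); first by exists (fun=> real_of_nat 0).
  have [u1 h] := hF1 s (conj Ds e) (fun j => u (inr (Some (inl j)))).
  exists u1 => _; rewrite (_ : _ \o _ = tapes_of s (fun j => u (inr (Some (inl j))))) //.
  by apply/funext => -[i|j] //=; exact: us.
have [u2 e2] : exists u2, s t 0 = true ->
    exec F2 (fun=> False) (u \o (@iota_r N J1 J2)) (tapes_of (g s) u2).
  case e: (s t 0); last by exists (fun=> real_of_nat 0).
  have [w h] := hF2 s (conj Ds e) (fun j => u (inr (Some (inr j)))).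
  exists w => _; rewrite (_ : _ \o _ = tapes_of s (fun j => u (inr (Some (inr j))))) //.
  by apply/funext => -[i|j] //=; exact: us.
rewrite -ht in e1 e2.
have [s' h es'] := exec_if (@pi_lK N J1 J2) (@iota_lK N J1 J2) (fl := inr None) erefl
  (@pi_rK N J1 J2) (@iota_rK N J1 J2) erefl e1 e2.
by exists s' => // i; rewrite es' // ht; case: (s t 0).
Qed.

Definition limsup (x : nat -> real) : real :=
  fun k => `[< forall n, exists2 m, n <= m & x m k >].

(** The machine for [f] may show temporary values on the variables, so the body of the loop is its
    wrapped form, for which the variables are clean. *)
Lemma comp_loop (D : store -> Prop) f : scomp D f -> (forall s, D s -> D (f s)) ->
  scomp D (fun s i => limsup (fun n => iter n f s i)).
Proof.
move=> [N0 h] Df; apply: (@comp_intro _ _ N0) => N /h [J [F hF]].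
pose inm (m : bool) (c : 'I_N -> bool) (x : 'I_N + J) := if x is inl i then c i else
    false.
pose outm (c : 'I_N + J -> bool) (d : 'I_N -> bool) (i : 'I_N) := c (inl i).
pose B := wrap_prog F inm outm.
exists (option (option (option ('I_N + ('I_N + J))))), (fun i => Some (Some (Some (inl
    i)))),
  (loop_prog B Some id None).
split=> [i j []//|s Ds u us].
have D_ n : D (iter n f s) by elim: n => //= n; exact: Df.
pose v (i : 'I_N) : option (option ('I_N + ('I_N + J))) := Some (Some (inl i)).
have body (n : nat) (w : option (option ('I_N + ('I_N + J))) -> real) : exists w',
    (forall i, w (v i) = iter n f s i) ->
    exec B (fun t => exists i, t = v i) w w' /\ forall i, w' (v i) = iter n.+1 f s i.
  case: (pselect (forall i, w (v i) = iter n f s i)) => [hw|]; last by exists w.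
  have [u' hu'] := hF _ (D_ n) (fun=> (fun=> false)).
  have [|w' h1 h2] := @exec_wrap N _ F inm outm (fun=> False) (iter n f s \o val) w
      (tapes_of (iter n.+1 f s) u') hw.
    rewrite (_ : (fun _ _ => _) = tapes_of (iter n f s) (fun _ _ => false)) //.
    by apply/funext => -[i|j]; apply/funext => k.
  by exists w' => _; split.
have [G hG] : {G : nat -> (option (option ('I_N + ('I_N + J))) -> real) -> _ |
    forall n w, (forall i, w (v i) = iter n f s i) ->
    exec B (fun t => exists i, t = v i) w (G n w) /\ forall i, G n w (v i) = iter n.+1
        f s i}.
  exists (fun n w => projT1 (cid (body n w))) => n w; exact: projT2 (cid (body n w)).
pose us_ := fix us_ n := if n is n'.+1 then G n' (us_ n') else u \o Some.
have us_v n i : us_ n (v i) = iter n f s i.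
  elim: n i => [|n IH] i; first by rewrite /= us.
  exact: (hG n (us_ n) IH).2.
have [||||n|s' h1 [_ h2]] := @exec_loop _ _ B Some id None _ _ _
   (fun t => exists i, t = v i) u us_ => //.
- exact: (hG n (us_ n) (us_v n)).1.
exists s' => // i; apply/funext => k; rewrite (h2 (v i)); last by exists i.
by apply: asbool_equiv_eq; split=> hn n; have [m nm] := hn n; exists m => //;
    rewrite ?us_v // -us_v.
Qed.

Section Mealy.
Variables (M : finType) (m0 : M) (mu : M -> bool -> M * bool).

Fixpoint mealy_state (x : real) (n : nat) : M :=
  if n is n'.+1 then (mu (mealy_state x n') (x n')).1 else m0.

Definition mealy (x : real) : real := fun k => (mu (mealy_state x k) (x k)).2.

Lemma comp_mealy a t : scomp (fun=> True) (fun s => upd s t (mealy (s a))).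
Proof.
apply: (@comp_intro _ _ (maxn a.+1 t.+1)) => N; rewrite geq_max => /andP [aN tN].
pose nu (m : M) (col : 'I_N -> bool) := ((mu m (col (Ordinal aN))).1,
  fun i : 'I_N => if i == t :> nat then (mu m (col (Ordinal aN))).2 else col i).
exists 'I_N, id, (sweep m0 nu); split=> // s _ u us.
exists (sweep_out m0 nu u); first exact: exec_sub (exec_sweep m0 nu u) _.
have hst k : sweep_state m0 nu u k = mealy_state (s a) k.
  by elim: k => //= k ->; rewrite us.
move=> i; apply/funext => k; rewrite /sweep_out /= hst /upd us us.
by case: eqP.
Qed.

End Mealy.

Definition unpair1 (x : real) : real := fun k => x k.*2.
Definition unpair2 (x : real) : real := fun k => x k.*2.+1.

Lemma unpair1K x y : unpair1 (rpair x y) = x.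
Proof. by apply/funext => k; rewrite /unpair1 /rpair odd_double doubleK. Qed.

Lemma unpair2K x y : unpair2 (rpair x y) = y.
Proof. by apply/funext => k; rewrite /unpair2 /rpair /= odd_double uphalf_double. Qed.

Lemma unpairK x : rpair (unpair1 x) (unpair2 x) = x.
Proof.
apply/funext => k; rewrite /rpair /unpair1 /unpair2; have := odd_double_half k.
by case: (odd k) => /= hk; rewrite -[in RHS]hk.
Qed.

(** For two interleaved tapes the exchange yields pairing and both projections at once. *)
Lemma comp_exchange a b c : a != b -> a != c -> b != c ->
  scomp (fun=> True) (fun s => upd (upd (upd s a (rpair (s b) (s c)))
    b (unpair1 (s a))) c (unpair2 (s a))).
Proof.
move=> ab ac bc; apply: (@comp_intro _ _ (maxn a.+1 (maxn b.+1 c.+1))) => N.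
rewrite !geq_max => /and3P [aN bN cN].
pose inm (m : bool) (col : 'I_N -> bool) (x : xtape 2) := match x with
  | XI i => if i == 0 :> nat then col (Ordinal bN) else col (Ordinal cN)
  | XT => col (Ordinal aN) | _ => false end.
pose outm (col : xtape 2 -> bool) (d : 'I_N -> bool) (i : 'I_N) :=
  if i == c :> nat then col (XI (inord 1)) else if i == b :> nat then col (XI (inord 0))
  else if i == a :> nat then col XT else d i.
exists (option (option ('I_N + xtape 2))), (fun i => Some (Some (inl i))),
  (wrap_prog (exchange 0) inm outm).
split=> [i j []//|s _ u us].
have hx := @exec_exchange 0 (fun x k => inm (k == 0) (fun i => (s \o val) i k) x) erefl
    erefl.
have [u' h1 h2] := @exec_wrap N _ (exchange 0) inm outm _ (s \o val) u _ us hx.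
exists u'; first exact: exec_sub h1 _.
move=> i; rewrite h2; apply/funext => k; rewrite /outm /upd.
case: eqP => _; first by rewrite /= /unpair2 inordK // addn1 muln2.
case: eqP => _; first by rewrite /= /unpair1 inordK // addn0 muln2.
case: eqP => _ //=; rewrite /rpair inordK ?ltn_mod // modn2 divn2.
by case: (odd k).
Qed.

Lemma comp_call p f a t :
  scomp (fun s => computes p (s a) (f (s a))) (fun s => upd s t (f (s a))).
Proof.
apply: (@comp_intro _ _ (maxn a.+1 t.+1)) => N; rewrite geq_max => /andP [aN tN].
pose inm (m : bool) (col : 'I_N -> bool) (x : ctape) := match x with
  | CI => col (Ordinal aN) | CE => m | _ => false end.
pose outm (col : ctape -> bool) (d : 'I_N -> bool) (i : 'I_N) :=
  if i == t :> nat then col CO else d i.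
exists (option (option ('I_N + ctape))), (fun i => Some (Some (inl i))),
  (wrap_prog (call_prog p) inm outm).
split=> [i j []//|s hs u us].
pose x0 (x : ctape) (k : nat) := inm (k == 0) (fun i => (s \o val) i k) x.
have [||||x1 hx1 eo] := @exec_call p _ _ x0 hs => //.
have [u' h1 h2] := @exec_wrap N _ (call_prog p) inm outm _ (s \o val) u _ us hx1.
exists u'; first exact: exec_sub h1 _.
move=> i; rewrite h2; apply/funext => k; rewrite /outm /upd.
by case: eqP => // _; rewrite eo.
Qed.

Definition ostore (x : real) : store := fun i => if i == 0 then x else fun=> false.

(** In terms of blocks, the input is interleaved on the [K] tapes of the first group, and the output
    is expected in this form in the third. So an exchange collects the input in variable 0, and
    after [F] another one spreads variable [r]. All other tapes are placed in the second group,
    which starts blank. *)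
Lemma comp_program (D : real -> Prop) c f r :
  scomp (fun s => D (s 0)) c -> (forall x, D x -> c (ostore x) r = f x) ->
  exists p, forall x, D x -> computes p x (f x).
Proof.
move=> [N0 hN] hc; pose N := (maxn N0 r).+1.
have [J [F hF]] := hN N (leq_trans (leq_maxl N0 r) (leqnSn _)).
have rN : r < N by rewrite ltnS leq_maxr.
pose I0 : finType := ('I_N + J)%type.
pose S : finType := option (option (I0 + bool)).
(* The type [S] comprises all the tapes for the second group: those of [F], the two marks of the
   exchanges and the flags of the two compositions. Adding 2 ensures that at least two tapes are
   interleaved. *)
pose K' := #|S|; pose K := K'.+2.
pose T1 : finType := ((I0 + bool) + ('I_K + 'I_K))%type.
pose iF (t : I0) : option T1 := Some (inl (inl t)).
pose pF (t : option T1) : option I0 := if t is Some (inl (inl t)) then Some t else None.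
pose iX (v : I0) (b : bool) (t : xtape K) : T1 := match t with
  | XI i => inr (if b then inr i else inl i) | XT => inl (inl v)
  | XP => inl (inr false) | XM => inl (inr true) end.
pose pX (v : I0) (b : bool) (t : T1) : option (xtape K) := match t with
  | inr (inl i) => if b then None else Some (XI i)
  | inr (inr i) => if b then Some (XI i) else None
  | inl (inl w) => if w == v then Some XT else None
  | inl (inr false) => Some XP | inl (inr true) => Some XM end.
have pXK v b t : pX v b (iX v b t) = Some t.
  by case: t => [i| | |] //=; [case: b|rewrite eqxx].
have iXK v b j t : pX v b j = Some t -> iX v b t = j.
  case: j => [[w|[]]|[i|i]] /=; try by move=> [<-].
  - by case: eqP => // -> [<-].
  - by case: b => // -[<-].
  - by case: b => // -[<-].
pose v0 : I0 := inl ord0; pose v1 : I0 := inl (Ordinal rN).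
pose i1 t := Some (iX v0 false t).
pose p1 (t : option T1) := if t is Some t' then pX v0 false t' else None.
pose A := seq_prog (exchange K') F i1 p1 iF pF None.
pose i2 t := Some (Some (iX v1 true t)).
pose p2 (t : option (option T1)) := if t is Some (Some t') then pX v1 true t' else None.
pose B := seq_prog A (exchange K') Some id i2 p2 None.
pose rk (x : S) : 'I_K := widen_ord (leq_trans (leqnSn K') (leqnSn K'.+1)) (enum_rank x).
pose rkinv (i : 'I_K) : option S := if insub (val i) is Some j then Some (enum_val (j :
    'I_#|S|)) else None.
have rkK x : rkinv (rk x) = Some x.
  by rewrite /rkinv /= valK enum_rankK.
pose iota (t : option (option T1)) : 'I_3 * 'I_K := match t with
  | Some (Some (inr (inl i))) => (inord 0, i)
  | Some (Some (inr (inr i))) => (inord 2, i)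
  | Some (Some (inl x)) => (inord 1, rk (Some (Some x)))
  | Some None => (inord 1, rk (Some None))
  | None => (inord 1, rk None) end.
pose pi (t : 'I_3 * 'I_K) : option (option (option T1)) :=
  if t.1 == 0 :> nat then Some (Some (Some (inr (inl t.2))))
  else if t.1 == 2 :> nat then Some (Some (Some (inr (inr t.2))))
  else if rkinv t.2 is Some x then Some (match x with
     | Some (Some y) => Some (Some (inl y)) | Some None => Some None | None => None
         end) else None.
have piK t : pi (iota t) = Some t.
  by case: t => [[[x|[i|i]]|]|]; rewrite /pi /iota /= !inordK //= rkK.
pose P := rename_prog B iota pi.
exists (to_program (block_prog P)) => x Dx.
pose no : real := fun=> false.
pose z0 : option (option T1) -> real := fun t => if t is Some (Some (inr (inl i)))
  then fun k => x (k * K + i) else no.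
pose y0 := z0 \o Some.
have [u' hF'] := hF (ostore x) Dx (fun=> no).
have hE1 := @exec_exchange K' (y0 \o i1) erefl erefl.
set e1 := exchanged _ in hE1.
have e1T : e1 XT = x.
  by apply/funext => k; rewrite /e1 /= /y0 /= inordK ?ltn_mod // -divn_eq.
have pFK t : pF (iF t) = Some t by [].
have iFK j t : pF j = Some t -> iF t = j by case: j => [[[w|w]|w]|] //= [->].
have p1K t : p1 (i1 t) = Some t by exact: pXK.
have i1K j t : p1 j = Some t -> i1 t = j by case: j => [j|//] /iXK <-.
have p2K t : p2 (i2 t) = Some t by exact: pXK.
have i2K j t : p2 j = Some t -> i2 t = j by case: j => [[j|//]|//] /iXK <-.
have sF : combine p1 e1 y0 \o iF = tapes_of (ostore x) (fun=> no).
  apply/funext => -[i|j]; rewrite /combine //=.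
  rewrite (_ : (inl i == v0) = (i == 0 :> nat)) // /ostore.
  by case: eqP.
rewrite -sF in hF'.
have [|a1 ha1 ea1] := exec_seq p1K i1K (erefl : p1 None = None) pFK iFK (erefl : pF
    None = None)
  (Cl := fun=> False) hE1 hF' => //.
set y2 := combine pF _ _ in ea1.
have hE2 := @exec_exchange K' (combine id a1 z0 \o i2).
have [||||b hb eb] := exec_seq (fun t : option T1 => erefl (Some t)) _ (erefl : id None
    = None)
  p2K i2K (erefl : p2 None = None) (Cl := fun=> False) (s := z0) ha1 (hE2 _ _) => //.
- by rewrite /= /combine /= ea1.
- by rewrite /= /combine /= ea1.
have := exec_blocks (exec_rename piK (fun=> no) hb).
move=> /to_program_computes h.
have := h x; rewrite -/P; set res := (X in computes _ _ X).
have -> : res = f x.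
  apply/funext => k; rewrite /res /combine /pi /= !inordK //= eb //.
  rewrite /combine /= ea1 // /y2 /combine /= !inordK ?ltn_mod // -divn_eq.
  by rewrite /= -hc.
apply.
- apply/funext => k; rewrite /combine /pi /= !inordK //=.
  by rewrite /= inordK ?ltn_mod // -divn_eq.
- apply/funext => k; rewrite /combine /pi /= !inordK //=.
  by case: (rkinv _) => [[[]|]|].
- by apply/funext => k; rewrite /combine /pi /= !inordK.
Qed.

(** * Computable functions between encoded types *)

Class Enc (T : Type) := enc : T -> real.
#[export] Instance enc_real : Enc real := id.
#[export] Instance enc_nat : Enc nat := real_of_nat.
#[export] Instance enc_bool : Enc bool := fun b => real_of_nat b.
#[export] Instance enc_prod (A B : Type) {eA : Enc A} {eB : Enc B} : Enc (A * B) :=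
  fun p => rpair (enc p.1) (enc p.2).

Lemma comp_sub (D D' : store -> Prop) (c : store -> store) : scomp D c -> (forall s, D'
    s -> D s) -> scomp D' c.
Proof.
move=> [N0 h] sub; exists N0 => N /h [J [F hF]]; exists J, F => s /sub; exact: hF.
Qed.

Lemma comp_ext (D : store -> Prop) (c c' : store -> store) : scomp D c -> c =1 c' ->
    scomp D c'.
Proof. by move=> h e; rewrite -(_ : c = c') //; exact/funext. Qed.

Lemma comp_copy a t : scomp (fun=> True) (fun s => upd s t (s a)).
Proof. exact: (comp_mealy tt (fun _ b => (tt, b))). Qed.

Lemma comp_id : scomp (fun=> True) id.
Proof.
apply: comp_ext (comp_copy 0 0) _ => s; apply/funext => i.
by rewrite /upd; case: eqP => // ->.
Qed.

Lemma updE s t x i : upd s t x i = if i == t then x else s i. Proof. by []. Qed.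

Lemma upd_lt s t x i : i < t -> upd s t x i = s i.
Proof. by rewrite updE ltn_neqAle => /andP [/negbTE ->]. Qed.

(* On the domain [D], [f] is computed by stack programs: they transform the
   variable [t] in place, preserve the variables below [t], and are free to
   overwrite those above. *)
Definition fcomp G H {eG : Enc G} {eH : Enc H} (D : G -> Prop) (f : G -> H) : Prop :=
  forall t, exists c, scomp (fun s => exists2 g, D g & s t = enc g) c /\
    forall s g, D g -> s t = enc g ->
      c s t = enc (f g) /\ forall i, i < t -> c s i = s i.

Section Rules.
Context {G H K : Type} {eG : Enc G} {eH : Enc H} {eK : Enc K}.
Implicit Type D : G -> Prop.

Lemma fcomp_sub D D' (f : G -> H) : fcomp D f -> (forall x, D' x -> D x) -> fcomp D' f.
Proof.
move=> h sub t; have [c [hc hs]] := h t; exists c; split.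
  by apply: comp_sub hc _ => s [g /sub Dg e]; exists g.
by move=> s g /sub; exact: hs.
Qed.

Lemma fcomp_ext D (f f' : G -> H) : fcomp D f -> (forall x, D x -> f x = f' x) -> fcomp
    D f'.
Proof.
move=> h e t; have [c [hc hs]] := h t; exists c; split=> // s g Dg eg.
by rewrite -e //; exact: hs.
Qed.

Lemma fcomp_comp D (D' : H -> Prop) (f : G -> H) (g : H -> K) :
  fcomp D f -> fcomp D' g -> (forall x, D x -> D' (f x)) -> fcomp D (g \o f).
Proof.
move=> hf hg DD' t; have [c [hc hs]] := hf t; have [c' [hc' hs']] := hg t.
exists (c' \o c); split.
  apply: comp_seq hc hc' _ => s [x Dx e]; exists (f x); first exact: DD'.
  by have [] := hs s x Dx e.
move=> s x Dx e; have [e1 h1] := hs s x Dx e.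
by have [e2 h2] := hs' _ _ (DD' _ Dx) e1; split=> // i it; rewrite /= h2 ?h1.
Qed.

(** A program for the variable [t.+1] preserves the argument in [t], and one for [t.+2] preserves
    also the value of [f] in [t.+1]; a final exchange pairs the values. *)
Lemma fcomp_pair D (f : G -> H) (g : G -> K) :
  fcomp D f -> fcomp D g -> fcomp D (fun x => (f x, g x)).
Proof.
move=> hf hg t; have [c [hc hs]] := hf t.+1; have [c' [hc' hs']] := hg t.+2.
pose c1 s := c (upd s t.+1 (s t)).
pose c2 s := c' (upd (c1 s) t.+2 (c1 s t)).
pose c3 (s : store) := upd (upd (upd s t (rpair (s t.+1) (s t.+2)))
    t.+1 (unpair1 (s t))) t.+2 (unpair2 (s t)).
have h1 s x : D x -> s t = enc x -> c1 s t.+1 = enc (f x) /\ forall i, i <= t -> c1 s i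
    = s i.
  move=> Dx e; have [|e1 h] := hs (upd s t.+1 (s t)) x Dx; first by rewrite updE eqxx.
  by split=> // i it; rewrite /c1 h // upd_lt.
have h2 s x : D x -> s t = enc x -> [/\ c2 s t.+1 = enc (f x), c2 s t.+2 = enc (g x) &
    forall i, i < t -> c2 s i = s i].
  move=> Dx e; have [e1 k1] := h1 s x Dx e.
  have [|e2 k2] := hs' (upd (c1 s) t.+2 (c1 s t)) x Dx; first by rewrite updE eqxx k1.
  split=> //; first by rewrite /c2 k2 // upd_lt.
  move=> i it; have it1 : i < t.+2 by rewrite (ltn_trans it).
  by rewrite /c2 k2 // upd_lt // k1 // ltnW.
exists (c3 \o c2); split.
  have k1 : scomp (fun s => exists2 x, D x & s t = enc x) c1.
    apply: (comp_seq (f := fun s => upd s t.+1 (s t)) (g := c) (D' := fun s => exists2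
        x, D x & s t.+1 = enc x)) hc _.
      by apply: comp_sub (comp_copy t t.+1) _.
    by move=> s [x Dx e]; exists x => //; rewrite updE eqxx.
  apply: (comp_seq (D' := fun=> True)) => //; last first.
    by apply: comp_exchange; rewrite neq_ltn ?ltnSn // ltnW.
  apply: (comp_seq (f := fun s => upd (c1 s) t.+2 (c1 s t)) (g := c') (D' := fun s =>
      exists2 x, D x & s t.+2 = enc x)) hc' _.
    by apply: (comp_seq (f := c1) (g := fun s => upd s t.+2 (s t)) k1 (comp_copy t t.+2)).
  move=> s [x Dx e]; exists x => //; rewrite updE eqxx.
  by have [_ ->] := h1 s x Dx e.
move=> s x Dx e; have [e1 e2 e3] := h2 s x Dx e; split.
  rewrite /= /c3 !updE eqxx (ltn_eqF (ltnSn t)) ltn_eqF; last exact: ltnW.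
  by rewrite e1 e2.
by move=> i it; rewrite /= /c3 !updE !ltn_eqF ?e3 // ?(ltn_trans it) // ltnW.
Qed.

Lemma fcomp_if D (b : G -> bool) (f g : G -> H) :
  fcomp D b -> fcomp (fun x => D x /\ b x) f -> fcomp (fun x => D x /\ ~~ b x) g ->
  fcomp D (fun x => if b x then f x else g x).
Proof.
move=> hb hf hg t; have [c [hc hs]] := hb t.+1.
have [c1 [hc1 hs1]] := hf t; have [c2 [hc2 hs2]] := hg t.
pose c0 s := c (upd s t.+1 (s t)).
have h0 s x : D x -> s t = enc x -> c0 s t.+1 = enc (b x) /\ forall i, i <= t -> c0 s i
    = s i.
  move=> Dx e; have [|e1 h] := hs (upd s t.+1 (s t)) x Dx; first by rewrite updE eqxx.
  by split=> // i it; rewrite /c0 h // upd_lt.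
exists ((fun s => if s t.+1 0 then c1 s else c2 s) \o c0); split.
  apply: (comp_seq (D' := fun s => exists2 x, D x & s t = enc x /\ s t.+1 = enc (b x))).
  - apply: (comp_seq (f := fun s => upd s t.+1 (s t)) (g := c) (D' := fun s => exists2
      x, D x & s t.+1 = enc x)) hc _.
      by apply: comp_sub (comp_copy t t.+1) _.
    by move=> s [x Dx e]; exists x => //; rewrite updE eqxx.
  - apply: comp_if.
      apply: comp_sub hc2 _ => s [[x Dx [e eb]] eb0]; exists x => //; split=> //.
      by move: eb0; rewrite eb; case: (b x).
    apply: comp_sub hc1 _ => s [[x Dx [e eb]] eb0]; exists x => //; split=> //.
    by move: eb0; rewrite eb; case: (b x).
  - by move=> s [x Dx e]; have [e1 e2] := h0 s x Dx e; exists x; rewrite // e2.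
move=> s x Dx e; have [e1 e2] := h0 s x Dx e; rewrite /= e1.
have e3 : c0 s t = enc x by rewrite e2.
case eb: (b x) => /=.
  have [//|k1 k2] := hs1 (c0 s) x _ e3; split=> // i it.
  by rewrite k2 // e2 // ltnW.
have [|k1 k2] := hs2 (c0 s) x _ e3; first by rewrite eb.
by split=> // i it; rewrite k2 // e2 // ltnW.
Qed.

(** For functions that only change the type under which a real is read. *)
Lemma fcomp_recode D (f : G -> H) : (forall x, enc (f x) = enc x) -> fcomp D f.
Proof.
move=> e t; exists id; split; first exact: comp_sub comp_id _.
by move=> s x _ ->; rewrite e.
Qed.

Lemma fcomp_mealy (M : finType) (m0 : M) mu (f : G -> H) D :
  (forall x, enc (f x) = mealy m0 mu (enc x)) -> fcomp D f.
Proof.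
move=> e t; exists (fun s => upd s t (mealy m0 mu (s t))); split.
  by apply: comp_sub (comp_mealy m0 mu t t) _.
by move=> s x _ ex; split=> [|i it]; [rewrite updE eqxx ex e|rewrite upd_lt].
Qed.

Lemma limsup_const (u : nat -> real) x : (forall n, u n = x) -> limsup u = x.
Proof.
move=> h; apply/funext => k; apply: (asbool_equiv_eqP idP); split=> [/(_ 0) [m _]|xk n].
  by rewrite h.
by exists n; rewrite ?h.
Qed.

Lemma limsup_evconst (u : nat -> real) x N : (forall n, N <= n -> u n = x) -> limsup u
    = x.
Proof.
move=> h; apply/funext => k; apply: (asbool_equiv_eqP idP); split=> [/(_ N) [m Nm]|xk n].
  by rewrite h.
by exists (maxn n N); rewrite ?leq_maxl // h ?leq_maxr.
Qed.

Lemma limsup_rpair (u v : nat -> real) :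
  limsup (fun n => rpair (u n) (v n)) = rpair (limsup u) (limsup v).
Proof. by apply/funext => k; rewrite /limsup /rpair; case: (odd k). Qed.

(** The codes of the iterates belong to [G], but their limsup may be a code for another type. *)
Lemma fcomp_loop (f : G -> G) (g : G -> H) :
  fcomp (fun=> True) f -> (forall x, limsup (fun n => enc (iter n f x)) = enc (g x)) ->
  fcomp (fun=> True) g.
Proof.
move=> hf hg t; have [c [hc hs]] := hf t.
have hi s x n : s t = enc x -> iter n c s t = enc (iter n f x) /\
    forall i, i < t -> iter n c s i = s i.
  move=> e; elim: n => //= n [IH1 IH2]; have [e1 e2] := hs _ _ I IH1.
  by split=> // i it; rewrite e2 // IH2.
exists (fun s i => limsup (fun n => iter n c s i)); split.
  apply: comp_loop hc _ => s [x _ e]; exists (f x) => //.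
  by have [] := hs s x I e.
move=> s x _ e; split=> [|i it].
  rewrite -hg; congr limsup; apply/funext => n; by have [] := hi s x n e.
by apply: limsup_const => n; have [_ ->] := hi s x n e.
Qed.

End Rules.

Lemma fcomp_id G {eG : Enc G} (D : G -> Prop) : fcomp D (@id G).
Proof. exact: fcomp_recode. Qed.

Lemma fcomp_fst G H {eG : Enc G} {eH : Enc H} (D : G * H -> Prop) : fcomp D fst.
Proof.
move=> t; pose c1 (s : store) := upd (upd (upd s t (rpair (s t.+1) (s t.+2)))
    t.+1 (unpair1 (s t))) t.+2 (unpair2 (s t)).
exists ((fun s => upd s t (s t.+1)) \o c1); split.
  apply: (comp_seq (D' := fun=> True)) => //; last exact: comp_copy.
  by apply: comp_sub (comp_exchange _ _ _) _; rewrite // neq_ltn ?ltnSn // ltnW.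
move=> s [x y] _ e; split=> [|i it].
  by rewrite /= updE eqxx /c1 !updE (ltn_eqF (ltnSn _)) eqxx e /enc /= unpair1K.
rewrite /= upd_lt // /c1 !upd_lt // ?(ltn_trans it) //; exact: leqnSn.
Qed.

Lemma fcomp_snd G H {eG : Enc G} {eH : Enc H} (D : G * H -> Prop) : fcomp D snd.
Proof.
move=> t; pose c1 (s : store) := upd (upd (upd s t (rpair (s t.+1) (s t.+2)))
    t.+1 (unpair1 (s t))) t.+2 (unpair2 (s t)).
exists ((fun s => upd s t (s t.+2)) \o c1); split.
  apply: (comp_seq (D' := fun=> True)) => //; last exact: comp_copy.
  by apply: comp_sub (comp_exchange _ _ _) _; rewrite // neq_ltn ?ltnSn // ltnW.
move=> s [x y] _ e; split=> [|i it].
  by rewrite /= updE eqxx /c1 !updE eqxx e /enc /= unpair2K.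
rewrite /= upd_lt // /c1 !upd_lt // ?(ltn_trans it) //; exact: leqnSn.
Qed.

(** The domain is the set of inputs for which the run is known; a program that reads a presentation
    is guaranteed to halt on presented reals only. *)
Lemma fcomp_call H {eH : Enc H} p (f : real -> H) :
  fcomp (fun x : real => computes p x (enc (f x))) f.
Proof.
move=> t; exists (fun s => upd s t (enc (f (s t)))); split.
  apply: comp_sub (@comp_call p (fun x => enc (f x)) t t) _ => s [x hx e].
  by move: hx; rewrite /enc /= in e *; rewrite e.
by move=> s x _ ex; split=> [|i it]; [rewrite updE eqxx ex|rewrite upd_lt].
Qed.

Lemma fcomp_program H {eH : Enc H} (D : real -> Prop) (f : real -> H) :
  fcomp D f -> exists p, forall x, D x -> computes p x (enc (f x)).
Proof.
move=> h; have [c [hc hs]] := h 0.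
apply: (@comp_program D c (fun x => enc (f x)) 0).
  by apply: comp_sub hc _ => s Ds; exists (s 0).
by move=> x Dx; have [] := hs (ostore x) x Dx erefl.
Qed.

Notation computable f := (fcomp (fun=> True) f).

Section Total.
Context {G H K L : Type} {eG : Enc G} {eH : Enc H} {eK : Enc K} {eL : Enc L}.

Lemma cf_app (f : H -> K) (a : G -> H) :
  computable f -> computable a -> computable (fun x => f (a x)).
Proof. by move=> hf ha; exact: (fcomp_comp ha hf). Qed.

Lemma cf_app2 (f : H -> K -> L) (a : G -> H) (b : G -> K) :
  computable (fun p : H * K => f p.1 p.2) -> computable a -> computable b ->
  computable (fun x => f (a x) (b x)).
Proof. by move=> hf ha hb; exact: (fcomp_comp (fcomp_pair ha hb) hf). Qed.

Lemma cf_if (b : G -> bool) (f g : G -> H) :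
  computable b -> computable f -> computable g ->
  computable (fun x => if b x then f x else g x).
Proof.
by move=> hb hf hg; apply: fcomp_if => //; [apply: fcomp_sub hf _|apply: fcomp_sub hg _].
Qed.

End Total.

Lemma cf_fst G H K {eG : Enc G} {eH : Enc H} {eK : Enc K} (f : G -> H * K) : computable
    f -> computable (fun x => (f x).1).
Proof. move=> h; exact: (cf_app (@fcomp_fst _ _ _ _ _) h). Qed.

Lemma cf_snd G H K {eG : Enc G} {eH : Enc H} {eK : Enc K} (f : G -> H * K) : computable
    f -> computable (fun x => (f x).2).
Proof. move=> h; exact: (cf_app (@fcomp_snd _ _ _ _ _) h). Qed.

Lemma cf_zero G {eG : Enc G} : computable (fun _ : G => 0).
Proof. exact: (fcomp_mealy (m0 := tt) (mu := fun _ _ => (tt, false))). Qed.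

Lemma cf_false G {eG : Enc G} : computable (fun _ : G => false).
Proof. exact: (fcomp_mealy (m0 := tt) (mu := fun _ _ => (tt, false))). Qed.

Lemma cf_true G {eG : Enc G} : computable (fun _ : G => true).
Proof.
apply: (fcomp_mealy (m0 := true) (mu := fun m _ => (false, m))) => x.
by apply/funext => -[].
Qed.

Lemma cf_succ G {eG : Enc G} (f : G -> nat) : computable f -> computable (fun x => (f
    x).+1).
Proof.
move=> hf; apply: (cf_app (f := succn)) hf.
apply: (fcomp_mealy (m0 := true) (mu := fun m b => (b, m))) => x.
by apply/funext => -[].
Qed.

Lemma cf_nat (n : nat) G {eG : Enc G} : computable (fun _ : G => n).
Proof. by elim: n => [|n IH]; [exact: cf_zero|exact: (cf_succ IH)]. Qed.

Section Bool.
Context {G : Type} {eG : Enc G}.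
Implicit Types a b : G -> bool.

Lemma cf_not b : computable b -> computable (fun x => ~~ b x).
Proof.
move=> hb; apply: (@fcomp_ext _ _ _ _ _ (fun x => if b x then false else true)).
  by apply: cf_if => //; [exact: cf_false|exact: cf_true].
by move=> x _; case: (b x).
Qed.

Lemma cf_and a b : computable a -> computable b -> computable (fun x => a x && b x).
Proof.
move=> ha hb; apply: (@fcomp_ext _ _ _ _ _ (fun x => if a x then b x else false)) => //.
by apply: cf_if => //; exact: cf_false.
Qed.

Lemma cf_imp a b : computable a -> computable b -> computable (fun x => a x ==> b x).
Proof.
move=> ha hb; apply: (@fcomp_ext _ _ _ _ _ (fun x => if a x then b x else true)) => //.
by apply: cf_if => //; exact: cf_true.
Qed.

End Bool.

Section Pointwise.
Variable phi : bool -> bool -> bool.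

(** Keeps an even bit of the interleaved pair until the odd bit after it is read; so the result
    appears as the second component of a pair. *)
Let mu (m : option bool) (b : bool) : option bool * bool :=
  if m is Some a then (None, phi a b) else (Some b, false).

Let mu_state x y k : mealy_state None mu (rpair x y) k =
  if odd k then Some (x k./2) else None.
Proof.
by elim: k => //= k ->; rewrite /rpair uphalf_half; case: (odd k).
Qed.

Lemma cf_pointwise : computable (fun p : real * real => (fun k => phi (p.1 k) (p.2 k))
    : real).
Proof.
apply: (cf_snd (f := fun p : real * real => ((fun=> false) : real, (fun k => phi (p.1
    k) (p.2 k)) : real))).
apply: (fcomp_mealy (m0 := None) (mu := mu)) => -[x y].
apply/funext => k; rewrite /mealy mu_state /enc /= /enc_prod /enc /= /enc_real /rpair /=.
by case: (odd k).
Qed.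

End Pointwise.

Lemma fcomp_unpair1 : computable unpair1.
Proof.
apply: (cf_app (f := fst) (a := fun x : real => (unpair1 x, unpair2 x))).
  exact: fcomp_fst.
by apply: fcomp_recode => x; rewrite /enc /= /enc_prod /enc /= unpairK.
Qed.

Lemma fcomp_unpair2 : computable unpair2.
Proof.
apply: (cf_app (f := snd) (a := fun x : real => (unpair1 x, unpair2 x))).
  exact: fcomp_snd.
by apply: fcomp_recode => x; rewrite /enc /= /enc_prod /enc /= unpairK.
Qed.

(* The bits at [2 k] and [2 k + 1] are iteratively moved to [k], so that each bit
   eventually arrives at [0]. *)
Lemma fcomp_any : computable (fun x : real => `[< exists k, x k >]).
Proof.
pose por (x y : real) : real := fun k => x k || y k.
have hor : computable (fun p : real * real => por p.1 p.2).
  exact: (cf_pointwise orb).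
pose f x := por x (por (unpair1 x) (unpair2 x)).
have hf : computable f.
  exact: (cf_app2 hor (fcomp_id _) (cf_app2 hor fcomp_unpair1 fcomp_unpair2)).
pose lim (x : real) : real := limsup (fun n => iter n f x).
have hlim : computable lim by apply: (fcomp_loop hf).
have hhead : computable (fun x : real => x 0).
  apply: (fcomp_mealy (m0 := true) (mu := fun m b => (false, m && b))) => x.
  apply/funext => -[|k]; rewrite /mealy /enc /= /enc_bool /real_of_nat /enc_real;
    by case: (x 0).
apply: (fcomp_ext (cf_app hhead hlim)) => x _.
rewrite /lim /limsup; apply: asbool_equiv_eq; split=> [h|[k xk] n].
  have [m _ hm] := h 0; apply: contrapT => no.
  have : forall k, iter m f x k = false.
    elim: m {hm} => [|m IH] k /=; last by rewrite /f /por /unpair1 /unpair2 !IH.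
    by apply/negbTE/negP => xk; apply: no; exists k.
  by move=> /(_ 0); rewrite hm.
have hstep (y : real) j : y j -> f y j./2.
  move=> yj; rewrite /f /por /unpair1 /unpair2; move: (odd_double_half j).
  by case: (odd j); rewrite ?add1n ?add0n => ->; rewrite yj !orbT.
have hkeep (y : real) : y 0 -> f y 0 by rewrite /f /por => ->.
(* Induction on a bound for the position, which is halved in each round; a bit that has arrived at 0
   stays there. *)
have aux j : forall m (y : real), j <= m -> y j -> iter m f y 0.
  elim: j {-2}j (leqnn j) => [|j IH] i ij m y im yi.
    move: ij yi; rewrite leqn0 => /eqP -> y0.
    by elim: m {im} => //= m IH; exact: hkeep.
  case: i ij im yi => [|i] ij im yi.
    by elim: m {im} => //= m IHm; exact: hkeep.
  case: m im => // m im; rewrite iterSr.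
  apply: (IH i.+1./2) (hstep _ _ yi).
    by rewrite -ltnS (leq_trans _ ij) // ltn_half_double -addnn addSn ltnS leq_addl.
  by rewrite -ltnS (leq_trans _ im) // ltn_half_double -addnn addSn ltnS leq_addl.
by exists (maxn n k); [exact: leq_maxl|exact: aux (leq_maxr _ _) xk].
Qed.

Section Numbers.
Context {G : Type} {eG : Enc G}.

Lemma cf_anyb (phi : bool -> bool -> bool) (x y : G -> real) : computable x ->
    computable y ->
  computable (fun g => `[< exists k, phi (x g k) (y g k) >]).
Proof.
move=> hx hy; apply: (cf_app fcomp_any).
exact: (cf_app2 (f := fun u v : real => (fun k => phi (u k) (v k)) : real)
    (cf_pointwise phi)).
Qed.

Lemma cf_real_of_nat (n : G -> nat) : computable n -> computable (fun g => real_of_nat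
    (n g)).
Proof. by move=> h; apply: (cf_app (f := real_of_nat)) h; exact: fcomp_recode. Qed.

Lemma cf_ltn (n m : G -> nat) : computable n -> computable m ->
  computable (fun g => n g < m g).
Proof.
move=> hn hm.
have := cf_anyb (fun a b => ~~ a && b) (cf_real_of_nat hn) (cf_real_of_nat hm).
move/fcomp_ext; apply=> g _; apply: (asbool_equiv_eqP idP); split.
  by move=> [k /andP []]; rewrite /real_of_nat -leqNgt; exact: leq_ltn_trans.
by move=> nm; exists (n g); rewrite /real_of_nat ltnn.
Qed.

Lemma cf_eqn (n m : G -> nat) : computable n -> computable m ->
  computable (fun g => n g == m g).
Proof.
move=> hn hm; apply: (@fcomp_ext _ _ _ _ _ (fun g => ~~ (n g < m g) && ~~ (m g < n g))).
  by apply: cf_and; apply: cf_not; exact: cf_ltn.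
by move=> g _; case: ltngtP.
Qed.

(** Reduces reading a bit at a computed position to [fcomp_any]. *)
Definition onehot (n : nat) : real := fun k => k == n.

Lemma fcomp_onehot : computable onehot.
Proof.
pose mu (m b : bool) := (b, m && ~~ b).
apply: (fcomp_mealy (m0 := true) (mu := mu)) => n; apply/funext => k.
have st j : mealy_state true mu (enc n) j = (j <= n).
  by case: j.
rewrite /mealy st /mu /= /enc /= /enc_nat /real_of_nat /enc_real /onehot -leqNgt.
by rewrite eqn_leq.
Qed.

Lemma cf_bit (x : G -> real) (n : G -> nat) : computable x -> computable n ->
  computable (fun g => x g (n g)).
Proof.
move=> hx hn; have := cf_anyb andb hx (cf_app fcomp_onehot hn).
move/fcomp_ext; apply=> g _; apply: (asbool_equiv_eqP idP); split.
  by move=> [k /andP [xk /eqP <-]].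
by move=> xn; exists (n g); rewrite xn /onehot eqxx.
Qed.

(** The bits are computed one by one in a loop; with [fcomp_any] this yields number quantifiers. *)
Lemma cf_real (P : G -> nat -> bool) : computable (fun p : G * nat => P p.1 p.2) ->
  computable (P : G -> real).
Proof.
move=> hP; pose st := (G * nat * real)%type.
pose por (x y : real) : real := fun k => x k || y k.
have hor : computable (fun p : real * real => por p.1 p.2).
  exact: (cf_pointwise orb).
pose f (s : st) : st :=
  (s.1.1, s.1.2.+1, if P s.1.1 s.1.2 then por s.2 (onehot s.1.2) else s.2).
have h1 : computable (fun s : st => s.1.1) by do 2 apply: cf_fst; exact: fcomp_id.
have h2 : computable (fun s : st => s.1.2) by apply/cf_snd/cf_fst; exact: fcomp_id.
have h3 : computable (fun s : st => s.2) by apply/cf_snd; exact: fcomp_id.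
have hf : computable f.
  apply: fcomp_pair; first by apply: fcomp_pair => //; exact: cf_succ.
  apply: cf_if => //; first exact: (cf_app2 hP h1 h2).
  exact: (cf_app2 hor h3 (cf_app fcomp_onehot h2)).
(* The limit of the growing counter is the real with all bits 1, which is not the code of a number;
   so the limit has another type than the states. *)
pose g (s : st) : G * real * real := (s.1.1, fun=> true,
  fun k => s.2 k || ((s.1.2 <= k) && P s.1.1 k)).
have hiter n s : iter n f s = (s.1.1, s.1.2 + n,
    fun k => s.2 k || ((s.1.2 <= k < s.1.2 + n) && P s.1.1 k)).
  elim: n => [|n /= ->].
    rewrite addn0; case: s => -[a m] x /=; congr (_, _, _); apply/funext => k.
    by case: (ltnP k m) => /=; rewrite ?andbF ?orbF.
  rewrite /f /= addnS; congr (_, _, _); apply/funext => k.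
  case e: (P s.1.1 (s.1.2 + n)); rewrite /por /onehot ltnS (leq_eqVlt k).
    case: eqP => [->|_] /=; last by rewrite orbF.
    by rewrite e leq_addr !orbT.
  by case: eqP => [->|_] //=; rewrite e !andbF.
have hg : computable g.
  apply: (fcomp_loop hf) => -[[a m] x].
  rewrite (_ : (fun n => _) = fun n => rpair (rpair (enc a) (real_of_nat (m + n)))
      (fun k => x k || ((m <= k < m + n) && P a k))); last first.
    by apply/funext => n; rewrite hiter.
  rewrite !limsup_rpair /enc /= /enc_prod /=; congr rpair; first congr rpair.
  - exact: limsup_const.
  - apply/funext => k; apply/asboolP => n; exists (maxn n k.+1); first exact: leq_maxl.
    by rewrite /real_of_nat (leq_trans (leq_maxr n k.+1)) ?leq_addl.
  - apply/funext => k; apply: (asbool_equiv_eqP idP); split.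
      rewrite /enc /enc_real => /(_ 0) [n _ /=]; case: (x k) => //=.
      by move=> /andP [/andP [-> _] ->].
    rewrite /enc /= /enc_real => h n; exists (maxn n k.+1); first exact: leq_maxl.
    case: (x k) h => //= /andP [-> ->] /=.
    by rewrite (leq_trans (leq_maxr n k.+1)) ?leq_addl.
have hinit : computable (fun a : G => (a, 0, (fun=> false) : real)).
  apply: fcomp_pair; first by apply: fcomp_pair; [exact: fcomp_id|exact: cf_zero].
  exact: (fcomp_mealy (m0 := tt) (mu := fun _ _ => (tt, false))).
exact: cf_snd (cf_app hg hinit).
Qed.

Lemma cf_exists (P : G -> nat -> bool) : computable (fun p : G * nat => P p.1 p.2) ->
  computable (fun g => `[< exists n, P g n >]).
Proof. by move=> /cf_real hP; exact: cf_app fcomp_any hP. Qed.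

Lemma cf_forall (P : G -> nat -> bool) : computable (fun p : G * nat => P p.1 p.2) ->
  computable (fun g => `[< forall n, P g n >]).
Proof.
move=> hP; apply: (@fcomp_ext _ _ _ _ _ (fun g => ~~ `[< exists n, ~~ P g n >])).
  by apply: cf_not; apply: (cf_exists (P := fun g n => ~~ P g n)); exact: cf_not.
move=> g _; apply/idP/idP.
  by move=> /asboolPn h; apply/asboolP => n; apply: contrapT => /negP nP; apply: h;
      exists n.
by move=> /asboolP h; apply/asboolPn => -[n]; rewrite h.
Qed.

End Numbers.

(** The loop has omega rounds, but its state is constant once the counter has reached the bound. *)
Lemma cf_iter G {eG : Enc G} X {eX : Enc X} (h : G -> X -> X) (n : G -> nat) (x : G ->
    X) :
  computable (fun p : G * X => h p.1 p.2) -> computable n -> computable x ->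
  computable (fun g => iter (n g) (h g) (x g)).
Proof.
move=> hh hn hx; pose st := (G * nat * nat * X)%type.
pose f (s : st) : st :=
  if s.1.2 < s.1.1.2 then (s.1.1.1, s.1.1.2, s.1.2.+1, h s.1.1.1 s.2) else s.
have h1 : computable (fun s : st => s.1.1.1) by do 3 apply: cf_fst; exact: fcomp_id.
have h2 : computable (fun s : st => s.1.1.2) by apply/cf_snd/cf_fst/cf_fst;
    exact: fcomp_id.
have h3 : computable (fun s : st => s.1.2) by apply/cf_snd/cf_fst; exact: fcomp_id.
have h4 : computable (fun s : st => s.2) by apply/cf_snd; exact: fcomp_id.
have hf : computable f.
  apply: cf_if; [exact: cf_ltn| |exact: fcomp_id].
  apply: fcomp_pair; last exact: cf_app2 hh h1 h4.
  by apply: fcomp_pair; [exact: fcomp_pair|exact: cf_succ].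
pose g (s : st) : st := (s.1.1.1, s.1.1.2, maxn s.1.2 s.1.1.2,
  iter (s.1.1.2 - s.1.2) (h s.1.1.1) s.2).
have hiter m s : s.1.1.2 - s.1.2 <= m -> iter m f s = g s.
  elim: m s => [|m IH] [[[a k] i] y] /= hm.
    rewrite /g /=; move: hm; rewrite leqn0 => hm; rewrite (eqP hm) /=.
    by move: hm; rewrite subn_eq0 => /maxn_idPl ->.
  rewrite -iterS iterSr {2}/f /=; case: ltnP => ik.
    rewrite IH; last by rewrite /= subnS -ltnS prednK ?subn_gt0.
    rewrite /g /= (maxn_idPr ik) (maxn_idPr (ltnW ik)) subnS; congr (_, _).
    by rewrite -iterSr prednK // subn_gt0.
  by rewrite IH //= (eqP ik).
have hg : computable g.
  apply: (fcomp_loop hf) => s; apply: (limsup_evconst (N := s.1.1.2 - s.1.2)) => m hm.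
  by rewrite hiter.
have hinit : computable (fun a : G => (a, n a, 0, x a)).
  apply: fcomp_pair => //; apply: fcomp_pair; last exact: cf_zero.
  by apply: fcomp_pair => //; exact: fcomp_id.
have := cf_snd (cf_app hg hinit); move/fcomp_ext; apply=> a _.
by rewrite /g /= subn0.
Qed.

(** * Codes of formulas and the Tarski-Vaught condition *)

Ltac cfv := match goal with
  | H : fcomp _ ?f |- fcomp _ ?f => exact H
  | |- fcomp _ (fun p => p) => exact: fcomp_id
  | |- fcomp _ (@fst _ _) => exact: fcomp_fst
  | |- fcomp _ (@snd _ _) => exact: fcomp_snd
  | |- fcomp _ (fun p => fst (@?a p)) => apply: (cf_fst (f := a)); cfv
  | |- fcomp _ (fun p => snd (@?a p)) => apply: (cf_snd (f := a)); cfv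
  | H : fcomp _ ?f |- fcomp _ (fun p => ?f (@?a p)) =>
      apply: (cf_app (f := f) (a := a) H); cfv
  end.

Lemma cf_addn G {eG : Enc G} (n m : G -> nat) : computable n -> computable m ->
    computable (fun g => n g + m g).
Proof.
move=> hn hm; apply: (@fcomp_ext _ _ _ _ _ (fun g => iter (n g) succn (m g))).
  apply: (cf_iter (h := fun _ : G => succn)) => //.
  by apply: cf_succ; cfv.
by move=> g _; elim: (n g) => //= k ->.
Qed.

Lemma cf_pred G {eG : Enc G} (n : G -> nat) : computable n -> computable (fun g => (n
    g).-1).
Proof.
move=> hn.
apply: (@fcomp_ext _ _ _ _ _ (fun g => (iter (n g) (fun p => (p.1.+1, p.1)) (0, 0)).2)).
  apply: cf_snd; apply: (cf_iter (h := fun (_ : G) p => (p.1.+1, p.1))) => //.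
    by apply: fcomp_pair; [apply: cf_succ; cfv|cfv].
  by apply: fcomp_pair; exact: cf_zero.
move=> g _; have -> // : forall k, iter k (fun p => (p.1.+1, p.1)) (0, 0) = (k, k.-1).
by elim=> //= k ->.
Qed.

Lemma cf_of_nat G {eG : Enc G} (n : G -> nat) : computable n -> computable (fun g =>
    Cantor.of_nat (n g)).
Proof.
(* The successor of a pair in the diagonal enumeration by [Cantor.of_nat]. *)
move=> hn; pose st (p : nat * nat) := if 0 < p.1 then (p.1.-1, p.2.+1) else (p.2.+1, 0).
apply: (@fcomp_ext _ _ _ _ _ (fun g => iter (n g) st (0, 0))).
  apply: (cf_iter (h := fun _ : G => st)) => //; last by apply: fcomp_pair;
      exact: cf_zero.
  apply: (cf_app (f := st) (a := snd)); last exact: fcomp_snd.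
  apply: cf_if; first by apply: cf_ltn; [exact: cf_zero|cfv].
    by apply: fcomp_pair; [apply: cf_pred; cfv|apply: cf_succ; cfv].
  by apply: fcomp_pair; [apply: cf_succ; cfv|exact: cf_zero].
move=> g _; elim: (n g) => //= k ->; rewrite /st.
by case: (Cantor.of_nat k) => -[].
Qed.

Lemma cf_npair G {eG : Enc G} (n m : G -> nat) : computable n -> computable m ->
    computable (fun g => npair (n g) (m g)).
Proof.
(* The second component runs through the triangular numbers, which are the offsets of the
   diagonals. *)
move=> hn hm; pose st (p : nat * nat) := (p.1.+1, p.1.+1 + p.2).
apply: (@fcomp_ext _ _ _ _ _ (fun g => m g + (iter (m g + n g) st (0, 0)).2)).
  apply: cf_addn => //; apply: cf_snd.
  apply: (cf_iter (h := fun _ : G => st)); first 1 last.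
  - exact: cf_addn.
  - by apply: fcomp_pair; exact: cf_zero.
  apply: (cf_app (f := st) (a := snd)); last exact: fcomp_snd.
  by apply: fcomp_pair; [apply: cf_succ; cfv|apply: cf_addn; [apply: cf_succ; cfv|cfv]].
move=> g _; rewrite /npair /Cantor.to_nat plusE; congr (_ + _).
have -> // : forall k, iter k st (0, 0) = (k, nat_rec (fun=> nat) 0 (fun i m => i.+1 +
    m) k).
by elim=> //= k ->.
Qed.

Lemma cf_column G {eG : Enc G} (x : G -> real) (n m : G -> nat) : computable x ->
    computable n -> computable m ->
  computable (fun g => column (x g) (n g) (m g)).
Proof. by move=> hx hn hm; apply: cf_bit => //; exact: cf_npair. Qed.

Lemma of_npair n m : Cantor.of_nat (npair n m) = (n, m).
Proof. exact: Cantor.cancel_of_to. Qed.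

(** Codes 0 for the empty list and successors for the others; every number is the code of a list, so
    quantifiers over lists are quantifiers over numbers. *)
Definition lcons (a t : nat) : nat := (npair a t).+1.
Definition lhead (t : nat) : nat := (Cantor.of_nat t.-1).1.
Definition ltail (t : nat) : nat := if 0 < t then (Cantor.of_nat t.-1).2 else 0.
Definition lcode (l : seq nat) : nat := foldr lcons 0 l.
Definition lnth (t i : nat) : nat := lhead (iter i ltail t).
Definition lin (t i : nat) : bool := 0 < iter i ltail t.

Lemma lnth_code l i : lnth (lcode l) i = nth 0 l i.
Proof.
rewrite /lnth; elim: l i => [|a l IH] [|i] //=; last first.
- by rewrite -iterS iterSr /ltail of_npair /= IH.
- by rewrite /lhead /= of_npair.
- by rewrite (_ : iter i ltail 0 = 0) //; elim: i => //= i ->.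
Qed.

Lemma lin_code l i : lin (lcode l) i = (i < size l).
Proof.
rewrite /lin; elim: l i => [|a l IH] [|i] //=;
    last by rewrite -iterS iterSr /ltail /= of_npair IH.
by rewrite (_ : iter i ltail 0 = 0) //; elim: i => //= i ->.
Qed.

Lemma lcode_surj t : exists l, t = lcode l.
Proof.
elim: t {-2}t (leqnn t) => [|n IH] t; first by rewrite leqn0 => /eqP ->; exists [::].
case: t => [_|t tn]; first by exists [::].
case e: (Cantor.of_nat t) => [a u].
have et : t = npair a u by rewrite /npair -e Cantor.cancel_to_of.
have [|l ul] := IH u.
  apply: (leq_trans _ (tn : t <= n)); rewrite et.
  have /leP := Cantor.to_nat_non_decreasing a u.
  by rewrite plusE; apply: leq_trans; exact: leq_addr.
by exists (a :: l); rewrite /= /lcons et ul.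
Qed.

Lemma cf_lcons G {eG : Enc G} (t i : G -> nat) : computable t -> computable i ->
    computable (fun g => lcons (t g) (i g)).
Proof. by move=> ht hi; apply: cf_succ; exact: cf_npair. Qed.

Lemma cf_tails G {eG : Enc G} (t i : G -> nat) : computable t -> computable i ->
  computable (fun g => iter (i g) ltail (t g)).
Proof.
move=> ht hi; apply: (cf_iter (h := fun _ : G => ltail)) => //.
apply: cf_if; first by apply: cf_ltn; [exact: cf_zero|cfv].
  by apply/cf_snd/cf_of_nat/cf_pred; cfv.
exact: cf_zero.
Qed.

Lemma cf_lnth G {eG : Enc G} (t i : G -> nat) : computable t -> computable i ->
    computable (fun g => lnth (t g) (i g)).
Proof. by move=> ht hi; apply/cf_fst/cf_of_nat/cf_pred; exact: cf_tails. Qed.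

Lemma cf_lin G {eG : Enc G} (t i : G -> nat) : computable t -> computable i ->
    computable (fun g => lin (t g) (i g)).
Proof. by move=> ht hi; apply: cf_ltn; [exact: cf_zero|exact: cf_tails]. Qed.

(** A finite sequence of reals is given by a list of indices of columns of a fixed real [w], which
    makes quantification over such sequences arithmetical. *)
Definition word (w : real) (t : nat) : real := fun k =>
  let p := Cantor.of_nat k in
  if p.1 == 0 then lin t p.2 else lin t p.1.-1 && column w (lnth t p.1.-1) p.2.

Lemma word_code w l : word w (lcode l) = rseq [seq column w m | m <- l].
Proof.
apply/funext => k; rewrite /word /rseq; case: (Cantor.of_nat k) => [[|i] j] /=.
  by rewrite lin_code /real_of_nat size_map.
rewrite lin_code lnth_code; case: ltnP => il /=; first by rewrite (nth_map 0).
by rewrite nth_default // size_map.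
Qed.

Lemma cf_word G {eG : Enc G} (w : G -> real) (t : G -> nat) :
  computable w -> computable t -> computable (fun g => word (w g) (t g)).
Proof.
move=> hw ht; apply: (cf_real (P := fun g => word (w g) (t g))).
have ho : computable (fun p : G * nat => Cantor.of_nat p.2) by apply: cf_of_nat; cfv.
apply: cf_if.
- by apply: cf_eqn; [cfv|exact: cf_zero].
- by apply: cf_lin; cfv.
apply: cf_and; first by apply: cf_lin; [cfv|apply: cf_pred; cfv].
by apply: cf_column; [cfv|apply: cf_lnth; [cfv|apply: cf_pred; cfv]|cfv].
Qed.

(** Extends the columns of [u] by the codes of logical symbols and variables, that is, all
    numbers. *)
Definition alphabet (u : real) : real := fun k =>
  let p := Cantor.of_nat k in let q := Cantor.of_nat p.1 in
  if q.1 == 0 then p.2 < q.2 else column u q.2 p.2.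

Lemma alphabet_nat u n : column (alphabet u) (npair 0 n) = real_of_nat n.
Proof. by apply/funext => k; rewrite /column /alphabet of_npair /= of_npair. Qed.

Lemma alphabet_column u n : column (alphabet u) (npair 1 n) = column u n.
Proof. by apply/funext => k; rewrite /column /alphabet of_npair /= of_npair. Qed.

Lemma cf_alphabet G {eG : Enc G} (u : G -> real) :
  computable u -> computable (fun g => alphabet (u g)).
Proof.
move=> hu; apply: (cf_real (P := fun g => alphabet (u g))).
have ho : computable (fun p : G * nat => Cantor.of_nat p.2) by apply: cf_of_nat; cfv.
have hq : computable (fun p : G * nat => Cantor.of_nat (Cantor.of_nat p.2).1).
  by apply: cf_of_nat; cfv.
apply: cf_if; first by apply: cf_eqn; [cfv|exact: cf_zero].
  by apply: cf_ltn; cfv.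
by apply: cf_column; cfv.
Qed.

Section ClosedCheck.
Variable chi : real -> bool.
Hypothesis cf_chi : computable chi.

Definition below (z : real) (n a : nat) : bool :=
  `[< forall k, lin a k ==> z (npair (lnth a k) n) && (lnth a k != n) >].

Definition holds (u w : real) (t a : nat) : bool := chi (rpair (word u t) (word w a)).

Definition agree_off (i a b : nat) : bool :=
  `[< forall k, (k != i) && lin a k ==> lin b k && (lnth b k == lnth a k) >].

(** The witness is the entry [i] of a list [b], which may have to be longer than [a], since [i] can
    lie beyond the end of [a]. *)
Definition has_witness (u z w : real) (n t i a : nat) : bool :=
  `[< exists b, [&& below z n b, lin b i, agree_off i a b & holds u w t b] >].

(* The Tarski-Vaught condition for the elements that [w] lists below [n] in the
   order coded by [z]. *)
Definition closed_below (u z w : real) (n : nat) : bool :=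
  `[< forall t, `[< forall i, `[< forall a,
    below z n a && holds u w (lcons (npair 0 3) (lcons (npair 0 (4 + i)) t)) a ==>
    has_witness u z w n t i a >] >] >].

Definition some_closed (u z w : real) : bool :=
  `[< exists n, z (npair n n) && closed_below u z w n >].

Section Computable.
Context {G : Type} {eG : Enc G}.

Lemma cf_below (z : G -> real) (n a : G -> nat) :
  computable z -> computable n -> computable a ->
  computable (fun g => below (z g) (n g) (a g)).
Proof.
move=> hz hn ha; apply: cf_forall.
have h : computable (fun p : G * nat => lnth (a p.1) p.2) by apply: cf_lnth; cfv.
apply: cf_imp; first by apply: cf_lin; cfv.
apply: cf_and; first by apply: (cf_bit (x := fun p : G * nat => z p.1));
    [cfv|apply: cf_npair; cfv].
by apply/cf_not/cf_eqn; cfv.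
Qed.

Lemma cf_holds (u w : G -> real) (t a : G -> nat) :
  computable u -> computable w -> computable t -> computable a ->
  computable (fun g => holds (u g) (w g) (t g) (a g)).
Proof.
move=> hu hw ht ha; apply: (cf_app cf_chi).
apply: (@fcomp_ext _ _ _ _ _ ((fun p : real * real => rpair p.1 p.2) \o
  (fun g => (word (u g) (t g), word (w g) (a g))))) => //.
apply: (fcomp_comp (D' := fun=> True)) => //; last exact: fcomp_recode.
by apply: fcomp_pair; exact: cf_word.
Qed.

Lemma cf_agree_off (i a b : G -> nat) :
  computable i -> computable a -> computable b ->
  computable (fun g => agree_off (i g) (a g) (b g)).
Proof.
move=> hi ha hb; apply: cf_forall; apply: cf_imp; apply: cf_and.
- by apply/cf_not/cf_eqn; cfv.
- by apply: cf_lin; cfv.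
- by apply: cf_lin; cfv.
- by apply: cf_eqn; apply: cf_lnth; cfv.
Qed.

End Computable.

Lemma cf_has_witness G {eG : Enc G} (u z w : G -> real) (n t i a : G -> nat) :
  computable u -> computable z -> computable w -> computable n -> computable t ->
  computable i -> computable a ->
  computable (fun g => has_witness (u g) (z g) (w g) (n g) (t g) (i g) (a g)).
Proof.
move=> hu hz hw hn ht hi ha; apply: cf_exists.
apply: cf_and; first by apply: cf_below; cfv.
apply: cf_and; first by apply: cf_lin; cfv.
by apply: cf_and; [apply: cf_agree_off; cfv|apply: cf_holds; cfv].
Qed.

Lemma cf_closed_below G {eG : Enc G} (u z w : G -> real) (n : G -> nat) :
  computable u -> computable z -> computable w -> computable n ->
  computable (fun g => closed_below (u g) (z g) (w g) (n g)).
Proof.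
move=> hu hz hw hn; do 3 apply: cf_forall; apply: cf_imp.
  apply: cf_and; first by apply: cf_below; cfv.
  apply: cf_holds; try cfv.
  apply: cf_lcons; first exact: (cf_nat (npair 0 3)).
  apply: cf_lcons; last by cfv.
  by apply: cf_npair; [exact: cf_zero|apply: cf_addn; [exact: (cf_nat 4)|cfv]].
by apply: cf_has_witness; cfv.
Qed.

Lemma cf_some_closed G {eG : Enc G} (u z w : G -> real) :
  computable u -> computable z -> computable w ->
  computable (fun g => some_closed (u g) (z g) (w g)).
Proof.
move=> hu hz hw; apply: cf_exists; apply: cf_and.
  by apply: (cf_bit (x := fun p : G * nat => z p.1)); [cfv|apply: cf_npair; cfv].
by apply: cf_closed_below; cfv.
Qed.

End ClosedCheck.

(** * Formulas and elementary substructures *)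

Local Open Scope classical_set_scope.
Local Notation r0 := (real_of_nat 0).

Lemma real_of_nat_inj : injective real_of_nat.
Proof.
move=> n m e; apply/eqP; rewrite eqn_leq.
have h a b : real_of_nat a = real_of_nat b -> a <= b.
  move=> eab; rewrite leqNgt; apply/negP => ba.
  by have := congr1 (fun x : real => x b) eab; rewrite /real_of_nat ba ltnn.
by rewrite !h.
Qed.

Lemma rpair_inj x y x' y' : rpair x y = rpair x' y' -> x = x' /\ y = y'.
Proof.
by move=> e; split;
    [rewrite -(unpair1K x y) e unpair1K|rewrite -(unpair2K x y) e unpair2K].
Qed.

Lemma column_rseq0 s : column (rseq s) 0 = real_of_nat (size s).
Proof. by apply/funext => j; rewrite /column /rseq of_npair. Qed.

Lemma column_rseqS s i : column (rseq s) i.+1 = nth r0 s i.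
Proof. by apply/funext => j; rewrite /column /rseq of_npair. Qed.

Lemma rseq_inj : injective rseq.
Proof.
move=> s s' e; have es : size s = size s'.
  by apply: real_of_nat_inj; rewrite -!column_rseq0 e.
by apply: (@eq_from_nth _ r0) => // i _; rewrite -!column_rseqS e.
Qed.

Lemma seq_choice (T : Type) (x0 : T) n (P : nat -> T -> Prop) :
  (forall k, k < n -> exists x, P k x) ->
  exists t, size t = n /\ forall k, k < n -> P k (nth x0 t k).
Proof.
move=> h; have /choice [f hf] : forall k, exists x, k < n -> P k x.
  move=> k; case kn: (k < n); last by exists x0.
  by have [x Px] := h k kn; exists x.
exists (mkseq f n); split; first exact: size_mkseq.
by move=> k kn; rewrite nth_mkseq //; exact: hf.
Qed.

Lemma countable_enum T (t0 : T) (A : set T) : countable A ->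
  exists g : nat -> T, forall x, A x -> exists n, g n = x.
Proof.
move=> /countable_injP [f finj].
have /choice [g hg] : forall n, exists x, forall y, A y -> f y = n -> x = y.
  move=> n; case: (pselect (exists2 y, A y & f y = n)) => [[y Ay fy]|no].
    by exists y => y' Ay' fy'; apply: finj; rewrite ?inE // fy fy'.
  by exists t0 => y Ay fy; case: no; exists y.
by exists g => x Ax; exists (f x); exact: hg.
Qed.

Lemma enum_countable T (A : set T) (g : nat -> T) :
  (forall x, A x -> exists n, g n = x) -> countable A.
Proof.
move=> h; apply: (@sub_countable _ _ _ (range g)).
  by apply: subset_card_le => x /h [n <-]; exists n.
by apply: sub_countable (card_image_le _ _) _; exact: countableP.
Qed.

Section Syntax.
Variable L : language.
Hypothesis hL : computably_presented L.

Let gcode_nat (x : Defs.fsym L + rsym L) n : gcode x = real_of_nat n -> False.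
Proof. exact: gcode_nonlogical. Qed.

Lemma flatten_parse (I : eqType) (T : Type) (g g' : I -> seq T) (Q : I -> Prop) (s :
    seq I) :
  (forall i r r', g i ++ r = g' i ++ r' -> Q i /\ r = r') ->
  forall r r', flatten [seq g i | i <- s] ++ r = flatten [seq g' i | i <- s] ++ r' ->
  (forall i, i \in s -> Q i) /\ r = r'.
Proof.
move=> h; elim: s => [|i s IH] r r' //=; rewrite -!catA => /h [Qi /IH [Qs ->]].
by split=> // j; rewrite inE => /predU1P [->|/Qs].
Qed.

(** Unique readability of prefix notation; the remainders are there for the induction. *)
Lemma term_parse (t t' : term L) r r' :
  term_string t ++ r = term_string t' ++ r' -> t = t' /\ r = r'.
Proof.
elim: t t' r r' => [i|f a IH] [j|f' a'] r r' /= [].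
- by move=> /real_of_nat_inj/addnI -> ->.
- by move=> /esym /gcode_nat.
- by move=> /gcode_nat.
move=> /(gcode_inj hL) [ef]; subst f' => e.
have [|h ->] := flatten_parse (Q := fun i => a i = a' i) _ e.
  by move=> i r1 r1'; exact: IH.
split=> //; congr App; apply/funext => i; apply: h; exact: mem_enum.
Qed.

Lemma formula_parse (phi phi' : formula L) r r' :
  formula_string phi ++ r = formula_string phi' ++ r' -> phi = phi' /\ r = r'.
Proof.
elim: phi phi' r r' => [t u|R a|psi IH|psi IH chi IH'|i psi IH]
  [t' u'|R' a'|psi'|psi' chi'|i' psi'] r r' /= [];
  try by [move=> /real_of_nat_inj|move=> /gcode_nat|move=> /esym /gcode_nat].
- by rewrite -!catA => /term_parse [-> /term_parse [-> ->]].
- move=> /(gcode_inj hL) [eR]; subst R' => e.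
  have [|h ->] := flatten_parse (Q := fun i => a i = a' i) _ e.
    by move=> i r1 r1'; exact: term_parse.
  split=> //; congr Rel; apply/funext => i; apply: h; exact: mem_enum.
- by move=> /IH [-> ->].
- by rewrite -!catA => /IH [-> /IH' [-> ->]].
- by move=> /real_of_nat_inj/addnI -> /IH [-> ->].
Qed.

Lemma formula_string_inj : injective (@formula_string L).
Proof.
move=> phi psi e; have := @formula_parse phi psi [::] [::].
by rewrite !cats0 => /(_ e) [].
Qed.

(** Thanks to this, the closure condition can speak of arbitrary strings: membership in the diagram
    already ensures that they are formulas. *)
Lemma formula_string_Ex phi i s :
  formula_string phi = [:: real_of_nat 3, var_code i & s] ->
  exists2 psi : formula L, phi = Ex i psi & formula_string psi = s.
Proof.
case: phi => [t u|R a|psi|psi chi|j psi] /= [];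
  try by [move=> /real_of_nat_inj|move=> /gcode_nat].
by move=> /real_of_nat_inj/addnI -> <-; exists psi.
Qed.

Lemma term_bound (t : term L) : exists n, forall j, term_free t j -> j < n.
Proof.
elim: t => [i|f a IH]; first by exists i.+1 => j /= ->.
have [N hN] := choice IH; exists (\max_i N i) => j /= [i /hN h].
exact: leq_trans h (leq_bigmax i).
Qed.

Lemma free_bound (phi : formula L) : exists n, forall j, free phi j -> j < n.
Proof.
elim: phi => [t u|R a|psi IH//|psi [n hn] chi [m hm]|i psi [n hn]] /=.
- have [n hn] := term_bound t; have [m hm] := term_bound u; exists (maxn n m) => j.
  by rewrite leq_max => -[/hn ->//|/hm ->]; rewrite orbT.
- have [N hN] := choice (fun i => term_bound (a i)); exists (\max_i N i) => j [i /hN h].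
  exact: leq_trans h (leq_bigmax i).
- by exists (maxn n m) => j; rewrite leq_max => -[/hn ->//|/hm ->]; rewrite orbT.
- by exists n => j [_ /hn].
Qed.

Section Structure.
Variable A : structure L.

Lemma eval_dep (e e' : nat -> real) (t : term L) :
  (forall j, term_free t j -> e j = e' j) -> eval A e t = eval A e' t.
Proof.
elim: t => [i|f a IH] /= h; first exact: h.
by congr fint; apply/funext => i; apply: IH => j fj; apply: h; exists i.
Qed.

Lemma sat_dep (phi : formula L) (e e' : nat -> real) :
  (forall j, free phi j -> e j = e' j) -> sat A e phi <-> sat A e' phi.
Proof.
elim: phi e e' => [t u|R a|psi IH|psi IH chi IH'|i psi IH] e e' /= h.
- rewrite (@eval_dep e e' t) ?(@eval_dep e e' u) // => j fj; apply: h; auto.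
- rewrite (_ : (fun i => eval A e (a i)) = fun i => eval A e' (a i)) //.
  by apply/funext => i; apply: eval_dep => j fj; apply: h; exists i.
- by rewrite (IH e e').
- by rewrite (IH e e') ?(IH' e e') // => j fj; apply: h; auto.
- have hx x : sat A (fun j => if j == i then x else e j) psi <->
      sat A (fun j => if j == i then x else e' j) psi.
    apply: IH => j fj; case: eqP => // ji; exact: h.
  by split=> -[x Ax /hx]; exists x.
Qed.

Lemma diagram_in (phi : formula L) (a : seq real) :
  elementary_diagram A (rpair (formula_code phi) (rseq a)) <->
  [/\ forall i, i < size a -> univ A (nth r0 a i),
      forall j, free phi j -> j < size a & sat A (nth r0 a) phi].
Proof.
split=> [[psi [b [e h1 h2 h3]]]|[h1 h2 h3]]; last by exists phi, a.
have [/rseq_inj/formula_string_inj -> /rseq_inj ->] := rpair_inj e.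
by split.
Qed.

Lemma diagram_Ex i s a :
  elementary_diagram A (rpair (rseq [:: real_of_nat 3, var_code i & s]) (rseq a)) ->
  exists b, [/\ i < size b, forall k, k < size b -> univ A (nth r0 b k),
    forall k, k <> i -> k < size a -> k < size b /\ nth r0 b k = nth r0 a k &
    elementary_diagram A (rpair (rseq s) (rseq b))].
Proof.
move=> [phi [a' [e h1 h2 h3]]]; have [/rseq_inj e1 /rseq_inj ea] := rpair_inj e.
subst a'; have [psi ephi es] := formula_string_Ex (esym e1).
subst phi s; move: h3 => /= [x Ax hx].
(* If [i] lies beyond the end of [a], the gap is filled with [x] too, as all entries have to be in
   the universe. *)
pose v k := if (k == i) || (size a <= k) then x else nth r0 a k.
pose b := mkseq v (maxn i.+1 (size a)).
have hv k : univ A (v k).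
  rewrite /v; case: eqP => //= _; case: leqP => // ka; exact: h1.
have bk k : k < size b -> nth r0 b k = v k by rewrite size_mkseq => kb; rewrite nth_mkseq.
exists b; rewrite size_mkseq in bk *; split.
- exact: leq_maxl.
- by move=> k kb; rewrite bk.
- move=> k ki ka; have kb : k < maxn i.+1 (size a) by rewrite leq_max ka orbT.
  split=> //; rewrite bk // /v leqNgt ka orbF; by case: eqP => [/ki|].
have fb j : free psi j -> j < maxn i.+1 (size a).
  move=> fj; rewrite leq_max ltnS; case: (eqVneq j i) => [->|/eqP ji];
      first by rewrite leqnn.
  by rewrite (h2 j) ?orbT.
apply/(diagram_in psi b); rewrite size_mkseq; split=> //; first by move=> k kb;
    rewrite bk.
apply/(sat_dep (e' := fun j => if j == i then x else nth r0 a j)) => // j fj.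
rewrite bk ?fb // /v; case: eqP => //= ji; rewrite leqNgt.
by rewrite h2.
Qed.

End Structure.

Section Alphabet.
Variable U : real.
Hypothesis U_nat : forall n, exists m, column U m = real_of_nat n.
Hypothesis U_sym : forall x : Defs.fsym L + rsym L, exists m, column U m = gcode x.

Definition spell (l : seq nat) : seq real := [seq column U m | m <- l].

Let spelled (s : seq real) := exists l, s = spell l.

Let spelled_cons x s : (exists m, column U m = x) -> spelled s -> spelled (x :: s).
Proof. by move=> [m <-] [l ->]; exists (m :: l). Qed.

Let spelled_cat s s' : spelled s -> spelled s' -> spelled (s ++ s').
Proof. by move=> [l ->] [l' ->]; exists (l ++ l'); rewrite /spell map_cat. Qed.

Let spelled_flatten (I : Type) (g : I -> seq real) s :
  (forall i, spelled (g i)) -> spelled (flatten [seq g i | i <- s]).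
Proof.
by move=> h; elim: s => [|i s IH]; [exists [::]|exact: spelled_cat].
Qed.

Let spelled_term (t : term L) : spelled (term_string t).
Proof.
elim: t => [i|f a IH] /=; apply: spelled_cons.
- exact: U_nat.
- by exists [::].
- exact: U_sym.
- exact: spelled_flatten.
Qed.

Lemma formula_spelled (phi : formula L) : spelled (formula_string phi).
Proof.
elim: phi => [t u|R a|psi IH|psi IH chi IH'|i psi IH] /=;
  (apply: spelled_cons; first by [exact: U_nat|exact: U_sym]) => //.
- by apply: spelled_cat; exact: spelled_term.
- by apply: spelled_flatten => i; exact: spelled_term.
- exact: spelled_cat.
- by apply: spelled_cons => //; exact: U_nat.
Qed.

Variable A : structure L.

(** The set [X] may contain reals outside the universe, such as codes of symbols, since a
    presentation lists these as well. *)
Definition tv_closed (X : set real) : Prop := forall l i a,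
  (forall k, k < size a -> X (nth r0 a k)) ->
  elementary_diagram A (rpair (rseq [:: real_of_nat 3, var_code i & spell l]) (rseq a)) ->
  exists b, [/\ i < size b, forall k, k < size b -> X (nth r0 b k),
    forall k, k <> i -> k < size a -> k < size b /\ nth r0 b k = nth r0 a k &
    elementary_diagram A (rpair (rseq (spell l)) (rseq b))].

Section Closed.
Variable X : set real.
Hypothesis hX : tv_closed X.

Definition core : set real := [set x | univ A x /\ X x].

Lemma tv_witness (psi : formula L) i (a : seq real) :
  (forall k, k < size a -> core (nth r0 a k)) ->
  (forall j, free (Ex i psi) j -> j < size a) -> sat A (nth r0 a) (Ex i psi) ->
  exists2 x, core x & sat A (fun j => if j == i then x else nth r0 a j) psi.
Proof.
move=> ha hf hs; have [l el] := formula_spelled psi.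
have [|b [ib Xb hb]] := hX (l := l) (i := i) (fun k ka => (ha k ka).2).
  rewrite -el; apply/(diagram_in A (Ex i psi)); split=> //.
  by move=> k /ha [].
rewrite -el => /(diagram_in A psi) [Ab fb sb]; exists (nth r0 b i).
  by split; [exact: Ab|exact: Xb].
apply/(sat_dep A (e' := nth r0 b)) => // j fj; case: eqP => [->//|ji].
by rewrite (hb j ji _).2 //; apply: hf.
Qed.

(** A witness for the formula that something equals itself, which has no parameters. *)
Lemma core_nonempty : core !=set0.
Proof.
have [x Ax] := univ_nonempty A.
have [|||y Cy _] := @tv_witness (Eq (Var 0) (Var 0)) 0 [::] => //=.
- by move=> j [j0 [/j0|/j0]].
- by exists x.
- by exists y.
Qed.

(** The value is the only witness [x_n] for [x_n = f(x_0, ..., x_(n-1))], with [n] the arity. *)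
Lemma core_fint (f : Defs.fsym L) (a : 'I_(farity f) -> real) :
  (forall i, core (a i)) -> core (fint A a).
Proof.
move=> ha; pose n := farity f; pose s := [seq a i | i <- enum 'I_n].
have ss : size s = n by rewrite size_map size_enum_ord.
have ns (i : 'I_n) : nth r0 s i = a i.
  by rewrite (nth_map i) ?size_enum_ord // nth_ord_enum.
have [|||x Cx /=] := @tv_witness (Eq (Var n) (App (fun i : 'I_n => Var i))) n s.
- by move=> k; rewrite ss => kn; rewrite (ns (Ordinal kn)).
- by move=> j /= [jn [//|[i ->]]]; rewrite ss.
- exists (fint A a); first by apply: fint_closed => i; exact: (ha i).1.
  rewrite /= eqxx; congr fint; apply/funext => i.
  by rewrite ltn_eqF // ns.
rewrite eqxx (_ : (fun i : 'I_n => _) = a); first by move=> <-.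
by apply/funext => i; rewrite ltn_eqF // ns.
Qed.

Definition core_structure : structure L :=
  @Structure L core (@fint L A) (@rint L A) core_nonempty core_fint.

Lemma core_eval e t : eval core_structure e t = eval A e t.
Proof.
by elim: t => //= f a IH; congr (fint A); apply/funext => i; exact: IH.
Qed.

Lemma core_sat phi e : (forall i, core (e i)) -> sat core_structure e phi <-> sat A e phi.
Proof.
have upd_core e' i x : (forall j, core (e' j)) -> core x ->
  forall j, core (if j == i then x else e' j) by move=> ? ? j; case: ifP.
elim: phi e => [t u|R a|psi IH|psi IH chi IH'|i psi IH] e he /=.
- by rewrite !core_eval.
- rewrite (_ : (fun i => eval core_structure e (a i)) = fun i => eval A e (a i)) //.
  by apply/funext => i; rewrite core_eval.
- by rewrite IH.
- by rewrite IH // IH'.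
split=> [[x Cx /IH hx]|[x Ax hx]].
  by exists x; [case: Cx|apply: hx; exact: upd_core].
(* Closure is about finite lists of parameters, so [e] is cut off at a bound for the free
   variables. *)
have [n hn] := free_bound (Ex i psi).
pose a := mkseq e n.
have ae j : free (Ex i psi) j -> nth r0 a j = e j by move=> /hn jn; rewrite nth_mkseq.
have [|||y Cy] := @tv_witness psi i a.
- by move=> k; rewrite size_mkseq => kn; rewrite nth_mkseq.
- by rewrite size_mkseq.
- exact/(sat_dep A (phi := Ex i psi) ae)/(ex_intro2 _ _ x Ax hx).
move=> hy; exists y => //; apply/IH; first exact: upd_core.
apply/(sat_dep A (e' := fun j => if j == i then y else nth r0 a j)) => // j fj.
by case: eqP => // ji; rewrite ae.
Qed.

Lemma core_elementary : elementary_substructure core_structure A.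
Proof. by split=> // [x []//|phi e]; exact: core_sat. Qed.

(** By elementarity only the parameters remain to be tested; column 0 of the coded sequence tells
    how many there are. *)
Lemma core_diagram x : elementary_diagram core_structure x <->
  elementary_diagram A x /\
  forall i, unpair2 x (npair 0 i) -> core (column (unpair2 x) i.+1).
Proof.
have key phi a : (forall k, k < size a -> core (nth r0 a k)) ->
    (forall j, free phi j -> j < size a) ->
    sat core_structure (nth r0 a) phi <-> sat A (nth r0 a) phi.
  (* The default [r0] need not be in [core], whereas [core_sat] wants all values of the assignment
     there. *)
  move=> Ca fa; have [x0 C0] := core_nonempty.
  have ha j : free phi j -> nth r0 a j = nth x0 a j by move=> /fa ja;
      exact: set_nth_default.
  rewrite (sat_dep _ ha) (sat_dep A ha); apply: core_sat => j.
  by case: (ltnP j (size a)) => ja; [rewrite (set_nth_default r0) // ;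
      exact: Ca|rewrite nth_default].
have colE c a i : unpair2 (rpair c (rseq a)) (npair 0 i) = (i < size a).
  by rewrite unpair2K -[LHS]/(column (rseq a) 0 i) column_rseq0.
split=> [[phi [a [-> h1 h2 h3]]]|[[phi [a [-> h1 h2 h3]]] hC]].
  split; first by exists phi, a; split=> // [i /h1 []//|]; apply/key.
  by move=> i; rewrite colE unpair2K column_rseqS; exact: h1.
have Ca k : k < size a -> core (nth r0 a k).
  by move=> ka; have := hC k; rewrite colE unpair2K column_rseqS; exact.
by exists phi, a; split=> //; apply/key.
Qed.

End Closed.
End Alphabet.
End Syntax.

(** * Closed initial segments of a presentation *)

Section Segments.
Variables (L : language) (A : structure L) (U : real).
Hypothesis U_num : forall n, column U (npair 0 n) = real_of_nat n.
Variables (T : Type) (R : rel T) (s : T -> real).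
Hypothesis woR : wochoice.well_order R.

Definition segment (b : T) : set real := [set x | exists2 c, wlt R c b & s c = x].

Let chi (x : real) : bool := x \in elementary_diagram A.

Section Coded.
Variables (a : T) (z w : real) (e : T -> nat).
Let field := [set n | z (npair n n)].
Hypothesis z_field : forall n m, z (npair n m) -> field n /\ field m.
Hypothesis e_bij : set_bij [set b | R b a] field e.
Hypothesis z_R : forall b c, R b a -> R c a -> z (npair (e b) (e c)) = R b c.
Hypothesis w_s : forall b, R b a -> column w (e b) = s b.

Let e_inj b c : R b a -> R c a -> e b = e c -> b = c.
Proof. by case: e_bij => _ inj _ ba ca; apply: inj; rewrite inE. Qed.

Lemma belowP b m : R b a -> below z (e b) (lcode m) <->
  forall k, k < size m -> exists2 c, wlt R c b & e c = nth 0 m k.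
Proof.
move=> ba; split=> [/asboolP h k km|h].
  have := h k; rewrite lin_code km lnth_code /= => /andP [zk /eqP nk].
  have [fk _] := z_field zk; have [_ _ /(_ _ fk) [c ca ec]] := e_bij.
  exists c => //; rewrite -ec z_R // in zk nk.
  by case/(leqE_wlt woR): zk => // cb; case: nk; rewrite cb.
apply/asboolP => k; rewrite lin_code lnth_code; apply/implyP => /h [c cb <-].
have ca : R c a by apply: (wo_Rtrans woR _ ba); case/andP: cb.
rewrite z_R //; have /andP [-> _] := cb.
by apply/eqP => /(e_inj ca ba) ecb; move: cb; rewrite ecb wltE // wo_refl.
Qed.

(** The lists of numbers strictly below [e b] in the coded order name exactly the finite sequences
    from [segment b]. *)
Lemma closed_belowP b : R b a ->
  closed_below chi U z w (e b) <-> tv_closed U A (segment b).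
Proof.
move=> ba.
have leA c : wlt R c b -> R c a.
  by move=> /andP [cb _]; exact: (wo_Rtrans woR cb ba).
have holdsE t m : holds chi U w (lcode t) (lcode m) <->
    elementary_diagram A (rpair (rseq (spell U t)) (rseq [seq column w k | k <- m])).
  by rewrite /holds /chi !word_code inE.
(* The two letters are the existential quantifier, coded by 3, and the [i]-th variable, coded by
   [4 + i]. *)
have exE i l : spell U (npair 0 3 :: npair 0 (4 + i) :: l) =
    [:: real_of_nat 3, var_code i & spell U l] by rewrite /spell /= !U_num.
split=> h.
- move=> l i ra hra hED.
  have [k kb|m [sm hm]] := @seq_choice nat 0 (size ra) (fun k n => exists2 c, wlt R c b &
      e c = n /\ s c = nth r0 ra k).
    by have [c cb sc] := hra k kb; exists (e c), c.
  have em : ra = [seq column w k | k <- m].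
    apply: (@eq_from_nth _ r0); first by rewrite size_map sm.
    move=> k kr.
    rewrite (nth_map 0) ?sm //; have [c cb [<- <-]] := hm k kr.
    by rewrite w_s //; exact: leA.
  move/asboolP: h => /(_ (lcode l)) /asboolP /(_ i) /asboolP /(_ (lcode m)) /implyP h.
  have /h /asboolP [b'] : below z (e b) (lcode m) &&
      holds chi U w (lcons (npair 0 3) (lcons (npair 0 (4 + i)) (lcode l))) (lcode m).
    apply/andP; split.
      by apply/(belowP _ ba) => k; rewrite sm => /hm [c cb [ec _]]; exists c.
    by apply/(holdsE (npair 0 3 :: npair 0 (4 + i) :: l) m); rewrite exE -em.
  have [m' ->] := lcode_surj b'.
  move=> /and4P [/(belowP _ ba) hb]; rewrite lin_code => im' /asboolP hag /holdsE hED'.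
  exists [seq column w k | k <- m']; rewrite size_map; split=> //.
    move=> k km'; rewrite (nth_map 0) //; have [c cb <-] := hb k km'.
    by exists c => //; rewrite w_s //; exact: leA.
  move=> k /eqP ki; rewrite -sm => km; have := hag k.
  rewrite !lin_code !lnth_code ki km /= => /andP [km' /eqP ek].
  by rewrite km' em !(nth_map 0) // ek.
apply/asboolP => t; apply/asboolP => i; apply/asboolP => t'.
have [l ->] := lcode_surj t; have [m ->] := lcode_surj t'.
apply/implyP => /andP [/(belowP _ ba) hb].
move/(holdsE (npair 0 3 :: npair 0 (4 + i) :: l) m); rewrite exE => hED.
have [|ra [ira hra hag hED']] := h l i _ _ hED.
  move=> k; rewrite size_map => km; have [c cb ec] := hb k km.
  by exists c => //; rewrite (nth_map 0) // -ec w_s //; exact: leA.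
(* [agree_off] compares indices and not reals, and a real may have several indices; so where the
   lists have to agree, the index is taken from [m]. *)
have [k kr|m' [sm' hm']] := @seq_choice nat 0 (size ra) (fun k n => exists2 c, wlt R c b &
    [/\ e c = n, s c = nth r0 ra k & k <> i -> k < size m -> n = nth 0 m k]).
  case: (pselect (k <> i /\ k < size m)) => [[ki km]|no].
    have [c cb ec] := hb k km; exists (e c), c => //; split=> //.
    have [|_ ->] := hag k ki; first by rewrite size_map.
    by rewrite (nth_map 0) // -ec w_s //; exact: leA.
  have [c cb sc] := hra k kr; exists (e c), c => //; split=> // ki km.
  by case: no.
have em : ra = [seq column w k | k <- m'].
  apply: (@eq_from_nth _ r0); first by rewrite size_map sm'.
    move=> k kr.
  rewrite (nth_map 0) ?sm' //; have [c cb [<- <- _]] := hm' k kr.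
  by rewrite w_s //; exact: leA.
apply/asboolP; exists (lcode m'); apply/and4P; split.
- by apply/(belowP _ ba) => k; rewrite sm' => /hm' [c cb [ec _ _]]; exists c.
- by rewrite lin_code sm'.
- apply/asboolP => k; rewrite !lin_code !lnth_code; apply/implyP => /andP [/eqP ki km].
  have [|kr _] := hag k ki; first by rewrite size_map.
  by have [c cb [_ _ ->]] := hm' k kr; rewrite // sm' kr eqxx.
- by apply/holdsE; rewrite -em.
Qed.

Lemma some_closedP : some_closed chi U z w <->
  exists2 b, R b a & tv_closed U A (segment b).
Proof.
split=> [/asboolP [n /andP [zn hn]]|[b ba hb]].
  have [_ _ /(_ n zn) [b ba eb]] := e_bij; exists b => //.
  by apply/(closed_belowP ba); rewrite eb.
apply/asboolP; exists (e b); rewrite z_R // wo_refl //=.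
exact/(closed_belowP ba).
Qed.

End Coded.

Hypothesis hL : computably_presented L.
Hypothesis R_count : forall a, countable [set b | R b a].
Hypothesis A_range : univ A `<=` range s.
Hypothesis A_uncount : ~ countable (univ A).

Let strict_bound (g : nat -> T) : exists t, forall n, wlt R (g n) t.
Proof.
apply: contrapT => no; apply: A_uncount.
have hg t : exists n, R t (g n).
  apply: contrapT => nt; apply: no; exists t => n; rewrite wltE //.
  by apply/negP => tn; apply: nt; exists n.
have /choice [h hh] : forall n, exists f : nat -> T, forall b, R b (g n) -> exists k, f
    k = b.
  by move=> n; exact: (countable_enum (g n) (R_count (g n))).
apply: (@enum_countable _ _ (fun k => s (h (Cantor.of_nat k).1 (Cantor.of_nat k).2)))
    => x Ax.
have [t _ <-] := A_range Ax; have [n tn] := hg t; have [k hk] := hh n t tn.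
by exists (npair n k); rewrite of_npair /= hk.
Qed.

Let witness (t0 : T) l i (m : seq T) :
  elementary_diagram A (rpair (rseq [:: real_of_nat 3, var_code i & spell U l])
    (rseq (map s m))) ->
  exists m' : seq T, [/\ i < size m',
    forall k, k <> i -> k < size m -> k < size m' /\ s (nth t0 m' k) = s (nth t0 m k) &
    elementary_diagram A (rpair (rseq (spell U l)) (rseq (map s m')))].
Proof.
move=> /(diagram_Ex hL) [b [ib hb hag hED]].
have [k kb|m' [sm' hm']] := @seq_choice T t0 (size b) (fun k t => s t = nth r0 b k).
  by have [t _ st] := A_range (hb k kb); exists t.
have eb : b = map s m'.
  apply: (@eq_from_nth _ r0); first by rewrite size_map sm'.
  by move=> k kb; rewrite (nth_map t0) ?sm' // hm'.
exists m'; rewrite sm' -eb; split=> // k ki km.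
have [|kb ek] := hag k ki; first by rewrite size_map.
by rewrite hm' // ek (nth_map t0).
Qed.

(** A Skolem hull built inside the index order: [nx b] is above all chosen witnesses for parameters
    up to [b], and [a] is the least strict bound of the iterates [c n]. By leastness these are
    cofinal below [a], so finitely many parameters lie up to some [c N], and their witnesses below
    [c N.+1]. *)
Lemma closed_segment : exists a, tv_closed U A (segment a).
Proof.
have [x0 /A_range [t0 _ _]] := univ_nonempty A.
have /choice [W1 hW1] : forall p : seq nat * nat * seq T, exists m',
    elementary_diagram A (rpair (rseq [:: real_of_nat 3, var_code p.1.2 & spell U p.1.1])
      (rseq (map s p.2))) ->
    [/\ p.1.2 < size m',
    forall k, k <> p.1.2 -> k < size p.2 -> k < size m' /\ s (nth t0 m' k) = s (nth t0
        p.2 k) &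
    elementary_diagram A (rpair (rseq (spell U p.1.1)) (rseq (map s m')))].
  move=> [[l i] m] /=; set P := elementary_diagram A _.
  case: (pselect P) => [/(witness t0) [m' h]|no]; last by exists [::].
  by exists m'.
have /choice [en hen] : forall a, exists f : nat -> T, forall b, R b a -> exists k, f k
    = b.
  by move=> a; exact: (countable_enum a (R_count a)).
(* Enumerates [a], which makes [nx] increasing, and the entries of the witness lists for parameters
   up to [a]. The parameters are named by numbers through [en a], so that the tasks are
   countable. *)
pose H a (n : nat) : T := if n is n'.+1 then
    if @unpickle (seq nat * nat * seq nat * nat)%type n' is Some (l, i, m, k)
    then nth t0 (W1 (l, i, map (en a) m)) k else t0
  else a.
have /choice [nx hnx] : forall a, exists t, forall n, wlt R (H a n) t.
  by move=> a; exact: strict_bound.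
pose c n := iter n nx t0.
have [a [ha amin]] : exists a, (forall n, wlt R (c n) a) /\
    forall b, (forall n, wlt R (c n) b) -> R a b.
  by apply: (wo_least woR); exact: strict_bound.
have cS n : wlt R (c n) (c n.+1) by exact: (hnx (c n) 0).
have cmono n m : n <= m -> R (c n) (c m).
  elim: m => [|m IH]; first by rewrite leqn0 => /eqP ->; exact: wo_refl.
  rewrite leq_eqVlt => /predU1P [->|nm]; first exact: wo_refl.
  by apply: (wo_Rtrans woR (IH nm)); case/andP: (cS m).
have cof b : wlt R b a -> exists n, R b (c n).
  move=> ba; apply: contrapT => no.
  suff : R a b by apply/negP; rewrite -wltE.
  by apply: amin => n; rewrite wltE //; apply/negP => bn; apply: no; exists n.
exists a => l i ra hra hED.
have [k kr|m [sm hm]] := @seq_choice T t0 (size ra) (fun k t => wlt R t a /\ s t = nth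
    r0 ra k).
  by have [t ta st] := hra k kr; exists t.
have era : ra = map s m.
  apply: (@eq_from_nth _ r0); first by rewrite size_map sm.
    move=> k kr.
  by rewrite (nth_map t0) ?sm //; have [_ ->] := hm k kr.
have [N hN] : exists N, forall k, k < size m -> R (nth t0 m k) (c N).
  have : forall k, k < size m -> wlt R (nth t0 m k) a.
    by move=> k; rewrite sm => /hm [].
  elim: m {sm hm era} => [|t m IH] h; first by exists 0.
  have [|N hN] := IH; first by move=> k km; exact: (h k.+1).
  have [n hn] := cof t (h 0 isT); exists (maxn n N) => -[|k] /= km.
    exact: (wo_Rtrans woR hn (cmono _ _ (leq_maxl _ _))).
  exact: (wo_Rtrans woR (hN k km) (cmono _ _ (leq_maxr _ _))).
have [k km|m1 [sm1 hm1]] := @seq_choice nat 0 (size m) (fun k n => en (c N) n = nth t0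
    m k).
  exact: hen (hN k km).
have em : m = map (en (c N)) m1.
  apply: (@eq_from_nth _ t0); first by rewrite size_map sm1.
  move=> k km.
  by rewrite (nth_map 0) ?sm1 // hm1.
have [|iw hag hEDw] := hW1 (l, i, m); first by rewrite /= -era.
exists (map s (W1 (l, i, m))); rewrite size_map; split=> //.
- move=> k kw; exists (nth t0 (W1 (l, i, m)) k); last by rewrite (nth_map t0).
  have := hnx (c N) (pickle (l, i, m1, k)).+1; rewrite /H pickleK -em => h.
  exact: (wo_trans (wo_strict woR) h (ha N.+1)).
- move=> k ki; rewrite -sm => km; have [kw ek] := hag k ki km; split=> //.
  by rewrite era !(nth_map t0).
Qed.

End Segments.

(** * The decision procedure *)

Lemma cf_writable y G {eG : Enc G} : writable y -> computable (fun _ : G => y).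
Proof.
move=> [p hp]; apply: (fcomp_comp (f := fun _ : G => real_of_nat 0) (g := fun=> y)).
- exact: (fcomp_mealy (m0 := tt) (mu := fun _ _ => (tt, false))).
- exact: fcomp_call p _.
- by [].
Qed.

Lemma cf_decidable (S : set real) : decidable_set S -> computable (fun x : real => x
    \in S).
Proof.
by move=> [p hp]; apply: fcomp_sub (fcomp_call p _) _ => x _; exact: hp.
Qed.

Lemma decidable_computable (S : set real) (f : real -> bool) :
  computable f -> (forall x, f x <-> S x) -> decidable_set S.
Proof.
move=> /fcomp_program [p hp] h; exists p => x.
by rewrite (_ : (x \in S) = f x); [exact: hp|apply/idP/idP; rewrite inE => /h].
Qed.

Theorem theorem29 (L : language) (A : structure L)
  (hL : computably_presented L)
  (hLw : coded_by_writable L)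
  (hA : decidable_model A)
  (hAw : well_presented A)
  (hAu : ~ countable (univ A)) :
  exists B : structure L,
    [/\ decidable_model B, countable (univ B) & elementary_substructure B A].
Proof.
have [x0 wx0 [d [u [ex0 hsym]]]] := hLw.
have [hAuniv /cf_decidable cchi] := hA.
have [T [R [s [woR Rc [_ Ar] [p hp]]]]] := hAw.
(* Columns of [u] with index outside [d] may be arbitrary reals. They do no harm, since the diagram
   only contains codes of genuine formulas. *)
pose U := alphabet u.
have U_num n : column U (npair 0 n) = real_of_nat n by exact: alphabet_nat.
have U_nat n : exists m, column U m = real_of_nat n by exists (npair 0 n).
have U_sym (x : Defs.fsym L + rsym L) : exists m, column U m = gcode x.
  have : symbol_codes L (gcode x) by exists x.
  by rewrite hsym => -[n _ e]; exists (npair 1 n); rewrite alphabet_column.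
have cU G (eG : Enc G) : computable (fun _ : G => U).
  apply: cf_alphabet.
  apply: (@fcomp_ext _ _ _ _ _ (fun _ : G => unpair2 x0)); last by rewrite ex0 unpair2K.
  exact: (cf_app fcomp_unpair2 (cf_writable wx0)).
have [a0] := closed_segment U woR hL Rc Ar hAu.
move=> /(ex_intro (fun a => tv_closed U A (segment R s a)) a0).
move=> /(wo_least woR) [alpha [halpha amin]] {a0}.
pose B := core_structure hL U_nat U_sym halpha.
have [t0 _] : exists t : T, True by have [x /Ar [t _ _]] := univ_nonempty A; exists t.
(* [pres] reads the presentation at the least index of its argument, since [s]
   need not be injective. *)
have /choice [q hq] : forall x, exists q : T * real, range s x ->
    [/\ s q.1 = x, forall b, s b = x -> R q.1 b, computes p x q.2 & codes_segment R s
        q.1 q.2].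
  move=> x; case: (pselect (range s x)) => [[t _ st]|no]; last by exists (t0, x).
  have [a [sa am]] := wo_least woR (P := fun a => s a = x) (ex_intro _ t st).
  by have [y py hy] := hp a; exists (a, y) => _; rewrite -sa /=; split=> // b;
      rewrite sa; exact: am.
pose pres x := (q x).2.
pose chi (x : real) := x \in elementary_diagram A.
pose bad y := some_closed chi U (unpair1 y) (unpair2 y).
(* The code [pres x] reaches up to the least index of [x]; a closed segment is found in it iff this
   index is at least [alpha], because [alpha] is the least closed one. *)
have badP x : univ A x -> bad (pres x) <-> ~ segment R s alpha x.
  move=> Ax; have [sx xmin _ [z [w [ey [fz [e [eb ez ew]]]]]]] := hq x (Ar _ Ax).
  rewrite /bad /pres ey unpair1K unpair2K.
  rewrite (some_closedP A U_num woR fz eb ez ew).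
  split=> [[b bq /amin ab] [c ca sc]|nx].
    have := wo_Rtrans woR (wo_Rtrans woR ab bq) (xmin c sc).
    by apply/negP; rewrite -wltE.
  exists alpha => //; case e0: (R alpha (q x).1) => //; case: nx.
  by exists (q x).1 => //; rewrite wltE // e0.
pose f (x : real) := if x \in univ A then ~~ bad (pres x) else false.
have fP x : f x <-> core A (segment R s alpha) x.
  rewrite /f; case: (pselect (univ A x)) => Ax; last by rewrite memNset //;
      split=> // -[].
  rewrite mem_set //.
  split=> [/negP nb|[_ sx]]; last by apply/negP => hb; exact: (badP x Ax).1 hb sx.
  by split=> //; apply: contrapT => ns; apply: nb; exact: (badP x Ax).2.
have cf : computable f.
  (* Membership in the universe is decided first, since [p] may fail to halt on reals that are not
     presented. *)
  apply: fcomp_if; [exact: cf_decidable| |by apply: fcomp_sub; first exact: cf_false].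
  apply: (fcomp_comp (f := pres) (g := fun y => ~~ bad y) (D' := fun=> True)) => //.
    apply: fcomp_sub (fcomp_call p pres) _ => x [_]; rewrite inE => /Ar hx.
    by have [] := hq x hx.
  apply: cf_not; apply: (cf_some_closed cchi) => //.
  - exact: fcomp_unpair1.
  - exact: fcomp_unpair2.
exists B; split; last exact: core_elementary.
- split; first exact: (decidable_computable cf).
  pose g (x : real) := chi x && `[< forall i, unpair2 x (npair 0 i) ==>
    f (column (unpair2 x) i.+1) >].
  apply: (decidable_computable (f := g)); last first.
    move=> x; rewrite core_diagram /g; split=> [/andP [h1 /asboolP h2]|[h1 h2]].
      by split=> [|i hi]; [rewrite inE in h1|have := h2 i; rewrite hi => /fP].
    apply/andP; split; first by rewrite /chi inE.
    by apply/asboolP => i; apply/implyP => /h2 /fP.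
  apply: cf_and => //; apply: (cf_forall (P := fun x i => unpair2 x (npair 0 i) ==>
    f (column (unpair2 x) i.+1))).
  have h2 : computable (fun p : real * nat => unpair2 p.1).
    exact: (cf_app fcomp_unpair2 (fcomp_fst _)).
  apply: cf_imp.
    apply: (cf_bit (x := fun p : real * nat => unpair2 p.1)) => //.
    by apply: cf_npair; [exact: cf_zero|exact: fcomp_snd].
  apply: (cf_app cf);
      apply: (cf_real (P := fun p : real * nat => column (unpair2 p.1) p.2.+1)).
  apply: cf_column; last exact: fcomp_snd.
    exact: (cf_app h2 (fcomp_fst _)).
  by apply: cf_succ; apply: cf_snd; exact: fcomp_fst.
- have [h hh] := countable_enum alpha (Rc alpha).
  apply: (@enum_countable _ _ (s \o h)) => x [_ [c /andP [ca _] <-]].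
  by have [n <-] := hh c ca; exists n.
Qed.
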